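(* Consider the zero-temperature Glauber dynamics on a $d$-regular tree, where $d\ge 2$ is even. Assume that the initial spins are i.i.d. symmetric $\pm1$ random variables. Then with probability $1$ (with respect to the initial configuration, clock rings and coin tosses) the dynamics does not freeze, i.e. almost surely there exists a vertex which flips its spin infinitely many times.
   Context: The zero-temperature Glauber dynamics for the Ising model on a graph $G=(V,E)$ is the following continuous-time Markov process $\sigma_t$ on $\{-1,1\}^V$. Independent Poisson clocks of rate $1$ are assigned to the vertices. When the clock of $x$ rings, consider $\Delta\mathcal{H}_x(\sigma)=2\sum_{y\sim x}\sigma_x\sigma_y$, the change of the energy $-\sum_{x\sim y}\sigma_x\sigma_y$ caused by flipping the spin at $x$. If it is negative the spin at $x$ is flipped; if it is positive nothing is done; if it is zero the spin at $x$ is flipped with probability $1/2$ according to a fair coin toss. All coin tosses are independent of each other, of the initial configuration and of the ring times. The dynamics freezes if every vertex flips only finitely many times, i.e. $\lim_{t\to\infty}\sigma_t$ exists pointwise. *)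

(* Defs.v *)
From HB Require Import structures.
From mathcomp Require Import all_boot all_order all_algebra.
From mathcomp Require Import all_classical all_reals all_analysis.
Set Implicit Arguments.
Unset Strict Implicit.
Unset Printing Implicit Defensive.
Import Order.TTheory GRing.Theory Num.Theory.
Import numFieldNormedType.Exports.
Local Open Scope classical_set_scope.
Local Open Scope ring_scope.

Definition neighbors (V : choiceType) (e : rel V) (x : V) : set V :=
  [set y | e x y].

Definition is_tree (V : choiceType) (e : rel V) : Prop :=
  [/\ [set: V] !=set0,
      symmetric e /\ irreflexive e,
      (forall x y : V, exists2 p : seq V, path e x p & last x p = y)
    & (* No simple cycle; [:: x; y] is a [cycle] as soon as [e x y]. *)
      (forall c : seq V, ucycle e c -> (size c <= 2)%N)].

Definition is_regular (V : choiceType) (e : rel V) (d : nat) : Prop :=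
  forall x : V, (neighbors e x #= `I_d)%card.

(* The spin space {-1, 1} is encoded by [bool]: [true] is +1, [false] is -1. *)
Definition spin (b : bool) : int := if b then 1 else -1.

Definition energy_change (V : choiceType) (e : rel V) (s : V -> bool) (x : V)
    : int :=
  2 * \sum_(y \in neighbors e x) spin (s x) * spin (s y).

(* The spin at [x] after its clock has rung in the configuration [s]; the coin
   [c] only matters when there is a tie. *)
Definition glauber_update (V : choiceType) (e : rel V) (c : bool)
    (s : V -> bool) (x : V) : bool :=
  if energy_change e s x < 0 then ~~ s x
  else if 0 < energy_change e s x then s x
  else if c then ~~ s x else s x.

(* [tau x k] is the [k]-th waiting time of the clock of [x], hence [n = 0]
   gives the first ring. *)
Definition ring_time (R : realType) (V : choiceType) (tau : V -> nat -> R)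
    (x : V) (n : nat) : R :=
  \sum_(k < n.+1) tau x k.

(* [sigma] is a trajectory, on times [t >= 0], driven by the waiting times
   [tau] and the coins [coin]. The pre-ring configuration sigma_{t-} is
   expressed by [sigma s] for all [s < t] close enough to [t]. *)
Definition glauber_trajectory (R : realType) (V : choiceType) (e : rel V)
    (tau : V -> nat -> R) (coin : V -> nat -> bool) (sigma : R -> V -> bool)
    : Prop :=
  (forall (x : V) (s t : R), 0 <= s -> s <= t ->
     (forall n, ~~ (s < ring_time tau x n <= t)) ->
     sigma t x = sigma s x) /\
  (forall (x : V) (n : nat), let t := ring_time tau x n in
     \forall s \near t^'-, sigma t x = glauber_update e (coin x n) (sigma s) x).

Definition flip_times (R : realType) (V : choiceType) (sigma : R -> V -> bool)
    (x : V) : set R :=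
  [set t : R | 0 < t /\ \forall s \near t^'-, sigma t x != sigma s x].

Definition freezes (R : realType) (V : choiceType) (sigma : R -> V -> bool)
    : Prop :=
  forall x : V, finite_set (flip_times sigma x).

Definition mutually_independent (R : realType) (disp : measure_display)
    (Omega : measurableType disp) (P : probability Omega R) (I : choiceType)
    (F : I -> set_system Omega) : Prop :=
  forall (s : seq I) (E : I -> set Omega), uniq s ->
    (forall i, i \in s -> F i (E i)) ->
    P (\bigcap_(i in [set` s]) E i) = (\prod_(i <- s) P (E i))%E.

Definition generated_sigma_algebra (disp disp' : measure_display)
    (Omega : measurableType disp) (T : measurableType disp')
    (X : Omega -> T) : set_system Omega :=
  preimage_set_system setT X measurable.

Definition configuration_sigma_algebra (R : realType) (disp : measure_display)
    (Omega : measurableType disp) (P : probability Omega R) (V : choiceType)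
    (s : V -> {RV P >-> bool}) : set_system Omega :=
  <<s \bigcup_(x in [set: V]) generated_sigma_algebra (s x) >>.

(* The sources of randomness: [None] is the whole initial configuration, the
   others are the individual waiting times and coins. *)
Definition glauber_sources (R : realType) (disp : measure_display)
    (Omega : measurableType disp) (P : probability Omega R) (V : choiceType)
    (init : V -> {RV P >-> bool}) (tau : V -> nat -> {RV P >-> R})
    (coin : V -> nat -> {RV P >-> bool}) (i : option (V * nat + V * nat))
    : set_system Omega :=
  match i with
  | None => configuration_sigma_algebra init
  | Some (inl (x, k)) => generated_sigma_algebra (tau x k)
  | Some (inr (x, k)) => generated_sigma_algebra (coin x k)
  end.

(* A rate-1 Poisson clock is given by i.i.d. Exp(1) waiting times. *)
Definition glauber_dynamics (R : realType) (disp : measure_display)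
    (Omega : measurableType disp) (P : probability Omega R) (V : choiceType)
    (e : rel V) (tau : V -> nat -> {RV P >-> R})
    (coin : V -> nat -> {RV P >-> bool}) (sigma : R -> V -> {RV P >-> bool})
    : Prop :=
  [/\ (forall x k (A : set R), measurable A ->
         distribution P (tau x k) A = exponential_prob 1 A),
      (forall x k (A : set bool), measurable A ->
         distribution P (coin x k) A = bernoulli_prob 2^-1 A),
      mutually_independent P (glauber_sources (sigma 0) tau coin)
    & {ae P, forall w, glauber_trajectory e (fun x k => tau x k w)
         (fun x k => coin x k w) (fun t x => sigma t x w)}].

Definition iid_symmetric_spins (R : realType) (disp : measure_display)
    (Omega : measurableType disp) (P : probability Omega R) (V : choiceType)
    (s : V -> {RV P >-> bool}) : Prop :=
  (forall x (A : set bool), measurable A ->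
     distribution P (s x) A = bernoulli_prob 2^-1 A) /\
  mutually_independent P (fun x => generated_sigma_algebra (s x)).

(* Main.v *)
(* Suppose first that d >= 4, and let c(T) be the probability that the spin of a
   given vertex is +1 at all times t >= T. If c(T) = 0 for all T then, by the spin
   symmetry, a.s. no given spin is eventually constant. If c(T) > 0 for some T
   then, by monotonicity, the probability that the root of a branch is +1 from
   time T on, when the vertex below it is held at +1, is at least c(T) as well.
   Surround a vertex v by finitely many core vertices with prescribed initial
   spins whose clocks do not ring before T, and ask that each branch attached to
   the core stays in agreement with the vertex to which it is attached. Core vertices
   then have d - 1 > d / 2 neighbours that agree with them from time T on, and never
   flip. If v has d / 2 core neighbours of each spin, then it is tied forever, and
   flips whenever its coin shows heads. Disjoint translates of this event are
   independent and have a probability bounded from below, hence one of them occurs.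

   If d = 2, then a frozen limit is constant, since two neighbours of a vertex
   with different limits would leave it tied, and two neighbours with the same
   limit attract it. At a large time T most spins have reached their limits, whereas
   the spins at k distant sites are almost independent and almost fair, which
   bounds the probability of freezing by 2 (3/4)^k up to a small error.

   Both arguments require that events involving infinitely many sites be local up
   to a small error: a spin at time T depends on a distant site only through a
   long chain of rings at decreasing times, which is unlikely. *)
Require Import Defs.
From HB Require Import structures.
From mathcomp Require Import all_boot all_order all_algebra.
From mathcomp Require Import all_classical all_reals all_analysis.
From mathcomp Require Import ring lra zify measurable_realfun.
Import Order.TTheory GRing.Theory Num.Theory.
Import numFieldNormedType.Exports.
Local Open Scope classical_set_scope.
Local Open Scope ring_scope.
Set Implicit Arguments.
Unset Strict Implicit.
Unset Printing Implicit Defensive.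

(** * Measurable predicates and probabilities *)

(** The given dynamics is not monotone in the configuration: in a tie, a coin that orders a flip
    sends a higher spin to a lower one. Reading the coin as the new spin is monotone and has the
    same law, but produces another trajectory. Monotonicity is therefore used for probabilities
    only: for a fixed order of finitely many rings, the two readings have equally many words of
    coins that keep a given spin up. No trajectory on a branch with a held vertex is ever
    constructed. All events are stated in terms of spins, waiting times and coins on finite sets of
    sites, and speak about an arbitrary trajectory only when no long chain of influence is present.
    The data that admit a freezing trajectory need not form a measurable set, so they are covered by
    measurable sets of probability zero or arbitrarily small probability. Degree two is separate
    because then d - 1 = d / 2: a vertex with a single unreliable neighbour may become tied, so no
    finite core can be frozen. *)

Section measurable_predicates.
Context d (T : measurableType d).
Implicit Types (A B : T -> Prop).

(** Predicates instead of sets, so that measurability follows the logical form of an event.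
    Quantifiers over countable types are allowed, and lists of rings form such a type. *)
Definition mpred A := measurable [set x | A x].

Lemma mpred_eq A B : (forall x, A x <-> B x) -> mpred A -> mpred B.
Proof. by move=> AB; rewrite /mpred (_ : [set x | A x] = [set x | B x])//; apply/seteqP; split=> x /AB. Qed.

Lemma mpred_cst (Q : Prop) : mpred (fun=> Q).
Proof.
have [q|nq] := pselect Q.
  by apply: (@mpred_eq (fun=> True)) => //; exact: measurableT.
by apply: (@mpred_eq (fun=> False)) => //; exact: measurable0.
Qed.

Lemma mpredI A B : mpred A -> mpred B -> mpred (fun x => A x /\ B x).
Proof. exact: measurableI. Qed.

Lemma mpredU A B : mpred A -> mpred B -> mpred (fun x => A x \/ B x).
Proof. exact: measurableU. Qed.

Lemma mpredN A : mpred A -> mpred (fun x => ~ A x).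
Proof. exact: measurableC. Qed.

Lemma mpred_impl A B : mpred A -> mpred B -> mpred (fun x => A x -> B x).
Proof.
move=> mA mB; apply: (@mpred_eq (fun x => ~ A x \/ B x)).
  by move=> x; split=> [[]//|AB]; have [/AB|] := pselect (A x); [right|left].
by apply: mpredU => //; exact: mpredN.
Qed.

Lemma mpred_iff A B : mpred A -> mpred B -> mpred (fun x => A x <-> B x).
Proof. by move=> mA mB; apply: mpredI; exact: mpred_impl. Qed.

Lemma mpred_exists (I : countType) (F : I -> T -> Prop) :
  (forall i, mpred (F i)) -> mpred (fun x => exists i, F i x).
Proof.
move=> mF; apply: (@mpred_eq (fun x => exists n, match unpickle n with
    | Some i => F i x | None => False end)).
  move=> x; split=> [[n]|[i Fi]]; first by case: unpickle => // i Fi; exists i.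
  by exists (pickle i); rewrite pickleK.
rewrite /mpred [X in measurable X](_ : _ = \bigcup_n [set x |
  match unpickle n with Some i => F i x | None => False end]); last first.
  by apply/seteqP; split=> x /= [n]; [exists n|move=> _; exists n].
apply: bigcupT_measurable => n; case: unpickle => [i|]; first exact: mF.
exact: measurable0.
Qed.

Lemma mpred_forall (I : countType) (F : I -> T -> Prop) :
  (forall i, mpred (F i)) -> mpred (fun x => forall i, F i x).
Proof.
move=> mF; apply: (@mpred_eq (fun x => ~ exists i, ~ F i x)).
  move=> x; split=> [H i|H [i]]; last by apply.
  by apply: contrapT => nF; apply: H; exists i.
by apply/mpredN/mpred_exists => i; exact: mpredN.
Qed.

Lemma mpred_in (I : eqType) (s : seq I) (F : I -> T -> Prop) :
  (forall i, i \in s -> mpred (F i)) -> mpred (fun x => forall i, i \in s -> F i x).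
Proof.
elim: s => [|a s IH] mF; first by apply: (@mpred_eq (fun=> True)); [move=> x; split|exact: mpred_cst].
apply: (@mpred_eq (fun x => F a x /\ forall i, i \in s -> F i x)).
  move=> x; split=> [[Fa Fs] i|Fs]; first by rewrite inE => /predU1P[->//|/Fs].
  by split=> [|i is_]; apply: Fs; rewrite inE ?eqxx// is_ orbT.
by apply: mpredI; [apply: mF; rewrite mem_head|apply: IH => i is_; apply: mF; rewrite inE is_ orbT].
Qed.

Lemma mpred_fun (R : realType) (f : T -> R) (A : set R) :
  measurable_fun setT f -> measurable A -> mpred (fun x => A (f x)).
Proof. by move=> mf mA; have := mf measurableT A mA; rewrite setTI. Qed.

Lemma mpred_lt (R : realType) (f g : T -> R) :
  measurable_fun setT f -> measurable_fun setT g -> mpred (fun x => f x < g x).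
Proof.
move=> mf mg; have := measurable_fun_ltr mf mg measurableT (Y := [set true]).
by rewrite setTI; apply.
Qed.

Lemma mpred_le (R : realType) (f g : T -> R) :
  measurable_fun setT f -> measurable_fun setT g -> mpred (fun x => f x <= g x).
Proof.
move=> mf mg; have := measurable_fun_ler mf mg measurableT (Y := [set true]).
by rewrite setTI; apply.
Qed.

End measurable_predicates.

Section real_probability.
Context (R : realType) d (T : measurableType d) (P : probability T R).
Implicit Types (A B : set T).

Definition pr A : R := fine (P A).

Lemma fin_pr A : measurable A -> P A = (pr A)%:E.
Proof. by move=> mA; rewrite /pr fineK// fin_num_measure. Qed.

Lemma pr_ge0 A : 0 <= pr A.
Proof. exact: fine_ge0. Qed.

Lemma pr_le A B : measurable A -> measurable B -> A `<=` B -> pr A <= pr B.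
Proof.
by move=> mA mB AB; rewrite -lee_fin -!fin_pr//; apply: le_measure; rewrite ?inE.
Qed.

Lemma prT : pr setT = 1.
Proof. by rewrite /pr probability_setT. Qed.

Lemma pr0 : pr set0 = 0.
Proof. by rewrite /pr measure0. Qed.

Lemma pr_le1 A : measurable A -> pr A <= 1.
Proof. by move=> mA; rewrite -prT; exact: pr_le. Qed.

Lemma prC A : measurable A -> pr (~` A) = 1 - pr A.
Proof.
move=> mA; apply: EFin_inj; rewrite EFinB -!fin_pr//; last exact: measurableC.
exact: probability_setC.
Qed.

Lemma prU_le A B : measurable A -> measurable B -> pr (A `|` B) <= pr A + pr B.
Proof.
move=> mA mB; rewrite -lee_fin EFinD -!fin_pr//; last exact: measurableU.
exact: measureU2.
Qed.

Lemma prU A B : measurable A -> measurable B -> A `&` B = set0 ->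
  pr (A `|` B) = pr A + pr B.
Proof.
move=> mA mB AB; apply: EFin_inj; rewrite EFinD -!fin_pr//; last exact: measurableU.
exact: measureU.
Qed.

Lemma prID A B : measurable A -> measurable B ->
  pr A = pr (A `&` B) + pr (A `\` B).
Proof.
move=> mA mB; rewrite -prU; first by rewrite setUIDK.
- exact: measurableI.
- exact: measurableD.
- by rewrite setDE setIACA setICr setI0.
Qed.

Lemma measurable_exists_in (I : eqType) (s : seq I) (F : I -> set T) :
  (forall i, i \in s -> measurable (F i)) ->
  measurable [set x | exists2 i, i \in s & F i x].
Proof.
move=> mF; rewrite (_ : [set _ | _] = ~` [set x | forall i, i \in s -> ~ F i x]).
  apply: measurableC; apply: mpred_in => i si; apply: mpredN; exact: mF.
apply/seteqP; split=> x /=.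
  by move=> [i si Fi] /(_ i si).
by move=> H; apply: contrapT => H'; apply: H => i si Fi; apply: H'; exists i.
Qed.

Lemma pr_exists_le (I : eqType) (s : seq I) (F : I -> set T) :
  (forall i, i \in s -> measurable (F i)) ->
  pr [set x | exists2 i, i \in s & F i x] <= \sum_(i <- s) pr (F i).
Proof.
elim: s => [|a s IH] mF.
  by rewrite big_nil (_ : [set _ | _] = set0) ?pr0//; apply/seteqP; split=> x // [].
have mFs i : i \in s -> measurable (F i) by move=> si; apply: mF; rewrite inE si orbT.
have mE := measurable_exists_in mFs.
have mFa : measurable (F a) by apply: mF; rewrite mem_head.
rewrite big_cons (_ : [set _ | _] = F a `|` [set x | exists2 i, i \in s & F i x]).
  by rewrite (le_trans (prU_le mFa mE))// lerD2l IH.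
apply/seteqP; split=> x /=.
  by move=> [i]; rewrite inE => /predU1P[->|si Fi]; [left|right; exists i].
by move=> [Fa|[i si Fi]]; [exists a; rewrite ?mem_head|exists i => //; rewrite inE si orbT].
Qed.

Lemma pr_partition (I : eqType) (s : seq I) (A : set T) (K : I -> set T) : uniq s ->
  measurable A -> (forall i, i \in s -> measurable (K i)) ->
  (forall i j x, i \in s -> j \in s -> K i x -> K j x -> i = j) ->
  (forall x, A x -> exists2 i, i \in s & K i x) ->
  pr A = \sum_(i <- s) pr (A `&` K i).
Proof.
move=> us mA mK dK AK.
have -> : A = A `&` [set x | exists2 i, i \in s & K i x].
  by apply/seteqP; split=> [x Ax|x []//]; split=> //; exact: AK.
rewrite [RHS](eq_bigr (fun i => pr (A `&` K i))); last first.
  by move=> i _; congr (pr (_ `&` _)); apply/seteqP; split=> [x []//|x Ax]; split=> //; exact: AK.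
elim: s us mK dK {AK} => [_ _ _|a s IH /=/andP[as_ us] mK dK].
  by rewrite big_nil (_ : _ `&` _ = set0) ?pr0//; apply/seteqP; split=> x // [_ []].
have sub i : i \in s -> i \in a :: s by rewrite inE => ->; rewrite orbT.
have mE : measurable [set x | exists2 i, i \in s & K i x].
  by apply: measurable_exists_in => i /sub; exact: mK.
have mKa : measurable (K a) by apply: mK; rewrite mem_head.
rewrite big_cons -IH//; last 2 first.
- by move=> i /sub; exact: mK.
- by move=> i j x /sub ? /sub; exact: dK.
rewrite -prU; last 3 first.
- exact: measurableI.
- exact: measurableI.
- apply/seteqP; split=> // x [[_ Ka] [_ [i si Ki]]].
  by move: as_; rewrite (dK a i x)// ?mem_head ?sub// si.
congr pr; apply/seteqP; split=> x /=.
  by move=> [Ax [i]]; rewrite inE => /predU1P[->|si] Ki; [left|right; split=> //; exists i].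
by move=> [[Ax Ka]|[Ax [i si Ki]]]; split=> //; [exists a; rewrite ?mem_head|exists i; rewrite ?sub].
Qed.

(** Both sides are integrals of counting functions. With words of coins as indices, this replaces a
    conditioning on spins and clocks by a pointwise comparison of counts. *)
Lemma sum_pr_count (I : eqType) (s : seq I) (A B : I -> set T) :
  (forall i, measurable (A i)) -> (forall i, measurable (B i)) ->
  (forall x, (count (fun i => `[< A i x >]) s <= count (fun i => `[< B i x >]) s)%N) ->
  \sum_(i <- s) pr (A i) <= \sum_(i <- s) pr (B i).
Proof.
move=> mA mB AB.
have E (C : I -> set T) : (forall i, measurable (C i)) ->
    (\sum_(i <- s) pr (C i))%:E = (\int[P]_x (\sum_(i <- s) (\1_(C i) x)%:E))%E.
  move=> mC; rewrite ge0_integral_sum//; last first.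
    by move=> i; apply/measurable_EFinP; exact: measurable_indic.
  rewrite -sumEFin; apply: eq_bigr => i _.
  by rewrite integral_indic// setIT /pr fineK// fin_num_measure.
rewrite -lee_fin !E//; apply: ge0_le_integral => //.
- by move=> x _; apply: sume_ge0 => i _; rewrite lee_fin.
- by apply: emeasurable_sum => i; apply/measurable_EFinP; exact: measurable_indic.
- by apply: emeasurable_sum => i; apply/measurable_EFinP; exact: measurable_indic.
- move=> x _; rewrite !sumEFin lee_fin.
  have C1 (C : I -> set T) : \sum_(i <- s) \1_(C i) x = (count (fun i => `[< C i x >]) s)%:R :> R.
    elim: s {AB E} => [|i s IH]; rewrite ?big_nil// big_cons IH /= natrD indicE.
    by congr (_%:R + _); congr nat_of_bool; apply/idP/asboolP; rewrite inE.
  by rewrite !C1 ler_nat.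
Qed.

(** Intersect the covers obtained for e = 1 / (n + 1). The set [N] itself may fail to be
    measurable. *)
Lemma pr_negligible_small (N : set T) :
  (forall e : R, 0 < e -> exists A, [/\ measurable A, N `<=` A & pr A < e]) ->
  P.-negligible N.
Proof.
move=> H; have {}H n : exists A, [/\ measurable A, N `<=` A & pr A < n.+1%:R^-1].
  by apply: H; rewrite invr_gt0.
have [A HA] := choice H.
have mA : measurable (\bigcap_n A n).
  by apply: bigcapT_measurable => n; have [] := HA n.
exists (\bigcap_n A n); split=> //; last by move=> x Nx n _; have [_ NA _] := HA n; exact: NA.
rewrite fin_pr//; congr (_%:E); apply/eqP; rewrite eq_le pr_ge0 andbT.
apply/ler_addgt0Pr => e e0; rewrite add0r.
have [n] : exists n : nat, (n.+1%:R^-1 : R) < e.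
  by have [n _ Hn] := near_infty_natSinv_lt (PosNum e0); exists n; apply: (Hn n) => /=.
move=> ne; apply: ltW; apply: le_lt_trans ne; have [mAn _ /ltW] := HA n.
by apply: le_trans; apply: pr_le => //; exact: bigcap_inf.
Qed.

Lemma pr0_negligible A : measurable A -> pr A = 0 -> P.-negligible A.
Proof. by move=> mA A0; apply/negligibleP => //; rewrite -(fineK (fin_num_measure P _ mA)) -/(pr _) A0. Qed.

Lemma negligible_exists (I : countType) (F : I -> set T) :
  (forall i, P.-negligible (F i)) -> P.-negligible [set x | exists i, F i x].
Proof.
move=> nF; pose G n := match unpickle n with Some i => F i | None => set0 end.
apply: (@negligibleS _ _ _ _ (\bigcup_n G n)).
  by move=> x [i Fi]; exists (pickle i) => //; rewrite /G pickleK.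
apply: negligible_bigcup => n; rewrite /G; case: unpickle => // .
exact: negligible_set0.
Qed.

(** Meant for the pieces on which the ordered list of rings is a given one. *)
Lemma pr_le_pieces (I : countType) (O : I -> set T) A B :
  (forall i, measurable (O i)) -> (forall i j, O i `&` O j !=set0 -> i = j) ->
  measurable A -> measurable B -> A `<=` [set x | exists i, O i x] ->
  (forall i, pr (A `&` O i) <= pr (B `&` O i)) -> pr A <= pr B.
Proof.
move=> mO trO mA mB AO leAB.
(* Several codes may decode to the same [i]; the test on [pickle i] keeps each [O i] at one index,
   so that the [O' n] are disjoint. *)
pose O' n := match unpickle n with
  | Some i => if (pickle i == n)%N then O i else set0 | None => set0 end.
have mO' n : measurable (O' n).
  by rewrite /O'; case: unpickle => // i; case: ifP.
have trO' (C : set T) : trivIset setT (fun n => C `&` O' n).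
  apply/trivIsetP => m n _ _ mn; apply/seteqP; split=> // x -[[_]].
  rewrite /O'; case: unpickle => // i; case: ifP => // /eqP pm Oi [_].
  case: unpickle => // j; case: ifP => // /eqP pn Oj; move/eqP: mn; apply.
  by rewrite -pm -pn; congr pickle; apply: trO; exists x.
have AE : A = \bigcup_n (A `&` O' n).
  apply/seteqP; split=> [x Ax|x [n _ []]//]; have [i Oi] := AO x Ax.
  by exists (pickle i) => //; split=> //; rewrite /O' pickleK eqxx.
rewrite -lee_fin -!fin_pr//.
apply: (@le_trans _ _ (P (\bigcup_n (B `&` O' n)))); last first.
  apply: le_measure; rewrite ?inE//; last by move=> x [n _ []].
  by apply: bigcupT_measurable => n; exact: measurableI.
rewrite {1}AE !measure_bigcup//=; try (by move=> *; exact: measurableI).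
apply: lee_nneseries => [n _ _|n _]; first exact: measure_ge0.
rewrite !fin_pr; [|exact: measurableI..].
rewrite lee_fin /O'; case: unpickle => [i|]; last by rewrite !setI0.
by case: ifP => _; [exact: leAB|rewrite !setI0].
Qed.

Lemma pr_sum_le1 n (F : nat -> set T) : (forall i, measurable (F i)) ->
  (forall i j w, F i w -> F j w -> i = j) -> \sum_(i <- iota 0 n) pr (F i) <= 1.
Proof.
move=> mF trF; rewrite -lee_fin -sumEFin -prT -(fin_pr measurableT).
rewrite -[iota _ _](_ : index_iota 0 n = _); last by rewrite /index_iota subn0.
rewrite big_mkord.
rewrite (eq_bigr (fun i : 'I_n => P (F i))); last by move=> i _; rewrite fin_pr.
rewrite -(@measure_bigsetU_ord _ _ _ P n xpredT (fun i : 'I_n => F i))//.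
- by apply: le_measure; rewrite ?inE//; exact: bigsetU_measurable.
- by move=> a b _ _ [w [wa wb]]; apply: val_inj; exact: trF wa wb.
Qed.

End real_probability.

(** * Independent coordinates *)

Section product_space.
Context (J : choiceType) (R : realType).

Definition coord_sets : set_system (J -> R) :=
  [set E | exists j (A : set R), measurable A /\ E = [set x | A (x j)]].

(** The product sigma-algebra. Events are built here once and pulled back along whatever random data
    are considered. *)
Definition dspace := g_sigma_algebraType coord_sets.

Lemma measurable_coord j : measurable_fun setT (fun x : dspace => x j).
Proof.
move=> _ A mA; rewrite setTI; apply: sub_sigma_algebra.
by exists j, A.
Qed.

Definition cylinders : set_system (J -> R) :=
  [set E | exists (s : seq J) (A : J -> set R), (forall j, measurable (A j)) /\
    E = [set x | forall j, j \in s -> A j (x j)]].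

Lemma cylinders_measurable : cylinders `<=` (@measurable _ dspace).
Proof.
move=> _ [s [A [mA ->]]]; apply: (@mpred_in _ dspace) => j _.
by apply: mpred_fun => //; exact: measurable_coord.
Qed.

Lemma dspace_cylinders : @measurable _ dspace = <<s cylinders >>.
Proof.
apply/seteqP; split.
  apply: smallest_sub; first exact: smallest_sigma_algebra.
  move=> _ [j [A [mA ->]]]; apply: sub_sigma_algebra.
  exists [:: j], (fun=> A); split=> //.
  by apply/seteqP; split=> x /= H => [i|]; [rewrite inE => /eqP ->|apply: H; rewrite mem_head].
apply: smallest_sub; last exact: cylinders_measurable.
exact: sigma_algebra_measurable.
Qed.

Lemma cylinders_setI : setI_closed cylinders.
Proof.
move=> _ _ [s [A [mA ->]]] [t [B [mB ->]]].
exists (s ++ t), (fun j => (if j \in s then A j else setT) `&` (if j \in t then B j else setT)).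
split; first by move=> j; apply: measurableI; case: ifP.
apply/seteqP; split=> x /=.
  by move=> [As Bt] j _; split; case: ifP => // jj; [exact: As|exact: Bt].
by move=> H; split=> j sj; have := H j; rewrite mem_cat sj ?orbT => /(_ isT)[].
Qed.

Lemma measurable_to_dspace d (T : measurableType d) (f : T -> dspace) :
  (forall j, measurable_fun setT (fun w => f w j)) -> measurable_fun setT f.
Proof.
move=> mf; apply: (measurability (coord_sets : set_system dspace)) => //.
move=> _ [_ [j [A [mA ->]]] <-].
by have := mf j measurableT A mA.
Qed.

Definition depends_on (S : set J) (E : set (J -> R)) :=
  forall x y, (forall j, S j -> x j = y j) -> E x -> E y.

End product_space.
Arguments cylinders {J R}.

Section independence.
Context (J : choiceType) (R : realType) d (Omega : measurableType d)
  (P : probability Omega R).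
Implicit Types (X : Omega -> J -> R) (E F : set (J -> R)).

Definition independent X := forall (s : seq J) (A : J -> set R), uniq s ->
  (forall j, measurable (A j)) ->
  P [set w | forall j, j \in s -> A j (X w j)] =
    (\prod_(j <- s) P [set w | A j (X w j)])%E.

Definition measurable_data X := forall j, measurable_fun setT (X ^~ j).

Lemma measurable_data_fun X : measurable_data X ->
  measurable_fun setT (X : Omega -> dspace J R).
Proof. exact: measurable_to_dspace. Qed.

Lemma measurable_preimage X E : measurable_data X ->
  measurable (E : set (dspace J R)) -> measurable (X @^-1` E).
Proof.
by move=> mX mE; rewrite -[X in measurable X]setTI; exact: measurable_data_fun.
Qed.

(** Dynkin's argument, with an event [a] so that it serves twice: [a = setT] and [c = 1] compare the
    laws of [X] and [Y], while [Y = X] gives independence from [a]. *)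
Lemma dspace_ind (a : set Omega) (c : R) X Y : measurable a ->
  measurable_data X -> measurable_data Y ->
  (forall E, cylinders E -> pr P (X @^-1` E `&` a) = c * pr P (Y @^-1` E)) ->
  forall E, measurable (E : set (dspace J R)) ->
  pr P (X @^-1` E `&` a) = c * pr P (Y @^-1` E).
Proof.
move=> ma mX mY H.
have c1 : pr P a = c.
  have := H setT; rewrite !preimage_setT setTI prT mulr1; apply.
  by exists [::], (fun=> setT); split=> //; apply/seteqP; split.
have mXY E : measurable (E : set (dspace J R)) ->
    measurable (X @^-1` E) /\ measurable (Y @^-1` E).
  by move=> mE; split; exact: measurable_preimage.
have D := @dynkin_induction _ (dspace J R) cylinders
  (fun E => pr P (X @^-1` E `&` a) = c * pr P (Y @^-1` E)).
move=> E; rewrite (dspace_cylinders J R); move: E; apply: D.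
- exact: dspace_cylinders.
- exact: cylinders_setI.
- by rewrite !preimage_setT setTI prT mulr1.
- exact: H.
- move=> S mS IH; have [mXS mYS] := mXY _ mS.
  rewrite (_ : X @^-1` (~` S) = ~` (X @^-1` S))//.
  rewrite (_ : Y @^-1` (~` S) = ~` (Y @^-1` S))// (prC P mYS) mulrBr mulr1 -IH -c1.
  have := prID P ma mXS; rewrite setDE [a `&` ~` _]setIC [a `&` _]setIC; lra.
- move=> F mF trF IH; apply: EFin_inj.
  have mXF n := (mXY _ (mF n)).1; have mYF n := (mXY _ (mF n)).2.
  rewrite EFinM -!fin_pr; last first.
  + by apply: measurableI => //; rewrite preimage_bigcup; exact: bigcupT_measurable.
  + by rewrite preimage_bigcup; exact: bigcupT_measurable.
  rewrite !preimage_bigcup setI_bigcupl.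
  rewrite !measure_bigcup//=.
  + rewrite -nneseriesZl//; apply: eq_eseriesr => n _.
    by rewrite fin_pr ?IH ?EFinM -?fin_pr//; exact: measurableI.
  + apply/trivIsetP => m n _ _ mn; rewrite -preimage_setI.
    by move/trivIsetP : trF => -> //; rewrite preimage_set0.
  + by move=> n _; exact: measurableI.
  + apply/trivIsetP => m n _ _ mn; rewrite setIACA -preimage_setI.
    by move/trivIsetP : trF => -> //; rewrite preimage_set0 set0I.
Qed.

Lemma independent_law X Y : measurable_data X -> measurable_data Y ->
  independent X -> independent Y ->
  (forall j A, measurable A -> P [set w | A (X w j)] = P [set w | A (Y w j)]) ->
  forall E, measurable (E : set (dspace J R)) -> pr P (X @^-1` E) = pr P (Y @^-1` E).
Proof.
move=> mX mY iX iY XY E mE; rewrite -[X in pr P X = _]setIT -[RHS]mul1r.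
apply: dspace_ind => // _ [s [A [mA ->]]]; rewrite setIT mul1r /pr; congr fine.
have cylE (Z : Omega -> J -> R) : Z @^-1` [set x | forall j, j \in s -> A j (x j)] =
    [set w | forall j, j \in undup s -> A j (Z w j)].
  by apply/seteqP; split=> w /= H j; [rewrite mem_undup|rewrite -mem_undup]; exact: H.
by rewrite !cylE iX ?undup_uniq// iY ?undup_uniq//; apply: eq_bigr => j _; exact: XY.
Qed.

(** A Dynkin induction over events would lose the hypothesis [depends_on S]. Masking the data
    instead of restricting the events lets it range over all measurable sets. *)
Definition mask (S : set J) (x : J -> R) j : R := if j \in S then x j else 0.

Lemma mask_dep (S : set J) E X : depends_on S E ->
  (fun w => mask S (X w)) @^-1` E = X @^-1` E.
Proof.
move=> dE; apply/seteqP; split=> w /=; apply: dE => j Sj;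
  by rewrite /mask ifT// inE.
Qed.

Lemma measurable_mask (S : set J) X : measurable_data X ->
  measurable_data (fun w => mask S (X w)).
Proof.
move=> mX j; rewrite /mask; case: (j \in S); last exact: measurable_cst.
exact: mX.
Qed.

Let cyl_mask (S : set J) X E : cylinders E ->
  exists s A, [/\ uniq s, forall j, measurable (A j), forall j, j \in s -> S j &
    (fun w => mask S (X w)) @^-1` E = [set w | forall j, j \in s -> A j (X w j)] \/
    (fun w => mask S (X w)) @^-1` E = set0].
Proof.
move=> [s [A [mA ->]]].
exists (undup [seq j <- s | j \in S]), A; split=> //; first exact: undup_uniq.
  by move=> j; rewrite mem_undup mem_filter => /andP[/set_mem].
have [H|] := pselect (forall j, j \in s -> j \notin S -> A j 0).
  left; apply/seteqP; split=> w /= Hw j.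
    by rewrite mem_undup mem_filter => /andP[jS js]; have := Hw j js; rewrite /mask jS.
  move=> js; rewrite /mask; case: ifPn => jS; last exact: H.
  by apply: Hw; rewrite mem_undup mem_filter jS.
move=> /existsNP[j /not_implyP[js /not_implyP[jS nA]]]; right.
apply/seteqP; split=> // w /= /(_ j js); rewrite /mask (negbTE jS).
exact: nA.
Qed.

Lemma independent_depends X (S1 S2 : set J) E1 E2 : measurable_data X ->
  independent X -> S1 `&` S2 = set0 ->
  measurable (E1 : set (dspace J R)) -> measurable (E2 : set (dspace J R)) ->
  depends_on S1 E1 -> depends_on S2 E2 ->
  pr P (X @^-1` E1 `&` X @^-1` E2) = pr P (X @^-1` E1) * pr P (X @^-1` E2).
Proof.
move=> mX iX S12 mE1 mE2 d1 d2.
rewrite -(mask_dep X d1) -(mask_dep X d2).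
have mm S := measurable_mask S mX.
have cylP S E : cylinders E -> measurable ((fun w => mask S (X w)) @^-1` E).
  move=> cE; apply: measurable_preimage; [exact: mm|exact: cylinders_measurable].
have cyl2 C1 C2 : cylinders C1 -> cylinders C2 ->
    pr P ((fun w => mask S1 (X w)) @^-1` C1 `&` (fun w => mask S2 (X w)) @^-1` C2) =
    pr P ((fun w => mask S1 (X w)) @^-1` C1) * pr P ((fun w => mask S2 (X w)) @^-1` C2).
  move=> c1 c2.
  have [s [A [us mA sS1 [->|->]]]] := cyl_mask S1 X c1; last by rewrite set0I pr0 mul0r.
  have [t [B [ut mB tS2 [->|->]]]] := cyl_mask S2 X c2; last by rewrite setI0 pr0 mulr0.
  have st j : j \in s -> j \in t -> False.
    by move=> /sS1 ? /tS2 ?; have : (S1 `&` S2) j by []; rewrite S12.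
  have mcyl (u : seq J) (D : J -> set R) : (forall j, measurable (D j)) ->
      measurable [set w | forall j, j \in u -> D j (X w j)].
    by move=> mD; apply: mpred_in => j _; apply: mpred_fun.
  apply: EFin_inj; rewrite EFinM -!fin_pr//; try by [exact: mcyl|apply: measurableI; exact: mcyl].
  rewrite !iX//.
  pose C j := if j \in s then A j else B j.
  have -> : [set w | forall j, j \in s -> A j (X w j)] `&`
      [set w | forall j, j \in t -> B j (X w j)] =
      [set w | forall j, j \in s ++ t -> C j (X w j)].
    apply/seteqP; split=> w /=.
      move=> [HA HB] j; rewrite mem_cat /C; case: ifP => [js _|_ /= jt]; first exact: HA.
      exact: HB.
    move=> H; split=> j jj; have := H j; rewrite mem_cat jj ?orbT /C => /(_ isT);
      first by rewrite jj.
    by case: ifP => // js; case: (st j).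
  rewrite iX; last by move=> j; rewrite /C; case: ifP.
    rewrite big_cat/=; congr (_ * _)%E; rewrite !big_seq; apply: eq_bigr => j jj.
      by rewrite /C jj.
    by rewrite /C ifF//; apply/negbTE/negP => /st; exact.
  rewrite cat_uniq us ut andbT /=; apply/hasPn => j jt; apply/negP => js.
  exact: (st j).
rewrite [RHS]mulrC; apply: dspace_ind => //.
  by apply: measurable_preimage => //; exact: mm.
move=> C1 cC1; rewrite setIC [RHS]mulrC.
apply: dspace_ind => //; first exact: cylP.
by move=> C2 cC2; rewrite setIC cyl2.
Qed.

Lemma independent_depends_seq X (I : eqType) (s : seq I) (S : I -> set J)
    (E : I -> set (J -> R)) : measurable_data X -> independent X -> uniq s ->
  (forall i k, i \in s -> k \in s -> i != k -> S i `&` S k = set0) ->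
  (forall i, i \in s -> measurable (E i : set (dspace J R))) ->
  (forall i, i \in s -> depends_on (S i) (E i)) ->
  pr P [set w | forall i, i \in s -> E i (X w)] = \prod_(i <- s) pr P (X @^-1` (E i)).
Proof.
move=> mX iX; elim: s => [_ _ _ _|a s IH /=/andP[as_ us] dS mE dE].
  by rewrite big_nil (_ : [set _ | _] = setT) ?prT//; apply/seteqP; split.
have sub i : i \in s -> i \in a :: s by rewrite inE => ->; rewrite orbT.
rewrite big_cons -IH//; last 3 first.
- by move=> i k /sub ? /sub ?; exact: dS.
- by move=> i /sub ?; exact: mE.
- by move=> i /sub ?; exact: dE.
rewrite (_ : [set _ | _] = X @^-1` (E a) `&` X @^-1` [set x | forall i, i \in s -> E i x]); last first.
  apply/seteqP; split=> w /=.
    by move=> H; split=> [|i /sub]; [apply: H; rewrite mem_head|exact: H].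
  by move=> [Ha H] i; rewrite inE => /predU1P[->//|/H].
apply: (@independent_depends X (S a) [set j | exists2 i, i \in s & S i j]) => //.
- apply/seteqP; split=> // j [Saj [i si Sij]].
  rewrite -(dS a i) ?mem_head ?sub//.
  by apply: contraNneq as_ => ->.
- by apply: mE; rewrite mem_head.
- by apply: (@mpred_in _ (dspace J R)) => i /sub; exact: mE.
- by apply: dE; rewrite mem_head.
- move=> x y xy H i si; apply: dE (H i si); first exact: sub.
  by move=> j Sj; apply: xy; exists i.
Qed.

End independence.

(** * Runs of the dynamics *)

Section glauber_runs.
Context (G : countType) (nb : G -> seq G) (R : realType).
Implicit Types (s : G -> bool) (v w : G) (U Z : seq G).

(* [(v, None)], [(v, Some (true, k))] and [(v, Some (false, k))] carry the
   initial spin of [v], its [k]-th waiting time and its [k]-th coin; spins and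
   coins are read off the sign of the coordinate. *)
Definition source := (G * option (bool * nat))%type.

Implicit Type x : source -> R.

Definition ini x v := 0 < x (v, None).
Definition wait x v k := x (v, Some (true, k)).
Definition flip x v k := 0 < x (v, Some (false, k)).
Definition ring x (a : G * nat) := ring_time (wait x) a.1 a.2.

(* With [m = false] the coin decides whether to flip in case of a tie, as in
   [glauber_update]; with [m = true] it is the new spin, which makes the update
   monotone in [s]. *)
Definition update (m c : bool) s v :=
  let p := count s (nb v) in
  if (p.*2 < size (nb v))%N then false
  else if (size (nb v) < p.*2)%N then true
  else if m then c else c (+) s v.

Lemma update_ext m c s s' v : {in nb v, s =1 s'} -> s v = s' v ->
  update m c s v = update m c s' v.
Proof. by move=> ss' sv; rewrite /update (eq_in_count ss') sv. Qed.

Lemma update_mono c s s' v : (forall y, y \in nb v -> s y -> s' y) ->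
  update true c s v -> update true c s' v.
Proof.
move=> ss'; rewrite /update.
have : (count s (nb v) <= count s' (nb v))%N.
  have -> : count s (nb v) = count (predI s s') (nb v).
    by apply: eq_in_count => y /ss' /=; case: (s y) => //= ->.
  by apply: sub_count => y /andP[].
move=> le; case: (ltngtP (count s (nb v)).*2 (size (nb v))) => // h1.
  by case: (ltngtP (count s' (nb v)).*2 (size (nb v))) => // h2; lia.
by case: (ltngtP (count s' (nb v)).*2 (size (nb v))) => // h2; lia.
Qed.

Definition step m U s (a : G * bool) : G -> bool :=
  fun y => if (y == a.1) && (a.1 \in U) then update m a.2 s a.1 else s y.

Definition run m U s (l : seq (G * bool)) := foldl (step m U) s l.

Lemma run_rcons m U s l a : run m U s (rcons l a) = step m U (run m U s l) a.
Proof. by rewrite /run foldl_rcons. Qed.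

Lemma run_notin m U s l v : v \notin U -> run m U s l v = s v.
Proof.
move=> vU; elim/last_ind: l => // l a IH; rewrite run_rcons /step.
by case: eqP => //= <-; rewrite (negbTE vU).
Qed.

Definition taint0 U Z : pred G := fun v => (v \notin U) && (v \notin Z).

Definition tstep U (S : pred G) v : pred G :=
  fun y => S y || [&& y == v, v \in U & has S (nb v)].

(* The sites that may have been influenced from outside of [U] once the sites of
   [l] have rung in this order, when those of [Z] are held fixed. *)
Definition taint U Z (l : seq G) : pred G := foldl (tstep U) (taint0 U Z) l.

Lemma taint_rcons U Z l v : taint U Z (rcons l v) = tstep U (taint U Z l) v.
Proof. by rewrite /taint foldl_rcons. Qed.

Lemma taint_cat U Z l l' v : taint U Z l v -> taint U Z (l ++ l') v.
Proof.
move=> lv; elim/last_ind: l' => [|l' a IH]; first by rewrite cats0.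
by rewrite -rcons_cat taint_rcons /tstep IH.
Qed.

Lemma taint0_taint U Z l v : taint0 U Z v -> taint U Z l v.
Proof. by move=> ?; rewrite -[l]cat0s; exact: taint_cat. Qed.

(** As long as [v] is untainted, each update at [v] consults only untainted sites. Those outside of
    [V] belong to [Z], where the second run is up forever and thus dominates; on the others
    [update_mono] applies. *)
Lemma run_mono U V Z s l v : {subset V <= U} -> (forall z, z \in Z -> z \notin V) ->
  ~~ taint V Z (map fst l) v -> run true U s l v ->
  run true V (fun y => (y \in Z) || s y) l v.
Proof.
move=> VU ZV; elim/last_ind: l v => [v _ /= ->|l a IH v]; first by rewrite orbT.
rewrite map_rcons taint_rcons !run_rcons /tstep negb_or => /andP[tv].
rewrite /step; case: eqVneq => [va|va] /=; last by move=> _; exact: IH.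
rewrite -va; case: (boolP (v \in V)) => vV /=.
  rewrite (VU _ vV) => nt; apply: update_mono => y yv; apply: IH.
  by apply: contra nt => ty; apply/hasP; exists y.
move=> _ _; rewrite run_notin//; have : ~~ taint0 V Z v.
  by apply: contra tv; exact: taint0_taint.
by rewrite /taint0 vV /= negbK => ->.
Qed.

(* [w] is up after each step of [l] from the [k]-th on. *)
Fixpoint steady m U w s k (l : seq (G * bool)) : bool :=
  ((0 < k)%N || s w) &&
  (if l is a :: l' then steady m U w (step m U s a) k.-1 l' else true).

Lemma steadyP m U w s k l : (k <= size l)%N ->
  reflect (forall i, (k <= i <= size l)%N -> run m U s (take i l) w) (steady m U w s k l).
Proof.
elim: l s k => [|a l IH] s k /= kl.
  rewrite andbT; move: kl; rewrite leqn0 => /eqP-> /=.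
  by apply: (iffP idP) => [sw i|H] //; exact: (H 0%N).
case: k kl => [_|k kl] /=.
  apply: (iffP andP) => [[sw /IH H] [_|i]//= il|H]; first exact: H.
  split; first exact: (H 0%N).
  by apply/IH => // i /andP[_ il]; exact: (H i.+1).
apply: (iffP (IH _ _ _)) => // H; last by move=> i il; exact: (H i.+1).
by move=> [|i]//= il; exact: H.
Qed.

Fixpoint bits n : seq (seq bool) :=
  if n is n'.+1 then map (cons true) (bits n') ++ map (cons false) (bits n') else [:: [::]].

Lemma mem_bits n c : (c \in bits n) = (size c == n).
Proof.
elim: n c => [|n IH] [|[] c]//=; rewrite mem_cat.
- by apply/negP => /orP[] /mapP[].
- rewrite eqSS -IH mem_map; last by move=> ? ? [].
  by rewrite orbC; case: mapP => // -[].
- rewrite eqSS -IH [X in _ || X]mem_map; last by move=> ? ? [].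
  by case: mapP => // -[].
Qed.

Lemma uniq_bits n : uniq (bits n).
Proof.
elim: n => //= n IH; rewrite cat_uniq !map_inj_uniq ?IH ?andbT//=; try by move=> ? ? [].
by apply/hasPn => _ /mapP[c _ ->]; apply/mapP => -[].
Qed.

(* For a given order of the rings the two conventions for the coins are
   equivalent, since they only differ by a permutation of the coin values. *)
Lemma count_steady U w s k (vs : seq G) :
  count (fun c => steady false U w s k (zip vs c)) (bits (size vs)) =
  count (fun c => steady true U w s k (zip vs c)) (bits (size vs)).
Proof.
elim: vs s k => [|v vs IH] s k //=.
rewrite !count_cat !count_map.
have E m c : count (preim (cons c) (fun c => steady m U w s k (zip (v :: vs) c))) (bits (size vs)) =
    (((0 < k)%N || s w) * count (fun c' => steady m U w (step m U s (v, c)) k.-1 (zip vs c'))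
      (bits (size vs)))%N.
  case b0: ((0 < k)%N || s w); rewrite ?mul1n ?mul0n.
    by apply: eq_count => c' /=; rewrite b0.
  by rewrite -[RHS](count_pred0 (bits (size vs))); apply: eq_count => c' /=; rewrite b0.
rewrite !E !IH -!mulnDr; congr (_ * _)%N.
(* Depending on the current spin of [v], a toss in one convention acts like the same or like the
   opposite toss in the other. *)
have [[-> ->]|[-> ->]] : (step false U s (v, true) = step true U s (v, true) /\
    step false U s (v, false) = step true U s (v, false)) \/
    (step false U s (v, true) = step true U s (v, false) /\
    step false U s (v, false) = step true U s (v, true)) => //; last by rewrite addnC.
rewrite /step /update /=; case sv: (s v); [right|left]; split; apply/funext => y; rewrite ?sv;
  case: ifP => // _; case: ifP => // _; case: ifP.
Qed.

Definition coins x (l : seq (G * nat)) := [seq (a.1, flip x a.1 a.2) | a <- l].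

Definition ringlist x U t (l : seq (G * nat)) :=
  pairwise (fun a b => ring x a < ring x b) l /\
  forall a, (a \in l) = (a.1 \in U) && (ring x a <= t).

Lemma ringlist_uniq x U t l l' : ringlist x U t l -> ringlist x U t l' -> l = l'.
Proof.
have tr : transitive (fun a b : G * nat => ring x a < ring x b).
  by move=> b a c; exact: lt_trans.
move=> [pl ml] [pl' ml']; apply: (irr_sorted_eq tr).
- by move=> a; rewrite ltxx.
- by rewrite (sorted_pairwise tr).
- by rewrite (sorted_pairwise tr).
- by move=> a; rewrite ml ml'.
Qed.

Definition good_clocks x :=
  [/\ forall v k, 0 < wait x v k,
      forall v t, exists k, t < ring x (v, k) &
      forall a b, ring x a = ring x b -> a = b].

Lemma ring_lt x v k k' : good_clocks x -> (k < k')%N -> ring x (v, k) < ring x (v, k').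
Proof.
move=> [pos _ _]; elim: k' => // k' IH.
rewrite ltnS leq_eqVlt => /predU1P[->|/IH /lt_trans]; last apply.
all: by rewrite /ring /ring_time /= [X in _ < X]big_ord_recr /= ltrDl.
Qed.

Lemma ring_gt0 x a : good_clocks x -> 0 < ring x a.
Proof.
case: a => v k gx; case: (posnP k) => [->|k0].
  by rewrite /ring /ring_time /= big_ord1; case: gx => ->.
apply: lt_trans (ring_lt v gx k0).
by rewrite /ring /ring_time /= big_ord1; case: gx => ->.
Qed.

(** The list up to [T] is delivered as a prefix of the one up to [T'], since [held_up] examines the
    steps that come after this prefix. *)
Lemma ringlist_exists x U T T' : good_clocks x -> T <= T' ->
  exists l1 l2, ringlist x U T l1 /\ ringlist x U T' (l1 ++ l2).
Proof.
move=> gx TT'; have [pos inf inj] := gx.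
have [K HK] := choice (fun v => inf v T').
pose c := undup [seq (v, k) | v <- U, k <- iota 0 (K v).+1].
have mc a : ring x a <= T' -> (a \in c) = (a.1 \in U).
  case: a => v k /= rT; rewrite mem_undup; apply/allpairsPdep/idP.
    by move=> [v' [k' [? _ [->]]]].
  move=> vU; exists v, k; split=> //; rewrite mem_iota /= add0n ltnS leqNgt.
  apply/negP => Kk; have := lt_trans (HK v) (ring_lt v gx Kk).
  by rewrite ltNge rT.
pose e (a b : G * nat) := ring x a <= ring x b.
have tot : total e by move=> a b; exact: le_total.
have tre : transitive e by move=> b a d; exact: le_trans.
pose l := sort e [seq a <- c | ring x a <= T'].
have ml a : (a \in l) = (a.1 \in U) && (ring x a <= T').
  rewrite mem_sort mem_filter; case: (boolP (ring x a <= T')) => [rT|_].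
    by rewrite mc//= andbT.
  by rewrite andbF.
have pl : pairwise (fun a b => ring x a < ring x b) l.
  have ul : uniq l by rewrite sort_uniq filter_uniq// undup_uniq.
  have : pairwise e l by rewrite -(sorted_pairwise tre); exact: sort_sorted.
  move: ul; rewrite uniq_pairwise; elim: (l) => //= a r IH /andP[ua ur] /andP[ea er].
  rewrite IH// andbT; apply/allP => b br; rewrite lt_neqAle [_ <= _](allP ea)// andbT.
  by apply: contraNneq (allP ua _ br) => /inj ->.
exists [seq a <- l | ring x a <= T], [seq a <- l | ~~ (ring x a <= T)].
have -> : [seq a <- l | ring x a <= T] ++ [seq a <- l | ~~ (ring x a <= T)] = l.
  move: pl; elim: (l) => //= a r IH /andP[ra rr]; case: ifP => /= aT; first by rewrite IH.
  suff -> : [seq b <- r | ring x b <= T] = [::].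
    by rewrite -[in RHS](IH rr) (_ : [seq b <- r | ring x b <= T] = [::])//;
      apply/eqP; rewrite -(negbK (_ == _)) -has_filter; apply/hasPn => b /(allP ra) ab;
      apply/negP => /(lt_le_trans ab) /ltW; rewrite aT.
  apply/eqP; rewrite -(negbK (_ == _)) -has_filter; apply/hasPn => b /(allP ra) ab.
  by apply/negP => /(lt_le_trans ab) /ltW; rewrite aT.
split; last by split.
split; first by rewrite pairwise_filter.
move=> a; rewrite mem_filter ml [LHS]andbC -andbA; congr andb.
by apply: andb_idl => aT; exact: le_trans TT'.
Qed.

Lemma ringlist_prefix x U T t T' l1 l2 : T <= t -> t <= T' ->
  ringlist x U T l1 -> ringlist x U T' (l1 ++ l2) ->
  exists2 i, (i <= size l2)%N & ringlist x U t (l1 ++ take i l2).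
Proof.
move=> Tt tT' [pl1 ml1] [pl ml].
have H : exists2 i, (i <= size l2)%N & [seq a <- l2 | ring x a <= t] = take i l2.
  move: pl; rewrite pairwise_cat => /and3P[_ _].
  elim: l2 {ml} => [_|a l IH /=/andP[la ll]]; first by exists 0%N.
  case: ifP => at_; first by have [i il ->] := IH ll; exists i.+1.
  exists 0%N => //=; apply/eqP; rewrite -(negbK (_ == _)) -has_filter.
  apply/hasPn => b /(allP la) ab; apply/negP => /(lt_le_trans ab) /ltW.
  by rewrite at_.
have [i il E] := H; exists i => //; rewrite -E; split.
  move: pl; rewrite !pairwise_cat => /and3P[pr -> p2]; rewrite (pairwise_filter _ p2).
  rewrite !andbT; apply/allrelP => a b al; rewrite mem_filter => /andP[_ bl].
  by move/allrelP : pr; exact.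
move=> a; rewrite mem_cat mem_filter; apply/idP/idP.
  move=> /orP[|/andP[at_ al]].
    by rewrite ml1 => /andP[-> aT]; rewrite (le_trans aT).
  by have := ml a; rewrite mem_cat al orbT at_ => /esym/andP[->].
move=> /andP[aU at_]; have := ml a; rewrite aU (le_trans at_ tT') mem_cat.
by rewrite at_ /= => ->.
Qed.

(** The rules of the dynamics on the sites of [U] only. Outside of [U] the process is arbitrary, so
    that a branch can be studied although the vertex below it obeys other rules. *)
Definition trajectory x U (sigma : R -> G -> bool) :=
  (forall v (s t : R), v \in U -> 0 <= s -> s <= t ->
     (forall n, ~~ (s < ring x (v, n) <= t)) -> sigma t v = sigma s v) /\
  (forall v n, v \in U -> \forall s \near (ring x (v, n))^'-,
     sigma (ring x (v, n)) v = update false (flip x v n) (sigma s) v).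

(* Finite speed of propagation: an untainted spin ignores the sites outside of [U]. *)
Lemma trajectory_run x U Z s0 sigma (t : R) l : good_clocks x -> 0 <= t ->
  trajectory x U sigma -> ringlist x U t l ->
  (forall v, v \in U -> sigma 0 v = s0 v) ->
  (forall v (s : R), v \in Z -> 0 <= s <= t -> sigma s v = s0 v) ->
  forall v, ~~ taint U Z (map fst l) v -> sigma t v = run false U s0 (coins x l) v.
Proof.
move=> gx t0 [T1 T2] rl sU; elim/last_ind: l t t0 rl => [|l a0 IH] t t0 [pl ml] sZ v.
  rewrite /= negb_and !negbK => /orP[vU|vZ]; last by apply: sZ => //; rewrite t0 lexx.
  rewrite (T1 v 0)// ?sU// => n; apply/negP => /andP[_ rt].
  by have := ml (v, n); rewrite /= vU rt.
have [a0U a0t] : a0.1 \in U /\ ring x a0 <= t.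
  by apply/andP; rewrite -ml mem_rcons mem_head.
have la0 a : a \in l -> ring x a < ring x a0.
  move=> al; move: pl; rewrite -cats1 pairwise_cat => /and3P[/allrelP H _ _].
  by apply: H => //; rewrite mem_head.
(* One time [s] between all the earlier rings and the last one: the induction hypothesis at [s]
   provides every spin that the last update consults. *)
have : exists s : R, [/\ 0 <= s, s < ring x a0, forall a, a \in l -> ring x a <= s &
    sigma (ring x a0) a0.1 = update false (flip x a0.1 a0.2) (sigma s) a0.1].
  pose M := \big[Num.max/0]_(a <- l) ring x a.
  have Ma0 : M < ring x a0.
    rewrite /M big_seq; elim/big_ind: _ => [||a /la0//]; first exact: ring_gt0.
    by move=> y z ya za; rewrite gt_max ya za.
  have lM a : a \in l -> ring x a <= M by move=> al; apply: le_bigmax_seq.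
  have M0 : 0 <= M by apply: bigmax_ge_id.
  have e : \forall s \near (ring x a0)^'-, M < s.
    by apply: nbhs_left_gt.
  have e2 : \forall s \near (ring x a0)^'-, s < ring x a0.
    by apply: nbhs_left_lt.
  have e3 : \forall s \near (ring x a0)^'-,
     sigma (ring x a0) a0.1 = update false (flip x a0.1 a0.2) (sigma s) a0.1.
    by have := T2 a0.1 a0.2 a0U; rewrite -surjective_pairing.
  have [s [[Ms sa] us]] := filter_ex (filterI (filterI e e2) e3).
  exists s; split=> //; first exact: le_trans M0 (ltW Ms).
  by move=> a /lM aM; exact: le_trans aM (ltW Ms).
move=> [s [s0' sa0 ls us]].
have {}IH : forall v, ~~ taint U Z (map fst l) v ->
    sigma s v = run false U s0 (coins x l) v.
  apply: IH => //.
  - split; first by move: pl; rewrite -cats1 pairwise_cat => /and3P[].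
    move=> a; apply/idP/idP => [al|/andP[aU as_]].
      have := ml a; rewrite mem_rcons inE al orbT ls// andbT.
      by move/esym/andP => [].
    have := ml a; rewrite aU (le_trans (ltW (le_lt_trans as_ sa0)) a0t) mem_rcons inE /=.
    by case: eqP => // aa0; move: sa0; rewrite -aa0 ltNge as_.
  - move=> y r yZ /andP[r0 rs]; apply: sZ => //; rewrite r0 /=.
    exact: le_trans rs (ltW (lt_le_trans sa0 a0t)).
rewrite map_rcons taint_rcons /tstep negb_or => /andP[tv].
rewrite /coins map_rcons run_rcons -/(coins x l) /step /=.
case: eqVneq => [va|va0] /=.
  rewrite va a0U /= => nt; rewrite (T1 _ (ring x a0))//; last 2 first.
  - exact: ltW (ring_gt0 _ gx).
  - move=> n; apply/negP => /andP[rr rt]; have := ml (a0.1, n).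
    rewrite /= a0U rt mem_rcons inE => /orP[/eqP E|/la0 H].
      by move: rr; rewrite E ltxx.
    by have := lt_trans rr H; rewrite ltxx.
  rewrite us; apply: update_ext => [y yn|]; last first.
    by apply: IH; rewrite -va.
  by apply: IH; apply: contra nt => ty; apply/hasP; exists y.
move=> _; rewrite -IH//.
have st : s <= t by exact: ltW (lt_le_trans sa0 a0t).
have [vU|vU] := boolP (v \in U).
  apply: T1 => // n; apply/negP => /andP[sr rt]; have := ml (v, n).
  rewrite /= vU rt mem_rcons inE => /orP[/eqP E|/ls H].
    by move/eqP : va0; rewrite -E.
  by have := lt_le_trans sr H; rewrite ltxx.
have vZ : v \in Z.
  have : ~~ taint0 U Z v by apply: contra tv; exact: taint0_taint.
  by rewrite /taint0 vU /= negbK.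
by rewrite !sZ// ?s0' ?t0 ?st ?lexx.
Qed.

Definition walk w (p : seq G) :=
  if p is v :: p' then (v == w) && path (fun a b => b \in nb a) v p' else true.

Lemma walk_take w p n : walk w p -> walk w (take n p).
Proof.
case: p n => [|v p] [|n]//= /andP[-> /=]; rewrite -{1}(cat_take_drop n p) cat_path.
by move=> /andP[].
Qed.

(* A chain of influence, read backwards in time from [w]. *)
Definition chain x U n w t := exists l : seq (G * nat),
  [/\ size l = n, walk w (map fst l), uniq (map fst l),
      sorted (fun a b => ring x b < ring x a) l &
      all (fun a => (a.1 \in U) && (ring x a <= t)) l].

Lemma chain_le x U V n w t t' : {subset U <= V} -> t <= t' ->
  chain x U n w t -> chain x V n w t'.
Proof.
move=> UV tt' [l [? ? ? ? /allP H]]; exists l; split=> //.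
by apply/allP => a /H /andP[/UV -> /le_trans]; exact.
Qed.

(** Follow the taint back in time: a site tainted at its ring has a neighbour that was tainted
    before. Since a site becomes tainted only once, the sites met are distinct, which later makes
    their clocks independent. *)
Lemma taint_path x U Z l v : pairwise (fun a b => ring x a < ring x b) l ->
  taint U Z (map fst l) v -> exists (l' : seq (G * nat)) (u : G),
  [/\ taint0 U Z u, walk v (rcons (map fst l') u),
      all (fun y => (y \in U) && taint U Z (map fst l) y) (map fst l'),
      uniq (map fst l') & {subset l' <= l} /\ sorted (fun a b => ring x b < ring x a) l'].
Proof.
elim/last_ind: l v => [v _ tv|l a IH v].
  by exists [::], v; split=> //=; rewrite eqxx.
rewrite -cats1 pairwise_cat => /and3P[/allrelP la pl _].
rewrite cats1 map_rcons taint_rcons /tstep.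
case: (boolP (taint U Z _ v)) => [tv _|ntv /and3P[/eqP va aU /hasP[y yv ty]]].
  have [l' [u [u0 wu al ul [sl sl']]]] := IH v pl tv; exists l', u; split=> //.
    by apply/allP => y /(allP al) /andP[-> ->].
  by split=> // b /sl bl; rewrite mem_rcons inE bl orbT.
have [l' [u [u0 wu al ul [sl sl']]]] := IH y pl ty; exists (a :: l'), u; split=> //=.
- rewrite va eqxx /=; move: wu; case: (l') => [|b r] /=.
    by rewrite !andbT => /eqP ->.
  by move=> /andP[/eqP -> ->]; rewrite yv.
- rewrite aU eqxx /=; apply/andP; split.
    by apply/orP; right; apply/hasP; exists y.
  by apply/allP => z /(allP al) /andP[-> ->].
- rewrite ul andbT; apply/negP => /(allP al) /andP[_].
  by rewrite -va (negbTE ntv).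
- split.
    by move=> b; rewrite inE mem_rcons inE => /predU1P[->|/sl ->]; rewrite ?eqxx ?orbT.
  case: (l') sl sl' => //= b r sl ->; rewrite andbT; apply: la; rewrite ?mem_head//.
  by apply: sl; rewrite mem_head.
Qed.

(* [U] contains every site at distance less than [n] from [w] that can be reached
   without crossing [Z]. *)
Definition encloses U Z w n := forall p u, walk w (rcons p u) ->
  {subset p <= U} -> (size p < n)%N -> ~~ taint0 U Z u.

Lemma taint_chain x U Z t l w n : ringlist x U t l -> encloses U Z w n ->
  taint U Z (map fst l) w -> chain x U n w t.
Proof.
move=> [pl ml] far /(taint_path pl)[l' [u [u0 wu al ul [sl sl']]]].
have nl : (n <= size l')%N.
  rewrite leqNgt; apply/negP => ln; have := far _ _ wu; rewrite size_map u0 => H.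
  by move: (H (fun y yl => proj1 (andP (allP al y yl))) ln).
exists (take n l'); rewrite map_take; split.
- by rewrite size_takel.
- have := walk_take n wu; rewrite -cats1 takel_cat// size_map//.
- exact: take_uniq.
- exact: take_sorted.
- by apply/allP => a /mem_take /sl; rewrite ml.
Qed.

Definition start Z s v := (v \in Z) || s v.

(** Read off the finite run on [U] with [Z] up: [w] is up at [T] and after each later ring until
    [T']. When no chain reaches [w], this is what a trajectory does there. *)
Definition held_up x U Z w T T' := exists l1 l2,
  [/\ ringlist x U T l1, ringlist x U T' (l1 ++ l2) &
   steady false U w (start Z (ini x)) (size l1) (coins x (l1 ++ l2))].

Section trajectory_held_up.
Variables (x : source -> R) (U Z : seq G) (w : G) (T T' : R) (n : nat).
Variable sigma : R -> G -> bool.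
Hypotheses (gx : good_clocks x) (T0 : 0 <= T) (TT' : T <= T').
Hypotheses (tx : trajectory x U sigma) (encl : encloses U Z w n).
Hypotheses (nch : ~ chain x U n w T') (ZU : forall z, z \in Z -> z \notin U).
Hypothesis sU : forall v, v \in U -> sigma 0 v = ini x v.
Hypothesis sZ : forall v (s : R), v \in Z -> 0 <= s <= T' -> sigma s v.

Lemma sigma_run (t : R) l : 0 <= t <= T' -> ringlist x U t l ->
  sigma t w = run false U (start Z (ini x)) (coins x l) w.
Proof.
move=> /andP[t0 tT'] rl; apply: (trajectory_run (Z := Z) gx t0 tx rl).
- by move=> v vU; rewrite sU// /start (_ : v \in Z = false)//; apply/negP => /ZU; rewrite vU.
- by move=> v s vZ /andP[s0 st]; rewrite sZ// ?s0 ?(le_trans st)// /start vZ.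
- by apply/negP => /(taint_chain rl encl) /(chain_le (fun _ => id) tT').
Qed.

Lemma held_up_sigma : (forall t : R, T <= t <= T' -> sigma t w) -> held_up x U Z w T T'.
Proof.
move=> H; have [l1 [l2 [r1 r2]]] := ringlist_exists U gx TT'.
exists l1, l2; split=> //; apply/steadyP; first by rewrite size_map size_cat leq_addr.
move=> i; rewrite size_map => /andP[i1 i2]; rewrite -map_take.
have [->|il] := eqVneq i (size l1).
  by rewrite take_size_cat// -(@sigma_run T)// ?T0 ?H// lexx.
have [pl ml] := r2.
have {il} i0 : (size l1 < i)%N by rewrite ltn_neqAle eq_sym il.
have [i' ii'] : exists i', i = i'.+1 by case: i i0 {i1 i2} => // i _; exists i.
have i'l : (i' < size (l1 ++ l2))%N by rewrite -ii'.
have a0 : (G * nat)%type by case: (l1 ++ l2) i'l => [|a _ _]//; exact: a.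
(* The state after [i] steps is the one at the time of the [i]-th ring [a]. This time exceeds [T],
   since [a] comes after the prefix [l1]. *)
pose a := nth a0 (l1 ++ l2) i'; have al : a \in l1 ++ l2 by exact: mem_nth.
have [aU aT'] : a.1 \in U /\ ring x a <= T' by apply/andP; rewrite -ml.
have Ta : T < ring x a.
  rewrite ltNge; apply/negP => aT; have := r1.2 a; rewrite aU aT => al1.
  have /(nthP a0)[j jl ja] : a \in l1 by rewrite al1.
  move/(pairwiseP a0) : pl => /(_ j i'); rewrite !inE i'l (leq_trans jl)//; last first.
    by rewrite size_cat leq_addr.
  move=> /(_ isT isT); rewrite nth_cat jl ja -/a ltxx -ltnS -ii' => H'.
  by suff : false by []; apply: H'; exact: leq_ltn_trans jl i0.
rewrite -(@sigma_run (ring x a)); first by apply: H; rewrite (ltW Ta).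
  by rewrite aT' ltW// ring_gt0.
split; first by move: pl; rewrite -{1}(cat_take_drop i (l1 ++ l2)) pairwise_cat => /and3P[].
move=> b; apply/idP/idP.
  move=> bi; have bl := mem_take bi; have := ml b; rewrite bl => /esym/andP[-> _] /=.
  move: bi => /(nthP a0)[j]; rewrite size_takel// => ji; rewrite nth_take// => <-.
  move: ji; rewrite ii' ltnS leq_eqVlt => /predU1P[->|ji]//.
  apply: ltW; move/(pairwiseP a0) : pl; apply; rewrite ?inE//.
  exact: ltn_trans i'l.
move=> /andP[bU ba]; have := ml b; rewrite bU (le_trans ba aT') /=.
move=> /(nthP a0)[j jl jb]; have [ji|ij] := leqP j i'.
  by apply/(nthP a0); exists j; rewrite ?size_takel ?nth_take// ii'.
have : ring x a < ring x b.
  by rewrite -jb; move/(pairwiseP a0) : pl; apply; rewrite ?inE.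
by rewrite ltNge ba.
Qed.

Lemma sigma_held_up : held_up x U Z w T T' -> forall t : R, T <= t <= T' -> sigma t w.
Proof.
move=> [l1 [l2 [r1 r2 st]]] t /andP[Tt tT'].
have [i il ri] := ringlist_prefix Tt tT' r1 r2.
rewrite (sigma_run _ ri) ?tT' ?(le_trans T0)//.
have := st => /steadyP; rewrite size_map size_cat leq_addr => /(_ isT (size l1 + i)%N).
by rewrite leq_addr leq_add2l il /coins -map_take take_cat ltnNge leq_addr /= addKn; apply.
Qed.

End trajectory_held_up.

End glauber_runs.

(** * The law of the data *)

Section exponential_facts.
Context (R : realType).
Local Notation mu := (@lebesgue_measure R).

Lemma exponential_pdf_le1 (y : R) : exponential_pdf 1 y <= 1.
Proof.
have [y0|y0] := leP 0 y; last by rewrite lt0_exponential_pdf.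
by rewrite exponential_pdfE// mul1r mulN1r expR_le1 oppr_le0.
Qed.

Lemma exponential_prob_itvoc (a b : R) : a <= b ->
  (exponential_prob 1 `]a, b]%classic <= (b - a)%:E)%E.
Proof.
move=> ab; rewrite /exponential_prob.
apply: (@le_trans _ _ (\int[mu]_(y in `]a, b]%classic) (cst 1%E) y)%E).
  apply: ge0_le_integral => //=.
  - by move=> y _; rewrite lee_fin exponential_pdf_ge0.
  - apply/measurable_EFinP; apply: measurable_funTS.
    exact: measurable_exponential_pdf.
  - by move=> y _; rewrite lee_fin exponential_pdf_le1.
rewrite integral_cst//= mul1e lebesgue_measure_itv/= lte_fin.
by case: ifPn => // _; rewrite lee_fin subr_ge0.
Qed.

Definition fair_sign (A : set R) : \bar R :=
  (2^-1 * ((1 \in A)%:R + (-1 \in A)%:R))%:E.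

Definition source_law (o : option (bool * nat)) (A : set R) : \bar R :=
  if o is Some (true, _) then exponential_prob 1 A else fair_sign A.

End exponential_facts.

Section glauber_data.
Context (R : realType) d (Omega : measurableType d) (P : probability Omega R).

Definition glauber_data (G : countType) (X : Omega -> source G -> R) :=
  [/\ measurable_data X, independent P X &
   forall j A, measurable A -> P [set w | A (X w j)] = source_law j.2 A].

Lemma glauber_data_law (G : countType) (X Y : Omega -> source G -> R) E :
  glauber_data X -> glauber_data Y -> measurable (E : set (dspace (source G) R)) ->
  pr P (X @^-1` E) = pr P (Y @^-1` E).
Proof.
move=> [mX iX lX] [mY iY lY]; apply: independent_law => //.
by move=> j A mA; rewrite lX// lY.
Qed.

Definition reindex (G G' : countType) (k : G' -> G) (x : source G -> R) : source G' -> R :=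
  fun j => x (k j.1, j.2).

Lemma glauber_data_reindex (G G' : countType) (k : G' -> G) X : injective k ->
  glauber_data X -> glauber_data (fun w => reindex k (X w)).
Proof.
move=> kI [mX iX lX]; split; first by move=> j; exact: mX.
  move=> s A us mA; pose h (j : source G') : source G := (k j.1, j.2).
  have hI : injective h by move=> [v o] [v' o'] [/kI -> ->].
  (* The constraints are carried along the injection [h]; coordinates that are not images of members
     of [s] are left free. *)
  pose A' j := if [pick i : 'I_(size s) | h (tnth (in_tuple s) i) == j] is Some i
    then A (tnth (in_tuple s) i) else setT.
  have A'E j : j \in s -> A' (h j) = A j.
    move=> js; have /tnthP[i ->] : j \in in_tuple s by [].
    rewrite /A'; case: pickP => [i' /eqP/hI ->//|/(_ i)].
    by rewrite eqxx.
  have := iX (map h s) A'; rewrite map_inj_uniq// => /(_ us).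
  rewrite big_map big_seq (eq_bigr (fun j => P [set w | A j (reindex k (X w) j)])); last first.
    by move=> j js; rewrite A'E.
  rewrite -big_seq => <-; last by move=> j; rewrite /A'; case: pickP.
  congr (P _); apply/seteqP; split=> w /= H j.
    by move=> /mapP[i si ->]; rewrite A'E//; exact: H.
  by move=> js; have := H (h j) (map_f h js); rewrite A'E.
by move=> j A mA; rewrite lX.
Qed.

(** The spin symmetry acts on the initial spins alone: coins decide whether to flip, whatever the
    spin is, and waiting times do not see it. *)
Definition reflect_spins (G : countType) (b : bool) (x : source G -> R) : source G -> R :=
  fun j => if b && (j.2 == None) then - x j else x j.

Let measurable_preimageN (A : set R) : measurable A -> measurable (-%R @^-1` A).
Proof.
move=> mA; rewrite -[X in measurable X]setTI.
by have mN : measurable_fun setT (-%R : R -> R) by []; exact: mN.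
Qed.

Lemma glauber_data_reflect (G : countType) b X :
  glauber_data X -> glauber_data (fun w => reflect_spins (G := G) b (X w)).
Proof.
move=> [mX iX lX]; split.
- move=> j; have mXj := mX j; rewrite /reflect_spins; case: (b && _) => //.
  exact: measurableT_comp.
- move=> s A us mA.
  pose A' (j : source G) := if b && (j.2 == None) then -%R @^-1` (A j) else A j.
  have mA' j : measurable (A' j).
    by rewrite /A'; case: ifP => _ //; exact: measurable_preimageN.
  have E j w : A j (reflect_spins b (X w) j) = A' j (X w j).
    by rewrite /A' /reflect_spins; case: ifP.
  have := iX s A' us mA'.
  rewrite (eq_bigr (fun j => P [set w | A j (reflect_spins b (X w) j)])); last first.
    by move=> j _; congr (P _); apply/seteqP; split=> w; rewrite /= E.
  move=> <-; congr (P _); apply/seteqP; split=> w /= H j js.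
    by rewrite -E; exact: H.
  by rewrite E; exact: H.
- move=> [v o] A mA; have lXv := lX (v, o) A mA; rewrite /reflect_spins /=.
  case E : (b && _) => //; move: E lXv => /andP[_ /eqP ->] _.
  rewrite -[LHS]/(P [set w | (-%R @^-1` A) (X w (v, None))]) lX; last exact: measurable_preimageN.
  rewrite /= /fair_sign addrC; congr (_ * (_ + _))%:E.
  congr (nat_of_bool _)%:R; apply/idP/idP; rewrite !inE /= ?opprK//.
Qed.

Section marginals.
Variables (G : countType) (X : Omega -> source G -> R).
Hypothesis gX : glauber_data X.

Lemma glauber_measurable (E : set (source G -> R)) :
  measurable (E : set (dspace (source G) R)) -> measurable (X @^-1` E).
Proof. by move=> mE; apply: measurable_preimage => //; case: gX. Qed.

Lemma pr_coord j A : measurable A -> pr P [set w | A (X w j)] = fine (source_law j.2 A).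
Proof. by move=> mA; rewrite /pr; case: gX => _ _ ->. Qed.

Let positive_set (b : bool) : set R := [set r | (0 < r) = b].

Let measurable_positive b : measurable (positive_set b).
Proof.
have m : mpred (fun r : R => 0 < r) by apply: mpred_lt.
case: b => //; apply: mpred_eq (mpredN m) => r; split; first by move/negP/negbTE.
by move=> ->.
Qed.

Let fair_positive b : fine (fair_sign (positive_set b)) = 2^-1.
Proof.
have pP (r : R) : (r \in positive_set b) = ((0 < r) == b).
  by apply/idP/eqP; rewrite inE.
by rewrite /fair_sign /= !pP ltr01 ltr0N1; case: b {pP} => /=; rewrite ?addr0 ?add0r mulr1.
Qed.

Lemma pr_ini v (b : bool) : pr P [set w | ini (X w) v = b] = 2^-1.
Proof.
rewrite -[LHS]/(pr P [set w | positive_set b (X w (v, None))]) pr_coord//.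
exact: fair_positive.
Qed.

Lemma pr_flip v k (b : bool) : pr P [set w | flip (X w) v k = b] = 2^-1.
Proof.
rewrite -[LHS]/(pr P [set w | positive_set b (X w (v, Some (false, k)))]) pr_coord//.
exact: fair_positive.
Qed.

Lemma pr_wait_itv v k a b : a <= b -> pr P [set w | a < wait (X w) v k <= b] <= b - a.
Proof.
move=> ab; have -> : [set w | a < wait (X w) v k <= b] =
    [set w | `]a, b]%classic (X w (v, Some (true, k)))].
  by apply/seteqP; split=> w; rewrite /= in_itv.
rewrite -lee_fin -fin_pr; last by apply: mpred_fun => //; case: gX.
by case: gX => _ _ -> //=; exact: exponential_prob_itvoc.
Qed.

Lemma measurable_wait v k (A : set R) : measurable A -> measurable [set w | A (wait (X w) v k)].
Proof. by move=> mA; case: gX => mX _ _; exact: (mpred_fun (mX _) mA). Qed.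

Lemma pr_wait_le v k t : 0 < t -> pr P [set w | wait (X w) v k <= t] <= 1 - expR (- t).
Proof.
move=> t0.
have m1 := measurable_wait v k (measurable_itv `[0, t]).
have m0 e : measurable [set w | - e < wait (X w) v k <= 0].
  by have := measurable_wait v k (measurable_itv `]-e, 0]).
have mle (a : R) : measurable [set w | wait (X w) v k <= a].
  by have := measurable_wait v k (measurable_itv `]-oo, a]).
have p1 (s : R) : 0 < s -> pr P [set w | `[0, s]%classic (wait (X w) v k)] = 1 - expR (- s).
  move=> s0; rewrite pr_coord//= -[X in fine X]/(exponential_prob 1 `[0, s]%classic).
  by rewrite exponential_prob_itv0c//= mulN1r.
(* The explicit formula only covers intervals [[0, s]]. For large [s] the complement has mass at
   most e / 2, and the interval from -e / 2 to 0 adds at most e / 2. *)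
have p0 : pr P [set w | wait (X w) v k <= 0] <= 0.
  apply/ler_addgt0Pr => e e0; rewrite add0r.
  have [s s0 se] : exists2 s : R, 0 < s & expR (- s) <= e / 2.
    exists (Num.max 1 (- ln (e / 2))); first by rewrite lt_max ltr01.
    rewrite -[leRHS]lnK ?posrE ?divr_gt0// ler_expR lerNl le_max lexx orbT//.
  apply: (@le_trans _ _ (pr P (~` [set w | `[0, s]%classic (wait (X w) v k)] `|`
      [set w | - (e / 2) < wait (X w) v k <= 0]))).
    apply: pr_le => //.
      by apply: measurableU => //; apply/measurableC/measurable_wait.
    move=> w /= w0; have [wl|wl] := ltP (- (e / 2)) (wait (X w) v k); first by right.
    left; rewrite /= in_itv /= => /andP[w0' _]; move: wl e0; lra.
  apply: le_trans (prU_le _ _ _) _ => //; first by apply/measurableC/measurable_wait.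
  rewrite prC; last exact: measurable_wait.
  rewrite p1//; have := @pr_wait_itv v k (- (e / 2)) 0; rewrite oppr_le0 => /(_ _).
  have e2 : 0 <= e / 2 by rewrite divr_ge0// ltW.
  move=> /(_ e2); move: se; lra.
apply: (@le_trans _ _ (pr P ([set w | wait (X w) v k <= 0] `|`
    [set w | `[0, t]%classic (wait (X w) v k)]))).
  apply: pr_le => //; first exact: measurableU.
  move=> w /= wt; have [w0|w0] := leP (wait (X w) v k) 0; [by left|right].
  by rewrite /= in_itv /= wt ltW.
apply: le_trans (prU_le _ _ _) _ => //.
by rewrite p1//; move: p0; lra.
Qed.

Lemma pr_wait_le0 v k : pr P [set w | wait (X w) v k <= 0] = 0.
Proof.
have mle (a : R) : measurable [set w | wait (X w) v k <= a].
  by have := measurable_wait v k (measurable_itv `]-oo, a]).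
apply/eqP; rewrite eq_le pr_ge0 andbT; apply/ler_addgt0Pr => e e0; rewrite add0r.
apply: le_trans (pr_le P (mle 0) (mle e) _) _; first by move=> w /= /le_trans; apply; exact: ltW.
apply: le_trans (pr_wait_le v k e0) _.
by have := expR_ge1Dx (- e); lra.
Qed.

Lemma pr_wait_gt v k t : 0 < t -> expR (- t) <= pr P [set w | t < wait (X w) v k].
Proof.
move=> t0; have mle : measurable [set w | wait (X w) v k <= t].
  by have := measurable_wait v k (measurable_itv `]-oo, t]).
have -> : [set w | t < wait (X w) v k] = ~` [set w | wait (X w) v k <= t].
  by apply/seteqP; split=> w /=; rewrite ltNge => /negP.
by rewrite prC//; have := pr_wait_le v k t0; lra.
Qed.

End marginals.

End glauber_data.

Section measurable_rings.
Context (G : countType) (R : realType).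
Local Notation D := (dspace (source G) R).

Lemma measurable_wait_coord v k : measurable_fun setT (fun x : D => wait x v k).
Proof. exact: measurable_coord. Qed.

Lemma measurable_ring a : measurable_fun setT (fun x : D => ring x a).
Proof. by apply: measurable_sum => k; exact: measurable_wait_coord. Qed.

Lemma mpred_ini v : mpred (fun x : D => ini x v).
Proof. by apply: mpred_lt => //; exact: measurable_coord. Qed.

Lemma mpred_flip v k : mpred (fun x : D => flip x v k).
Proof. by apply: mpred_lt => //; exact: measurable_coord. Qed.

Lemma mpred_ring_le a t : mpred (fun x : D => ring x a <= t).
Proof. by apply: mpred_le => //; exact: measurable_ring. Qed.

Lemma mpred_ring_lt a b : mpred (fun x : D => ring x a < ring x b).
Proof. by apply: mpred_lt; exact: measurable_ring. Qed.

Lemma ring_ext (x y : source G -> R) a :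
  (forall k, x (a.1, Some (true, k)) = y (a.1, Some (true, k))) -> ring x a = ring y a.
Proof. by move=> xy; apply: eq_bigr => k _; exact: xy. Qed.

Definition bin (delta : R) j r := j%:R * delta < r <= j.+1%:R * delta.

Lemma bin_inj delta i j r : 0 < delta -> bin delta i r -> bin delta j r -> i = j.
Proof.
move=> d0; suff H a b : bin delta a r -> bin delta b r -> (a <= b)%N.
  by move=> ri rj; apply/eqP; rewrite eqn_leq !H.
move=> /andP[ra _] /andP[_ rb]; rewrite leqNgt; apply/negP => ba.
have := lt_le_trans ra rb; rewrite ltr_pM2r// ltr_nat ltnS leqNgt.
by rewrite ba.
Qed.

Lemma bin_exists delta r : 0 < delta -> 0 < r -> exists j, bin delta j r.
Proof.
move=> d0 r0; have [n] : exists n : nat, r <= n%:R * delta.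
  exists (Num.bound (r / delta)); rewrite -ler_pdivrMr//.
  by apply/ltW/archi_boundP; rewrite divr_ge0// ltW.
elim: n => [|n IH]; first by rewrite mul0r leNgt r0.
have [/IH //|nr rn] := leP r (n%:R * delta).
by exists n; rewrite /bin nr rn.
Qed.

(** Positivity of the waiting times of [v] is part of the event, so that the estimates need no
    exceptional set and the event depends on the data of [v] only. *)
Definition ring_in_bin (delta : R) v j : set (source G -> R) :=
  [set x | (forall i, 0 < wait x v i) /\ exists k, bin delta j (ring x (v, k))].

Lemma mpred_bin delta j a : mpred (fun x : D => bin delta j (ring x a)).
Proof.
apply: (@mpred_eq _ _ (fun x : D => j%:R * delta < ring x a /\ ring x a <= j.+1%:R * delta)).
  by move=> x; rewrite /bin; split=> [[-> ->]|/andP[]].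
apply: mpredI; last exact: mpred_ring_le.
by apply: mpred_lt => //; exact: measurable_ring.
Qed.

Lemma mpred_wait_gt0 v i : mpred (fun x : D => 0 < wait x v i).
Proof. by apply: mpred_lt => //; exact: measurable_wait_coord. Qed.

Lemma measurable_ring_in_bin delta v j : measurable (ring_in_bin delta v j : set D).
Proof.
apply: (@mpredI _ D (fun x => forall i, 0 < wait x v i)
  (fun x => exists k, bin delta j (ring x (v, k)))).
  by apply: mpred_forall => i; exact: mpred_wait_gt0.
by apply: mpred_exists => k; exact: mpred_bin.
Qed.

Lemma ring_in_bin_depends delta v j :
  depends_on [set i | i.1 = v] (ring_in_bin delta v j).
Proof.
move=> x y xy [pos [k rk]]; split=> [i|]; first by rewrite /wait -xy//; exact: pos.
by exists k; rewrite -(@ring_ext x)// => i; exact: xy.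
Qed.

End measurable_rings.

Section ring_estimates.
Context (R : realType) d (Omega : measurableType d) (P : probability Omega R).
Context (G : countType) (X : Omega -> source G -> R).
Hypothesis gX : glauber_data P X.
Local Notation D := (dspace (source G) R).

(** Split according to the bin [i] of the preceding ring. The next waiting time is independent of it
    and must fall in an interval of length [2 * delta]; its density is at most 1, and the
    probabilities of the bins [i] sum to at most 1. *)
Lemma pr_ring_bin delta v k j : 0 < delta ->
  pr P [set w | (forall i, (i <= k)%N -> 0 < wait (X w) v i) /\
                bin delta j (ring (X w) (v, k))] <= 2 * delta.
Proof.
move=> d0.
pose E k j : set (source G -> R) :=
  [set x | (forall i, (i <= k)%N -> 0 < wait x v i) /\ bin delta j (ring x (v, k))].
have mE k' j' : measurable (E k' j' : set D).
  apply: (@mpredI _ D (fun x => forall i, (i <= k')%N -> 0 < wait x v i)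
    (fun x => bin delta j' (ring x (v, k')))); last exact: mpred_bin.
  by apply: mpred_forall => i; apply: mpred_impl; [exact: mpred_cst|exact: mpred_wait_gt0].
rewrite -[leLHS]/(pr P (X @^-1` (E k j))).
have mw a b k' : measurable [set x : D | a < wait x v k' <= b].
  by have := mpred_fun (measurable_wait_coord v k') (measurable_itv `]a, b]).
case: k => [|k].
  apply: (@le_trans _ _ (pr P [set w | j%:R * delta < wait (X w) v 0 <= j.+1%:R * delta])).
    apply: pr_le; [exact: (glauber_measurable gX)|exact: (glauber_measurable gX (mw _ _ _))|].
    by move=> w [_]; rewrite /ring /ring_time /= big_ord1.
  apply: le_trans (pr_wait_itv gX _ _ _) _.
    by rewrite ler_pM2r// ler_nat.
  by rewrite -natr1 mulrDl mul1r; move: d0; lra.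
pose W i : set (source G -> R) :=
  [set x | (j%:R - i.+1%:R) * delta < wait x v k.+1 <= (j.+1%:R - i%:R) * delta].
have sub : X @^-1` (E k.+1 j) `<=`
    [set w | exists2 i, i \in iota 0 j.+1 & (X @^-1` (E k i) `&` X @^-1` (W i)) w].
  move=> w [pos /andP[jr rj]].
  have r0 : 0 < ring (X w) (v, k).
    rewrite /ring /ring_time /= big_ord_recr /=.
    apply: ltr_wpDl; last exact: pos.
    by apply: sumr_ge0 => i _; apply/ltW/pos; rewrite ltnW// ltnS ltnW.
  have rS : ring (X w) (v, k.+1) = ring (X w) (v, k) + wait (X w) v k.+1.
    by rewrite /ring /ring_time /= big_ord_recr.
  have w0 : 0 < wait (X w) v k.+1 by exact: pos.
  have [i /[dup] bi /andP[ir ri]] := bin_exists d0 r0.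
  exists i.
    rewrite mem_iota /= add0n ltnS leqNgt; apply/negP => ji.
    have : i%:R * delta < j.+1%:R * delta by move: ir rj; rewrite rS; lra.
    by rewrite ltr_pM2r// ltr_nat ltnS leqNgt ji.
  split; first by split=> // i' i'k; apply: pos; exact: leqW.
  rewrite /W /=; move: jr rj; rewrite rS !mulrBl; move: ir ri; lra.
have mEW i : measurable (X @^-1` (E k i) `&` X @^-1` (W i)).
  apply: measurableI; first exact: (glauber_measurable gX).
  exact: (glauber_measurable gX (mw _ _ _)).
apply: le_trans (pr_le P _ _ sub) _.
- exact: (glauber_measurable gX).
- by apply: measurable_exists_in => i _.
apply: le_trans (pr_exists_le P _) _; first by move=> i _.
apply: (@le_trans _ _ (\sum_(i <- iota 0 j.+1) pr P (X @^-1` (E k i)) * (2 * delta))).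
  apply: ler_sum => i _; have [mX iX _] := gX.
  rewrite (@independent_depends _ _ _ _ _ _ [set s | exists2 i, (i <= k)%N & s = (v, Some (true, i))]
    [set (v, Some (true, k.+1))])//.
  - apply: ler_wpM2l; first exact: pr_ge0.
    apply: le_trans (pr_wait_itv gX _ _ _) _.
      by rewrite ler_pM2r// -!natr1; lra.
    by rewrite -!natr1 -mulrBl ler_pM2r//; lra.
  - by apply/seteqP; split=> // s [[i' ik ->]] [/eqP]; rewrite ltn_eqF.
  - exact: mw.
  - move=> x y xy [pos bx]; have wE i' : (i' <= k)%N -> wait x v i' = wait y v i'.
      by move=> ik; apply: xy; exists i'.
    split; first by move=> i' ik; rewrite -wE//; exact: pos.
    move: bx; rewrite /bin /ring /ring_time /= (eq_bigr (fun i : 'I_k.+1 => wait y v i))//.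
    by move=> [i' ik] _; exact: wE.
  - by move=> x y xy; rewrite /W /= /wait xy.
rewrite -mulr_suml ler_piMl//; first by rewrite mulr_ge0// ltW.
apply: pr_sum_le1 => [i|a b w [_ wa] [_ wb]]; first exact: (glauber_measurable gX).
exact: bin_inj d0 wa wb.
Qed.

Lemma pr_rings_le t v K : 0 < t ->
  pr P [set w | forall k, (k < K)%N -> wait (X w) v k <= t] <= (1 - expR (- t)) ^+ K.
Proof.
move=> t0; have [mX iX _] := gX.
have mw k : measurable [set x : D | wait x v k <= t].
  by apply: (@mpred_le _ D _ (fun x => wait x v k) (fun=> t)) => //; exact: measurable_wait_coord.
have := @independent_depends_seq _ _ _ _ P X _ (iota 0 K)
  (fun k => [set (v, Some (true, k))]) (fun k => [set x | wait x v k <= t]) mX iX (iota_uniq _ _).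
rewrite (_ : [set w | forall i, i \in iota 0 K -> _] =
    [set w | forall k, (k < K)%N -> wait (X w) v k <= t]); last first.
  by apply/seteqP; split=> w /= H k; have := H k; rewrite mem_iota add0n.
move=> ->.
- rewrite -[X in _ <= _ ^+ X](size_iota 0 K).
  elim: (iota 0 K) => [|k s IH]; rewrite ?big_nil// big_cons exprS ler_pM ?pr_ge0//.
    by apply: prodr_ge0 => i _; exact: pr_ge0.
  exact: (pr_wait_le gX v k t0).
- move=> i k _ _ ik; apply/seteqP; split=> // s [->] [ki].
  by rewrite ki eqxx in ik.
- by move=> k _; exact: mw.
- by move=> k _ x y xy /=; rewrite /wait xy.
Qed.

(** Up to probability e / 2 one of the first [K] waiting times exceeds [t], so that only the first
    [K] rings can fall in the bin, each with probability at most [2 * delta]. The bound is uniform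
    in the site and in the bin. *)
Lemma pr_ring_in_bin_small t e : 0 < e -> exists2 delta, 0 < delta <= e &
  forall v j, j.+1%:R * delta <= t -> pr P (X @^-1` (ring_in_bin delta v j)) <= e.
Proof.
move=> e0; have [t0|t0] := ltP 0 t; last first.
  exists e; rewrite ?e0 ?lexx// => v j => /le_trans /(_ t0).
  by rewrite leNgt mulr_gt0.
have q0 : 0 <= 1 - expR (- t) by rewrite subr_ge0 expR_le1 oppr_le0 ltW.
have q1 : 1 - expR (- t) < 1 by rewrite ltrBlDr ltrDl expR_gt0.
have [K HK] : exists K, (1 - expR (- t)) ^+ K < e / 2.
  have := cvg_expr (_ : `|1 - expR (- t)| < 1); rewrite ger0_norm// => /(_ q1).
  move=> /cvgrPdist_lt /(_ (e / 2)); rewrite divr_gt0// => /(_ isT)[K _ /(_ K (leqnn _))] /=.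
  by rewrite sub0r normrN ger0_norm ?exprn_ge0// => ?; exists K.
(* Chosen so that [K] rings cost at most e / 2 together; [K.+1] avoids a division by 0. *)
exists (e / 2 / (2 * K.+1%:R)).
  rewrite !divr_gt0 ?mulr_gt0//= ler_pdivrMr ?mulr_gt0// ler_pdivrMr//.
  by rewrite -[leLHS]mulr1 -mulrA ler_pM2l// -natrM -natrM ler1n.
set delta := e / 2 / _ => v j jt.
have d0 : 0 < delta by rewrite !divr_gt0// mulr_gt0.
pose E k : set (source G -> R) :=
  [set x | (forall i, (i <= k)%N -> 0 < wait x v i) /\ bin delta j (ring x (v, k))].
pose W : set (source G -> R) := [set x | forall k, (k < K)%N -> wait x v k <= t].
have mE k : measurable (E k : set D).
  apply: (@mpredI _ D (fun x => forall i, (i <= k)%N -> 0 < wait x v i)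
    (fun x => bin delta j (ring x (v, k)))); last exact: mpred_bin.
  by apply: mpred_forall => i; apply: mpred_impl; [exact: mpred_cst|exact: mpred_wait_gt0].
have mW : measurable (W : set D).
  apply: (@mpred_forall _ D _ (fun k x => (k < K)%N -> wait x v k <= t)) => k.
  apply: mpred_impl; first exact: mpred_cst.
  by apply: (@mpred_le _ D _ (fun x => wait x v k) (fun=> t)) => //; exact: measurable_wait_coord.
have sub : X @^-1` (ring_in_bin delta v j) `<=`
    X @^-1` W `|` [set w | exists2 k, k \in iota 0 K & E k (X w)].
  move=> w [pos [k bk]]; have [kK|Kk] := ltnP k K.
    by right; exists k; rewrite ?mem_iota//; split.
  left => i iK; have /andP[_ /le_trans /(_ jt)] := bk; apply: le_trans.
  rewrite /ring /ring_time /= (bigD1 (Ordinal (leq_trans iK (leqW Kk))))//= lerDl.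
  by apply: sumr_ge0 => l _; apply/ltW/pos.
have mU : measurable [set w | exists2 k, k \in iota 0 K & E k (X w)].
  by apply: measurable_exists_in => k _; exact: (glauber_measurable gX).
apply: le_trans (pr_le P _ _ sub) _.
- exact: (glauber_measurable gX (measurable_ring_in_bin _ _ _)).
- by apply: measurableU => //; exact: (glauber_measurable gX).
apply: le_trans (prU_le P _ _) _ => //; first exact: (glauber_measurable gX).
rewrite [leRHS](splitr e); apply: lerD; first by apply: le_trans (pr_rings_le v K t0) (ltW HK).
apply: le_trans (pr_exists_le P _) _; first by move=> k _; exact: (glauber_measurable gX).
apply: (@le_trans _ _ (\sum_(k <- iota 0 K) (2 * delta))).
  by apply: ler_sum => k _; exact: pr_ring_bin.
rewrite big_const_seq count_predT size_iota iter_addr_0 -(mulr_natr _ K).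
have : delta * (2 * K.+1%:R) = e / 2 by rewrite /delta mulfVK// mulf_neq0// pnatr_eq0.
by move=> <-; rewrite -natr1; move: d0; lra.
Qed.

Lemma measurable_same_ring a b t :
  measurable ([set x | [/\ forall v i, 0 < wait x v i, ring x a = ring x b &
      ring x a <= t]] : set D).
Proof.
apply: (@mpred_eq _ D (fun x => (forall v i, 0 < wait x v i) /\
  ((ring x a <= ring x b /\ ring x b <= ring x a) /\ ring x a <= t))).
  move=> x; split=> [[? [/andP/le_anti ? ?]]|[? E' ?]]; first by split.
  by split=> //; split=> //; rewrite E' lexx.
apply: mpredI; first by apply: mpred_forall => v; apply: mpred_forall => i; exact: mpred_wait_gt0.
apply: mpredI; last exact: mpred_ring_le.
by apply: mpredI; apply: mpred_le; exact: measurable_ring.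
Qed.

(** Equal ring times lie in the same bin. As the sites differ, the two rings are independent, so the
    sum over the bins before [t] is at most [2 * delta], for any [delta]. *)
Lemma pr_same_ring a b t : a.1 != b.1 ->
  pr P [set w | [/\ forall v i, 0 < wait (X w) v i, ring (X w) a = ring (X w) b &
    ring (X w) a <= t]] = 0.
Proof.
move=> ab; set N := [set w | _].
pose E (c : G * nat) delta j : set (source G -> R) :=
  [set x | (forall i, (i <= c.2)%N -> 0 < wait x c.1 i) /\ bin delta j (ring x c)].
have mE c delta j : measurable (E c delta j : set D).
  apply: (@mpredI _ D (fun x => forall i, (i <= c.2)%N -> 0 < wait x c.1 i)
    (fun x => bin delta j (ring x c))); last exact: mpred_bin.
  by apply: mpred_forall => i; apply: mpred_impl; [exact: mpred_cst|exact: mpred_wait_gt0].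
have dE c delta j : depends_on [set i | i.1 = c.1] (E c delta j).
  move=> x y xy [pos bx]; split=> [i /pos|]; first by rewrite /wait xy.
  by rewrite -(@ring_ext _ _ x)// => i; exact: xy.
have mN : measurable N by exact: (glauber_measurable gX (measurable_same_ring a b t)).
apply/eqP; rewrite eq_le pr_ge0 andbT; apply/ler_addgt0Pr => e e0; rewrite add0r.
have d0 : 0 < e / 2 by rewrite divr_gt0.
set delta := e / 2 in d0.
have [M HM] : exists M : nat, t <= M%:R * delta.
  exists (Num.bound (`|t| / delta)); rewrite -ler_pdivrMr//.
  apply: ltW; apply: le_lt_trans (archi_boundP _); last by rewrite divr_ge0// ltW.
  by rewrite ler_pM2r ?invr_gt0// ler_norm.
have sub : N `<=` [set w | exists2 j, j \in iota 0 M & (X @^-1` (E a delta j) `&` X @^-1` (E b delta j)) w].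
  move=> w [pos rab rt].
  have r0 : 0 < ring (X w) a.
    rewrite /ring /ring_time /= big_ord_recr /=; apply: ltr_wpDl => //.
    by apply: sumr_ge0 => i _; exact: ltW.
  have [j bj] := bin_exists d0 r0; exists j.
    rewrite mem_iota add0n /=; have /andP[jr _] := bj.
    by have := lt_le_trans jr (le_trans rt HM); rewrite ltr_pM2r// ltr_nat.
  by split; split=> //; rewrite -rab.
have mEE j : measurable (X @^-1` (E a delta j) `&` X @^-1` (E b delta j)).
  by apply: measurableI; exact: (glauber_measurable gX).
apply: le_trans (pr_le P mN _ sub) _; first by apply: measurable_exists_in.
apply: le_trans (pr_exists_le P _) _; first by [].
apply: (@le_trans _ _ (\sum_(i <- iota 0 M) pr P (X @^-1` (E a delta i)) * (2 * delta))).
  apply: ler_sum => i _; have [mX iX _] := gX.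
  rewrite (@independent_depends _ _ _ _ _ _ [set i | i.1 = a.1] [set i | i.1 = b.1])//.
    apply: ler_wpM2l; first exact: pr_ge0.
    by have := @pr_ring_bin delta b.1 b.2 i d0; rewrite -surjective_pairing.
  by apply/seteqP; split=> // s [sa sb]; move: ab; rewrite -sa -sb eqxx.
rewrite -mulr_suml (_ : 2 * delta = e); last by rewrite /delta mulrC divfK.
rewrite ler_piMl//; first exact: ltW.
apply: pr_sum_le1 => [i|i j w [_ bi] [_ bj]]; first exact: (glauber_measurable gX).
exact: bin_inj d0 bi bj.
Qed.

Lemma good_clocks_ae : {ae P, forall w, good_clocks (X w)}.
Proof.
have npos : P.-negligible [set w | exists v i, wait (X w) v i <= 0].
  apply: negligible_exists => v; apply: negligible_exists => i.
  apply: pr0_negligible; last exact: pr_wait_le0.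
  exact: (measurable_wait gX v i (measurable_itv `]-oo, 0])).
(* A ring time is at least its last waiting time, hence unbounded waiting times suffice for the
   rings of a site to exceed every bound. *)
have ninf : P.-negligible [set w | exists v (m : nat), forall k, wait (X w) v k <= m.+1%:R].
  apply: negligible_exists => v; apply: negligible_exists => m.
  set t : R := m.+1%:R; have t0 : 0 < t by rewrite ltr0n.
  have mw K : measurable [set w | forall k, (k < K)%N -> wait (X w) v k <= t].
    apply: mpred_forall => k; apply: mpred_impl; first exact: mpred_cst.
    exact: (measurable_wait gX v k (measurable_itv `]-oo, t])).
  apply: pr_negligible_small => e e0.
  have q0 : 0 <= 1 - expR (- t) by rewrite subr_ge0 expR_le1 oppr_le0 ltW.
  have q1 : 1 - expR (- t) < 1 by rewrite ltrBlDr ltrDl expR_gt0.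
  have [K HK] : exists K, (1 - expR (- t)) ^+ K < e.
    have := cvg_expr (_ : `|1 - expR (- t)| < 1); rewrite ger0_norm// => /(_ q1).
    move=> /cvgrPdist_lt /(_ e e0)[K _ /(_ K (leqnn _))] /=.
    by rewrite sub0r normrN ger0_norm ?exprn_ge0// => ?; exists K.
  exists [set w | forall k, (k < K)%N -> wait (X w) v k <= t]; split=> //.
    by move=> w H k _; exact: H.
  exact: le_lt_trans (pr_rings_le v K t0) HK.
have nsame : P.-negligible [set w | exists (a b : G * nat) (m : nat), [/\ a.1 != b.1,
    forall v i, 0 < wait (X w) v i, ring (X w) a = ring (X w) b & ring (X w) a <= m%:R]].
  apply: negligible_exists => a; apply: negligible_exists => b; apply: negligible_exists => m.
  have [ab|ab] := boolP (a.1 != b.1); last first.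
    by apply: negligibleS (negligible_set0 P) => w [].
  apply: pr_negligible_small => e e0.
  exists [set w | [/\ forall v i, 0 < wait (X w) v i, ring (X w) a = ring (X w) b &
    ring (X w) a <= m%:R]]; split; last by rewrite pr_same_ring.
    exact: (glauber_measurable gX (measurable_same_ring a b m%:R)).
  by move=> w [].
apply: negligibleS (negligibleU npos (negligibleU ninf nsame)) => w.
move=> ng; apply: contrapT => H; apply: ng.
have pos v k : 0 < wait (X w) v k.
  by rewrite ltNge; apply/negP => wk; apply: H; left; exists v, k.
have ring_ge v k : wait (X w) v k <= ring (X w) (v, k).
  rewrite /ring /ring_time /= big_ord_recr /= lerDr.
  by apply: sumr_ge0 => i _; exact: ltW.
have ringS v k : ring (X w) (v, k.+1) = ring (X w) (v, k) + wait (X w) v k.+1.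
  by rewrite /ring /ring_time /= big_ord_recr.
split=> //.
  move=> v t; apply: contrapT => nk; apply: H; right; left.
  exists v, (Num.bound `|t|) => k; apply: le_trans (ring_ge v k) _.
  have [rt|tr] := leP (ring (X w) (v, k)) t; last by case: nk; exists k.
  apply: le_trans rt _; apply: le_trans (ler_norm t) _; apply: ltW.
  by apply: lt_le_trans (archi_boundP _) _; rewrite ?normr_ge0// ler_nat.
move=> a b rab; have [ab|ab] := eqVneq a.1 b.1; last first.
  exfalso; apply: H; right; right; exists a, b, (Num.bound `|ring (X w) a|); split=> //.
  by apply: le_trans (ler_norm _) _; apply/ltW/archi_boundP/normr_ge0.
case: a b rab ab => v k [v' k'] /= rab vv; rewrite -vv in rab *.
have mono i j : (i < j)%N -> ring (X w) (v, i) < ring (X w) (v, j).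
  elim: j => // j IH; rewrite ltnS leq_eqVlt => /predU1P[->|/IH /lt_trans].
    by rewrite ringS ltrDl.
  by apply; rewrite ringS ltrDl.
have [/mono|/mono|->//] := ltngtP k k'; by rewrite rab ltxx.
Qed.

End ring_estimates.

(** * Chains of influence are short *)

Section chain_estimate.
Context (G : countType) (nb : G -> seq G) (deg : nat).
Hypotheses (deg_gt0 : (0 < deg)%N) (size_nb : forall v, size (nb v) = deg).

(** The list has repetitions: the last site is listed once per neighbour, which makes the number of
    entries exactly [deg ^ n]. *)
Fixpoint walks w n : seq (seq G) :=
  if n is n'.+1 then [seq w :: p | u <- nb w, p <- walks u n'] else [:: [::]].

Lemma mem_walks w p : walk nb w p -> p \in walks w (size p).
Proof.
elim: p w => // v p IH w /= /andP[/eqP-> pp].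
case: p pp IH => [_ _|u p /= /andP[uv pp] IH].
  apply/allpairsPdep; have : (0 < size (nb w))%N by rewrite size_nb.
  by case E : (nb w) => [|u l]// _; exists u, [::]; rewrite mem_head.
apply/allpairsPdep; exists u, (u :: p); split=> //.
by apply: IH; rewrite /= eqxx.
Qed.

Lemma size_walks w n p : p \in walks w n -> size p = n.
Proof.
elim: n w p => [|n IH] w p /=; first by rewrite inE => /eqP->.
by move=> /allpairsPdep[u [q [_ /IH qn ->]]] /=; rewrite qn.
Qed.

Lemma card_walks w n : size (walks w n) = (deg ^ n)%N.
Proof.
elim: n w => // n IH w /=; rewrite size_allpairs_dep sumnE big_map.
under eq_bigr do rewrite IH.
by rewrite big_const_seq count_predT iter_addn_0 size_nb mulnC expnS.
Qed.

(** The possible bins along a chain read backwards: ring times decrease strictly, but successive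
    rings may share a bin, so the indices only decrease weakly. *)
Fixpoint descents n j : seq (seq nat) :=
  if n is n'.+1 then [seq i :: p | i <- iota 0 j.+1, p <- descents n' i] else [:: [::]].

Let descentsS n j : descents n.+1 j = [seq i :: p | i <- iota 0 j.+1, p <- descents n i].
Proof. by []. Qed.

Lemma mem_descents j p : path geq j p -> p \in descents (size p) j.
Proof.
elim: p j => // i p IH j /andP[ij pp]; rewrite [size _]/= descentsS; apply/allpairsPdep; exists i, p; split=> //.
  by rewrite mem_iota.
exact: IH.
Qed.

Lemma size_descents n j p : p \in descents n j -> size p = n.
Proof.
elim: n j p => [|n IH] j p; first by rewrite inE => /eqP->.
by rewrite descentsS => /allpairsPdep[i [q [_ /IH qn ->]]] /=; rewrite qn.
Qed.

(** The exact number is the binomial coefficient of n + j over n. For fixed [j] only a growth rate 2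
    per step matters. *)
Lemma card_descents n j : (size (descents n j) <= 2 ^ (n + j))%N.
Proof.
elim: n j => [|n IH] j; first by rewrite /= expn_gt0.
rewrite descentsS size_allpairs_dep sumnE big_map.
apply: (@leq_trans (\sum_(i <- iota 0 j.+1) 2 ^ (n + i))%N); first exact: leq_sum.
elim: j => [|j IHj]; first by rewrite big_seq1 !addn0 leq_exp2l.
rewrite -[j.+2]addn1 iotaD big_cat big_seq1 add0n /= [X in (_ <= 2 ^ X)%N]addnS.
by rewrite expnS mul2n -addnn leq_add// leq_exp2l// addSnnS.
Qed.

Context (R : realType) d (Omega : measurableType d) (P : probability Omega R).
Variable X : Omega -> source G -> R.
Hypothesis gX : glauber_data P X.
Local Notation D := (dspace (source G) R).

Lemma mpred_sorted_ring (l : seq (G * nat)) :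
  mpred (fun x : D => sorted (fun a b => ring x b < ring x a) l).
Proof.
elim: l => [|a [|b l] IH]; [exact: (@mpred_cst _ D true)|exact: (@mpred_cst _ D true)|].
apply: (@mpred_eq _ D (fun x => ring x b < ring x a /\
    sorted (fun a b => ring x b < ring x a) (b :: l))).
  by move=> x /=; split=> [[-> ->]|/andP[]].
by apply: mpredI => //; exact: mpred_ring_lt.
Qed.

Lemma measurable_chain U n w t : measurable ([set x | chain nb x U n w t] : set D).
Proof.
apply: (@mpred_exists _ D _ (fun l x => _)) => l.
apply: (@mpred_eq _ D (fun x => (size l = n /\ walk nb w (map fst l) /\ uniq (map fst l)) /\
    (sorted (fun a b => ring x b < ring x a) l /\
     forall a, a \in l -> a.1 \in U /\ ring x a <= t))).
  move=> x; split=> [[[? [? ?]] [? H]]|[? ? ? ? /allP H]].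
    by split=> //; apply/allP => a /H [-> ->].
  by split=> //; split=> // a /H /andP[].
apply: mpredI; first exact: mpred_cst.
apply: mpredI; first exact: mpred_sorted_ring.
apply: mpred_in => a _; apply: mpredI; first exact: mpred_cst.
exact: mpred_ring_le.
Qed.

Lemma chain_depends (W : set G) U n w t : (forall v, v \in U -> W v) ->
  depends_on [set j | W j.1] ([set x : source G -> R | chain nb x U n w t]).
Proof.
move=> UW x y xy [l [ln wl ul sl /allP al]]; have rE a : a \in l -> ring x a = ring y a.
  by move=> /al /andP[/UW Wa _]; apply: ring_ext => k; exact: xy.
exists l; split=> //.
  apply: (sub_in_sorted (P := mem l)) sl; last by apply/allP.
  by move=> a b al' bl'; rewrite /= !rE.
by apply/allP => a al'; rewrite -rE//; exact: al.
Qed.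

(** Union bound over the walk and the bins of its rings. Along a walk with distinct sites the events
    of ringing in the prescribed bins are independent, and the bins can be taken so fine that each
    is much less likely than 1 / deg. The bound does not involve [U]. *)
Lemma pr_chain_small w t e : 0 < e -> exists N, forall n U, (N <= n)%N ->
  pr P [set o | chain nb (X o) U n w t] <= e.
Proof.
(* A step of the chain costs a factor [deg] for the site and 2 for the bin; with this [eps] the
   product is 1 / 2. *)
move=> e0; pose eps : R := (4 * deg%:R)^-1.
have deg0 : 0 < deg%:R :> R by rewrite ltr0n.
have eps0 : 0 < eps by rewrite invr_gt0 mulr_gt0.
have eps1 : eps <= 1 by rewrite invf_le1 ?mulr_gt0// -natrM ler1n muln_gt0.
(* A bin that contains a ring before [t] ends before [t + delta], which is at most [t + 1]. *)
have [delta /andP[d0 de] Hd] := pr_ring_in_bin_small gX (t + 1) eps0.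
have [M HM] : exists M : nat, t <= M%:R * delta.
  exists (Num.bound (`|t| / delta)); rewrite -ler_pdivrMr//.
  apply: ltW; apply: le_lt_trans (archi_boundP _); last by rewrite divr_ge0// ltW.
  by rewrite ler_pM2r ?invr_gt0// ler_norm.
have [N HN] : exists N, (2^-1 : R) ^+ N * 2 ^+ M <= e.
  have := @cvg_geometric R (2 ^+ M) 2^-1; rewrite ger0_norm// => /(_ _).
  have h1 : (2^-1 : R) < 1 by rewrite invf_lt1// ltr1n.
  move=> /(_ h1) /cvgrPdist_lt /(_ e e0)[N _ /(_ N (leqnn _))] /=.
  rewrite sub0r normrN ger0_norm; last by rewrite mulr_ge0// exprn_ge0.
  by move=> /ltW H; exists N; rewrite mulrC.
exists N => n U Nn.
pose L := [seq pJ <- [seq (p, J) | p <- walks w n, J <- descents n M] |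
  uniq pJ.1 && all (fun j => j.+1%:R * delta <= t + 1) pJ.2].
pose E (pJ : seq G * seq nat) : set (source G -> R) :=
  [set x | forall i, i \in iota 0 n -> ring_in_bin delta (nth w pJ.1 i) (nth 0%N pJ.2 i) x].
have mE pJ : measurable (E pJ : set D).
  by apply: (@mpred_in _ D) => i _; exact: measurable_ring_in_bin.
pose N0 := [set o | exists v i, wait (X o) v i <= 0].
have mN0 : measurable N0.
  apply: mpred_exists => v; apply: mpred_exists => i.
  exact: (measurable_wait gX v i (measurable_itv `]-oo, 0])).
have pN0 : pr P N0 = 0.
  have nN0 : P.-negligible N0.
    apply: negligible_exists => v; apply: negligible_exists => i.
    apply: pr0_negligible; last exact: (pr_wait_le0 gX).
    exact: (measurable_wait gX v i (measurable_itv `]-oo, 0])).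
  by rewrite /pr (measure_negligible mN0 nN0).
have mC := glauber_measurable gX (measurable_chain U n w t).
have mU : measurable [set o | exists2 pJ, pJ \in L & E pJ (X o)].
  by apply: measurable_exists_in => pJ _; exact: (glauber_measurable gX).
apply: (@le_trans _ _ (pr P (N0 `|` [set o | exists2 pJ, pJ \in L & E pJ (X o)]))).
  apply: pr_le => //; first exact: measurableU.
  move=> o [l [ln wl ul sl /allP al]].
  have [n0|pos] := pselect (N0 o); [by left|right].
  have {}pos v i : 0 < wait (X o) v i.
    by rewrite ltNge; apply/negP => ?; apply: pos; exists v, i.
  have r0 a : 0 < ring (X o) a.
    rewrite /ring /ring_time /= big_ord_recr /=; apply: ltr_wpDl => //.
    by apply: sumr_ge0 => i _; exact: ltW.
  have [jf Hj] := choice (fun a => bin_exists d0 (r0 a)).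
  exists (map fst l, map jf l); last first.
    move=> i; rewrite mem_iota add0n /= => iN; split=> //.
    have a0 : (G * nat)%type by case: (l) ln iN => [<-//|a _ _ _]; exact: a.
    rewrite (nth_map a0) ?ln// (nth_map a0) ?ln//.
    by exists (nth a0 l i).2; rewrite -surjective_pairing.
  rewrite mem_filter /= ul /=; apply/andP; split.
    apply/allP => j /mapP[a /al /andP[_ at_] ->]; have /andP[ja _] := Hj a.
    rewrite -natr1 mulrDl mul1r lerD//; first exact: ltW (lt_le_trans ja at_).
    exact: le_trans de eps1.
  apply/allpairsPdep; exists (map fst l), (map jf l); split=> //.
    by rewrite -ln -(size_map fst l); apply: mem_walks.
  rewrite -ln -(size_map jf l); apply: mem_descents.
  have mono a b : ring (X o) b < ring (X o) a -> (jf b <= jf a)%N.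
    move=> ba; rewrite leqNgt; apply/negP => jab.
    have /andP[_ ha] := Hj a; have /andP[hb _] := Hj b.
    have := lt_le_trans (lt_trans hb ba) ha; rewrite ltr_pM2r// ltr_nat ltnS.
    by rewrite leqNgt jab.
  have jM a : a \in l -> (jf a <= M)%N.
    move=> /al /andP[_ at_]; have /andP[ja _] := Hj a.
    have := lt_le_trans ja (le_trans at_ HM); rewrite ltr_pM2r// ltr_nat.
    exact: ltnW.
  case: (l) sl jM => //= a r sl jM; rewrite jM ?mem_head//=.
  by rewrite path_map; apply: sub_path sl => b c; exact: mono.
apply: le_trans (prU_le P mN0 mU) _; rewrite pN0 add0r.
apply: le_trans (pr_exists_le P _) _.
  by move=> pJ _; exact: (glauber_measurable gX).
have pE pJ : pJ \in L -> pr P (X @^-1` (E pJ)) <= eps ^+ n.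
  rewrite mem_filter => /andP[/andP[up /allP aJ] /allpairsPdep[p [J [pw Jd pJE]]]].
  have sp : size pJ.1 = n by rewrite pJE; exact: size_walks pw.
  have sJ : size pJ.2 = n by rewrite pJE; exact: size_descents Jd.
  have [mX iX _] := gX.
  have := @independent_depends_seq _ _ _ _ P X _ (iota 0 n)
    (fun i => [set j | j.1 = nth w pJ.1 i])
    (fun i => ring_in_bin delta (nth w pJ.1 i) (nth 0%N pJ.2 i)) mX iX (iota_uniq _ _).
  rewrite -[X in pr P X = _]/(X @^-1` (E pJ)) => ->.
  - rewrite -[X in _ <= _ ^+ X](size_iota 0 n) big_seq.
    have : forall i, i \in iota 0 n -> pr P (X @^-1` ring_in_bin delta (nth w pJ.1 i) (nth 0%N pJ.2 i)) <= eps.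
      move=> i; rewrite mem_iota add0n /= => iN; apply: Hd; apply: aJ.
      by rewrite mem_nth// sJ.
    rewrite -big_seq; elim: (iota 0 n) => [|i s IH] Hs; rewrite ?big_nil// big_cons exprS.
    rewrite ler_pM ?pr_ge0//.
    + by apply: prodr_ge0 => k _; exact: pr_ge0.
    + by apply: Hs; rewrite mem_head.
    + by apply: IH => k ks; apply: Hs; rewrite inE ks orbT.
  - move=> i k; rewrite !mem_iota !add0n /= => iN kN ik; apply/seteqP; split=> // j [/= ji jk].
    by move/eqP : ji; rewrite jk nth_uniq ?sp// eq_sym (negbTE ik).
  - by move=> i _; exact: measurable_ring_in_bin.
  - by move=> i _; exact: ring_in_bin_depends.
apply: (@le_trans _ _ (\sum_(pJ <- L) eps ^+ n)); first by rewrite big_seq [leRHS]big_seq; exact: ler_sum.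
rewrite big_const_seq count_predT iter_addr_0 -(mulr_natr _ (size L)).
have sL : (size L <= deg ^ n * 2 ^ (n + M))%N.
  apply: leq_trans (size_subseq (filter_subseq _ _)) _.
  by rewrite size_allpairs card_walks leq_mul2l card_descents orbT.
apply: le_trans HN; apply: (@le_trans _ _ (2^-1 ^+ n * 2 ^+ M)); last first.
  by rewrite ler_pM2r ?exprn_gt0// ler_wiXn2l// ?invr_ge0// invf_le1// ler1n.
apply: (@le_trans _ _ (eps ^+ n * (deg ^ n * 2 ^ (n + M))%N%:R)).
  by rewrite ler_pM2l ?exprn_gt0// ler_nat.
rewrite natrM !natrX exprD !mulrA ler_pM2r ?exprn_gt0// -!exprMn.
rewrite (_ : eps * deg%:R * 2 = 2^-1)// /eps invfM.
by rewrite divfK ?lt0r_neq0//; lra.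
Qed.

End chain_estimate.

(** * Events that hold a spin up *)

Section held_up_events.
Context (G : countType) (nb : G -> seq G) (R : realType).
Local Notation D := (dspace (source G) R).
Implicit Types (x : source G -> R) (U V Z : seq G) (v w y : G).

Lemma mpred_map (I : Type) (l : seq I) (f : D -> I -> bool) (Q : seq bool -> Prop) :
  (forall i, mpred (fun x : D => f x i)) -> mpred (fun x : D => Q (map (f x) l)).
Proof.
move=> mf; elim: l Q => [|i l IH] Q; first exact: (@mpred_cst _ D (Q [::])).
apply: (@mpred_eq _ D (fun x => (f x i /\ Q (true :: map (f x) l)) \/
    (~ f x i /\ Q (false :: map (f x) l)))).
  move=> x /=; case: (f x i); split=> [[[]|[]]|]//; first by left.
  by right.
apply: mpredU; apply: mpredI => //; try exact: mpredN.
  exact: (IH (fun bs => Q (true :: bs))).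
exact: (IH (fun bs => Q (false :: bs))).
Qed.

Lemma mpred_update m (c : D -> bool) (s : D -> G -> bool) v :
  mpred (fun x : D => c x) -> (forall y, mpred (fun x : D => s x y)) ->
  mpred (fun x : D => update nb m (c x) (s x) v).
Proof.
move=> mc ms.
pose Q bs := if bs is b :: b' :: bs' then
  let p := count id bs' in
  if (p.*2 < size (nb v))%N then false
  else if (size (nb v) < p.*2)%N then true
  else if m then b else b (+) b' else false.
pose f (x : D) (i : option G) := if i is Some y then s x y else c x.
have mf i : mpred (fun x : D => f x i) by case: i.
apply: (mpred_eq _ (@mpred_map _ [:: None, Some v & map Some (nb v)] f (fun bs => Q bs) mf)).
by move=> x /=; rewrite -map_comp count_map /update.
Qed.

Lemma mpred_steady m U w k (l : seq (G * nat)) (s : D -> G -> bool) :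
  (forall y, mpred (fun x : D => s x y)) ->
  mpred (fun x : D => steady nb m U w (s x) k (coins x l)).
Proof.
elim: l s k => [|a l IH] s k ms.
  apply: (@mpred_eq _ D (fun x => (0 < k)%N \/ s x w)).
    by move=> x; rewrite /= andbT; split=> /orP.
  by apply: mpredU => //; exact: mpred_cst.
apply: (@mpred_eq _ D (fun x => ((0 < k)%N \/ s x w) /\
    steady nb m U w (step nb m U (s x) (a.1, flip x a.1 a.2)) k.-1 (coins x l))).
  by move=> x /=; split=> [[/orP -> ->]|/andP[/orP]].
apply: mpredI; first by apply: mpredU => //; exact: mpred_cst.
apply: (IH (fun x => step nb m U (s x) (a.1, flip x a.1 a.2))) => y.
rewrite /step /=; case: ((y == a.1) && _) => //; apply: mpred_update => //.
exact: mpred_flip.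
Qed.

Lemma mpred_steady_zip m U w k (vs : seq G) c (s : D -> G -> bool) :
  (forall y, mpred (fun x : D => s x y)) ->
  mpred (fun x : D => steady nb m U w (s x) k (zip vs c)).
Proof.
elim: vs c s k => [|v vs IH] [|b c] s k ms; try by
  apply: (@mpred_eq _ D (fun x => (0 < k)%N \/ s x w));
  [move=> x; rewrite /= andbT; split=> /orP|apply: mpredU => //; exact: mpred_cst].
apply: (@mpred_eq _ D (fun x => ((0 < k)%N \/ s x w) /\
    steady nb m U w (step nb m U (s x) (v, b)) k.-1 (zip vs c))).
  by move=> x /=; split=> [[/orP -> ->]|/andP[/orP]].
apply: mpredI; first by apply: mpredU => //; exact: mpred_cst.
apply: (IH _ (fun x => step nb m U (s x) (v, b))) => y.
rewrite /step /=; case: ((y == v) && _) => //; apply: mpred_update => //.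
exact: mpred_cst.
Qed.

Lemma mpred_start Z y : mpred (fun x : D => start Z (ini x) y).
Proof.
apply: (@mpred_eq _ D (fun x => y \in Z \/ ini x y)); first by move=> x; split=> /orP.
by apply: mpredU; [exact: mpred_cst|exact: mpred_ini].
Qed.

Lemma mpred_ringlist U t l : mpred (fun x : D => ringlist x U t l).
Proof.
apply: mpredI.
  elim: l => [|a l IH]; first exact: (@mpred_cst _ D true).
  apply: (@mpred_eq _ D (fun x => (forall b, b \in l -> ring x a < ring x b) /\
      pairwise (fun a b => ring x a < ring x b) l)).
    move=> x; split=> [[H p]|/andP[/allP]//]; apply/andP; split=> //; exact/allP.
  by apply: mpredI => //; apply: mpred_in => b _; exact: mpred_ring_lt.
apply: mpred_forall => a; apply: (@mpred_eq _ D (fun x => a \in l <-> (a.1 \in U /\ ring x a <= t))).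
  move=> x; split=> [H|->]; last by split=> /andP.
  by apply/idP/andP => /H.
apply: mpred_iff; first exact: mpred_cst.
by apply: mpredI; [exact: mpred_cst|exact: mpred_ring_le].
Qed.

Lemma measurable_held_up U Z w T T' :
  measurable ([set x | held_up nb x U Z w T T'] : set D).
Proof.
apply: (@mpred_exists _ D _ (fun l1 x => exists l2, _)) => l1.
apply: (@mpred_exists _ D _ (fun l2 x => _)) => l2.
apply: (@mpred_eq _ D (fun x => ringlist x U T l1 /\ (ringlist x U T' (l1 ++ l2) /\
  steady nb false U w (start Z (ini x)) (size l1) (coins x (l1 ++ l2))))).
  by move=> x; split=> [[? []]|[]].
apply: mpredI; first exact: mpred_ringlist.
apply: mpredI; first exact: mpred_ringlist.
by apply: mpred_steady => y; exact: mpred_start.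
Qed.

Lemma steady_ext (W : set G) m U w s s' k l :
  (forall v, v \in U -> W v /\ forall y, y \in nb v -> W y) -> W w ->
  (forall v, W v -> s v = s' v) -> steady nb m U w s k l = steady nb m U w s' k l.
Proof.
move=> UW Ww; elim: l s s' k => [|a l IH] s s' k ss' /=; rewrite ss'//.
congr (_ && _); apply: IH => v Wv; rewrite /step; case: ifP => [/andP[_ aU]|_]; last exact: ss'.
have [Wa Wn] := UW _ aU; apply: update_ext => [y /Wn|]; exact: ss'.
Qed.

Lemma ringlist_ext x x' U t l : (forall v k, v \in U -> wait x v k = wait x' v k) ->
  ringlist x U t l -> ringlist x' U t l.
Proof.
move=> xy [pl ml].
have rE a : a.1 \in U -> ring x a = ring x' a by move=> aU; apply: ring_ext => k; exact: xy.
have lU a : a \in l -> a.1 \in U by rewrite ml => /andP[].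
split; last first.
  by move=> a; rewrite ml; case: (boolP (a.1 \in U)) => //= aU; rewrite rE.
apply: (sub_in_pairwise (P := mem l)) pl; last by apply/allP.
by move=> a b al bl /=; rewrite !rE ?lU.
Qed.

Lemma held_up_depends (W : set G) U Z w T T' :
  (forall v, v \in U -> W v /\ forall y, y \in nb v -> W y \/ y \in Z) -> W w ->
  depends_on [set j | W j.1] [set x : source G -> R | held_up nb x U Z w T T'].
Proof.
move=> UW Ww x x' xy [l1 [l2 [r1 r2 st]]]; exists l1, l2.
have wE v k : v \in U -> wait x v k = wait x' v k by move=> /UW[Wv _]; exact: xy.
split; [exact: ringlist_ext r1|exact: ringlist_ext r2|].
have -> : coins x' (l1 ++ l2) = coins x (l1 ++ l2).
  apply/eq_in_map => a; rewrite r2.2 => /andP[/UW[Wa _] _].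
  by rewrite /flip xy.
rewrite (@steady_ext (fun v => W v \/ v \in Z) _ _ _ _ (start Z (ini x)))//; last 2 first.
- by left.
- move=> v; rewrite /start; case: (boolP (v \in Z)) => //= vZ [Wv|//].
  by rewrite /ini xy.
- by move=> v /UW[Wv Wn]; split; [left|exact: Wn].
Qed.

Lemma held_up_le x U Z w T T' T'' : T <= T' -> T' <= T'' ->
  held_up nb x U Z w T T'' -> held_up nb x U Z w T T'.
Proof.
move=> TT' TT'' [l1 [l2 [r1 r2 st]]].
have [i il ri] := ringlist_prefix TT' TT'' r1 r2.
exists l1, (take i l2); split=> //.
have := st => /steadyP; rewrite size_map size_cat leq_addr => /(_ isT) H.
apply/steadyP; first by rewrite size_map size_cat leq_addr.
move=> j; rewrite size_map size_cat size_takel// => /andP[j1 ji].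
have := H j; rewrite j1 (leq_trans ji) ?leq_add2l// => /(_ isT).
rewrite /coins -!map_take !take_cat; case: ltnP => // _.
by rewrite take_takel// leq_subLR.
Qed.

Lemma taint_filter U Z (l : seq G) : taint nb U Z l = taint nb U Z [seq v <- l | v \in U].
Proof.
rewrite /taint; elim: l (taint0 U Z) => //= v l IH S; case: ifP => vU //=; rewrite IH//.
by congr foldl; apply/funext => y; rewrite /tstep vU andbF orbF.
Qed.

Lemma run_filter m U s (l : seq (G * bool)) :
  run nb m U s l = run nb m U s [seq a <- l | a.1 \in U].
Proof.
rewrite /run; elim: l s => //= a l IH s; case: ifP => aU //=; rewrite IH//.
by congr foldl; apply/funext => y; rewrite /step aU andbF.
Qed.

Lemma take_filter (I : Type) (p : pred I) (l : seq I) i : (i <= count p l)%N ->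
  exists2 j, (j <= size l)%N & take i [seq a <- l | p a] = [seq a <- take j l | p a].
Proof.
elim: l i => [|a l IH] i /=; first by exists 0%N.
case: i => [_|i]; first by exists 0%N; rewrite ?take0.
case: ifP => pa; rewrite ?add1n ?add0n => il; have [j jl E] := IH _ il.
  by exists j.+1 => //=; rewrite pa E.
by exists j.+1 => //=; rewrite pa.
Qed.

Lemma ringlist_filter x U V t l : {subset V <= U} -> ringlist x U t l ->
  ringlist x V t [seq a <- l | a.1 \in V].
Proof.
move=> VU [pl ml]; split; first exact: pairwise_filter.
move=> a; rewrite mem_filter ml andbA; congr andb.
by apply: andb_idr; exact: VU.
Qed.

(** Rings outside of [U] leave the run on [U] unchanged. This lets two regions be compared along one
    common list of rings, although [held_up] lists the rings of its own region only. *)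
Lemma steady_filter m U w s (k : nat) l : (k <= size l)%N -> steady nb m U w s k l ->
  steady nb m U w s (count (fun a => a.1 \in U) (take k l)) [seq a <- l | a.1 \in U].
Proof.
move=> kl /steadyP -/(_ kl) H.
have cl j : (count (fun a => a.1 \in U) (take j l) <= count (fun a => a.1 \in U) l)%N.
  by rewrite -{2}(cat_take_drop j l) count_cat leq_addr.
apply/steadyP; first by rewrite size_filter.
move=> i /andP[ki]; rewrite size_filter => il.
have [j jl E] := take_filter il; rewrite E -run_filter.
have [kj|jk] := leqP k j; first by apply: H; rewrite kj.
(* Here [j < k], but the first [j] and the first [k] entries contain the same rings of [U]. *)
suff <- : run nb m U s (take k l) = run nb m U s (take j l) by apply: H; rewrite leqnn.
rewrite run_filter [RHS]run_filter -E; congr run.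
have kE : [seq a <- take k l | a.1 \in U] =
    take (count (fun a => a.1 \in U) (take k l)) [seq a <- l | a.1 \in U].
  by rewrite -{3}(cat_take_drop k l) filter_cat take_size_cat// size_filter.
rewrite kE; congr take; apply/eqP; rewrite eqn_leq ki /=.
have := congr1 size E; rewrite size_takel ?size_filter// => ->.
by rewrite -[in leqRHS](cat_take_drop j (take k l)) count_cat take_takel ?leq_addr// ltnW.
Qed.

End held_up_events.

(** * Holding boundary sites up makes a spin more likely to stay up *)

Section held_up_comparison.
Context (G : countType) (nb : G -> seq G) (R : realType).
Context d (Omega : measurableType d) (P : probability Omega R).
Variable X : Omega -> source G -> R.
Hypothesis gX : glauber_data P X.
Variables (U V Z : seq G) (w : G) (T T' : R) (n : nat).
Hypotheses (VU : {subset V <= U}) (ZV : forall z, z \in Z -> z \notin V).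
Hypothesis encl : encloses nb V Z w n.
Local Notation D := (dspace (source G) R).

Let pieces (l : seq (G * nat) * seq (G * nat)) : set (source G -> R) :=
  [set x | ringlist x U T l.1 /\ ringlist x U T' (l.1 ++ l.2)].

Let nchain : set (source G -> R) := [set x | ~ chain nb x V n w T'].

Let steadyE m U' Z' k vs c : set (source G -> R) :=
  [set x | steady nb m U' w (start Z' (ini x)) k (zip vs c)].

Let flipE (L : seq (G * nat)) c : set (source G -> R) :=
  [set x | [seq flip x a.1 a.2 | a <- L] = c].

Let mpieces l : measurable (pieces l : set D).
Proof. exact: (measurableI _ _ (mpred_ringlist _ _ _) (mpred_ringlist _ _ _)). Qed.

Let mnchain : measurable (nchain : set D).
Proof. exact: (measurableC (measurable_chain nb V n w T')). Qed.

Let msteady m U' Z' k vs c : measurable (steadyE m U' Z' k vs c : set D).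
Proof.
apply: (@mpred_steady_zip _ nb _ m U' w k vs c (fun x => start Z' (ini x))) => y.
exact: mpred_start.
Qed.

Let mflip L c : measurable (flipE L c : set D).
Proof.
apply: (@mpred_map _ _ _ L (fun x a => flip x a.1 a.2) (fun bs => bs = c)) => a.
exact: mpred_flip.
Qed.

Let pr_flips (L : seq (G * nat)) c : uniq L -> size c = size L ->
  pr P (X @^-1` flipE L c) = 2^-1 ^+ size L.
Proof.
case: L c => [|a0 L'] c; first by case: c => // _ _;
  rewrite (_ : X @^-1` _ = setT) ?prT//; apply/seteqP; split.
set L := a0 :: L' => uL cL; have [mX iX _] := gX.
have := @independent_depends_seq _ _ _ _ P X _ (iota 0 (size L))
  (fun i => [set ((nth a0 L i).1, Some (false, (nth a0 L i).2))])
  (fun i => [set x | flip x (nth a0 L i).1 (nth a0 L i).2 = nth false c i]) mX iX (iota_uniq _ _).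
rewrite [X in pr P X](_ : _ = X @^-1` flipE L c); last first.
  apply/seteqP; split=> o H.
    suff : [seq flip (X o) a.1 a.2 | a <- L] = c by [].
    apply: (@eq_from_nth _ false); rewrite size_map// => i iL.
    by rewrite (nth_map a0)//; apply: H; rewrite mem_iota.
  have Hc : [seq flip (X o) a.1 a.2 | a <- L] = c := H.
  move=> i; rewrite mem_iota add0n => /andP[_ iL].
  by rewrite -Hc (nth_map a0).
move=> ->.
- rewrite -[X in _ ^+ X](size_iota 0).
  elim: (iota 0 _) => [|i s IH]; rewrite ?big_nil// big_cons exprS IH; congr (_ * _).
  exact: (pr_flip gX).
- move=> i j; rewrite !mem_iota !add0n /= => iL jL ij; apply/seteqP; split=> // k [-> [e1 e2]].
  have /eqP : nth a0 L i = nth a0 L j by rewrite [LHS]surjective_pairing e1 e2 -surjective_pairing.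
  by rewrite nth_uniq// (negbTE ij).
- move=> i _; set a := nth a0 L i; set b := nth false c i.
  apply: (@mpred_map _ _ _ [:: a] (fun x a => flip x a.1 a.2) (fun bs => head false bs = b)).
  by move=> a'; exact: mpred_flip.
- by move=> i _ x y xy; rewrite /= /flip xy.
Qed.

Let not_flip : set (source G) :=
  [set j | if j.2 is Some (false, _) then False else True].
Let is_flip : set (source G) :=
  [set j | if j.2 is Some (false, _) then True else False].

Let pieces_depends l m U' Z' k vs c :
  depends_on not_flip (pieces l `&` nchain `&` steadyE m U' Z' k vs c).
Proof.
move=> x y xy [[[r1 r2] nc] st].
have wE v i : wait x v i = wait y v i by exact: xy.
have rE a : ring x a = ring y a by apply: ring_ext => k'; exact: xy.
split.
  split; first by split; [apply: ringlist_ext r1 => v i _|apply: ringlist_ext r2 => v i _].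
  move=> [l' [ln wl ul sl /allP al]]; apply: nc; exists l'; split=> //.
    by apply: sub_sorted sl => a b; rewrite !rE.
  by apply/allP => a /al; rewrite rE.
rewrite /steadyE /= (_ : ini y = ini x)//; apply/funext => v.
by rewrite /ini xy.
Qed.

Let flip_depends L c : depends_on is_flip (flipE L c).
Proof.
move=> x y xy /= <-; apply: eq_map => a; by rewrite /flip xy.
Qed.

(** On this piece the clocks fix the list [L], and the coins of its entries are independent of spins
    and clocks. Each word of coins thus has weight [2^-1 ^+ size L] and can be replaced by a
    constant [c] inside the event. *)
Let pr_piece l U' Z' : let L := l.1 ++ l.2 in let vs := map fst L in
  uniq L ->
  pr P (X @^-1` (pieces l `&` nchain `&`
      [set x | steady nb false U' w (start Z' (ini x)) (size l.1) (coins x L)])) =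
  \sum_(c <- bits (size vs))
    pr P (X @^-1` (pieces l `&` nchain `&` steadyE false U' Z' (size l.1) vs c)) * 2^-1 ^+ size L.
Proof.
move=> L vs uL; have [mX iX _] := gX.
have coinsE (x : source G -> R) : coins x L = zip vs [seq flip x a.1 a.2 | a <- L].
  by rewrite /vs; elim: (L) => //= a L' <-.
have mS : measurable ([set x | steady nb false U' w (start Z' (ini x)) (size l.1) (coins x L)] : set D).
  by apply: (@mpred_steady _ nb _ false U' w _ L (fun x => start Z' (ini x))) => y; exact: mpred_start.
rewrite (@pr_partition _ _ _ P _ (bits (size vs)) _ (fun c => X @^-1` flipE L c)).
- rewrite !big_seq; apply: eq_bigr => c; rewrite mem_bits => /eqP cs.
  have cL : size c = size L by rewrite cs /vs size_map.
  rewrite -(pr_flips uL cL) -(@independent_depends _ _ _ _ P X not_flip is_flip)//.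
  + congr pr; apply/seteqP; split=> o [[pc st] fl]; split=> //; split=> //.
      by move: st; rewrite /= coinsE fl.
    by rewrite /= coinsE fl.
  + by apply/seteqP; split=> // -[v [[[] k]|]] [].
  + apply: measurableI; [exact: (measurableI _ _ (mpieces l) mnchain)|exact: msteady].
- exact: uniq_bits.
- apply: (glauber_measurable gX); apply: measurableI => //.
  exact: (measurableI _ _ (mpieces l) mnchain).
- by move=> c _; exact: (glauber_measurable gX).
- by move=> c c' o _ _ <- <-.
- by move=> o _; exists [seq flip (X o) a.1 a.2 | a <- L]; rewrite ?mem_bits ?size_map.
Qed.

(* Given the clocks, [count_steady] turns both sides into probabilities for the
   monotone convention, where [run_mono] applies. *)
Lemma pr_held_up_le :
  pr P [set o | ~ chain nb (X o) V n w T' /\ held_up nb (X o) U [::] w T T'] <=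
  pr P [set o | ~ chain nb (X o) V n w T' /\ held_up nb (X o) V Z w T T'].
Proof.
have mE U' Z' : measurable ([set x | ~ chain nb x V n w T' /\ held_up nb x U' Z' w T T'] : set D).
  exact: (measurableI _ _ mnchain (measurable_held_up nb U' Z' w T T')).
apply: (@pr_le_pieces _ _ _ P _ (fun l => X @^-1` pieces l)).
- by move=> l; exact: (glauber_measurable gX).
- move=> [l1 l2] [l1' l2'] [om [[r1 r2] [r1' r2']]].
  have /= e1 := ringlist_uniq r1 r1'; have /= := ringlist_uniq r2 r2'.
  by rewrite e1 => /eqP; rewrite eqseq_cat// eqxx /= => /eqP ->.
- exact: (glauber_measurable gX (mE _ _)).
- exact: (glauber_measurable gX (mE _ _)).
- by move=> o [_ [l1 [l2 [r1 r2 _]]]]; exists (l1, l2).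
move=> l; set L := l.1 ++ l.2.
pose S U' Z' : set (source G -> R) :=
  [set x | steady nb false U' w (start Z' (ini x)) (size l.1) (coins x L)].
have mS U' Z' : measurable (S U' Z' : set D).
  by apply: (@mpred_steady _ nb _ false U' w _ L (fun x => start Z' (ini x))) => y; exact: mpred_start.
have mPS U' Z' : measurable (X @^-1` (pieces l `&` nchain `&` S U' Z')).
  apply: (glauber_measurable gX); apply: measurableI => //.
  exact: (measurableI _ _ (mpieces l) mnchain).
apply: (@le_trans _ _ (pr P (X @^-1` (pieces l `&` nchain `&` S U [::])))).
  apply: pr_le => //.
    apply: measurableI; first exact: (glauber_measurable gX (mE _ _)).
    exact: (glauber_measurable gX).
  move=> o [[nc [l1 [l2 [r1 r2 st]]]] [r1' r2']]; split=> //.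
  have e1 := ringlist_uniq r1 r1'; have := ringlist_uniq r2 r2'.
  by rewrite /S /= /L => <-; rewrite -e1.
apply: (@le_trans _ _ (pr P (X @^-1` (pieces l `&` nchain `&` S V Z)))); last first.
  apply: pr_le => //.
    apply: measurableI; first exact: (glauber_measurable gX (mE _ _)).
    exact: (glauber_measurable gX).
  move=> o [[[r1 r2] nc] st]; split=> //; split=> //.
  exists [seq a <- l.1 | a.1 \in V], [seq a <- l.2 | a.1 \in V]; split.
  - exact: ringlist_filter r1.
  - by rewrite -filter_cat; exact: ringlist_filter r2.
  - have lL : (size l.1 <= size (coins (X o) L))%N by rewrite size_map size_cat leq_addr.
    have := steady_filter lL st.
    rewrite /coins -map_take take_size_cat// count_map size_filter -filter_cat filter_map.
    by [].
have [uL|nuL] := boolP (uniq L); last first.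
  rewrite (_ : X @^-1` _ = set0) ?pr0 ?pr_ge0//; apply/seteqP; split=> // o [[[_ [pl _]] _] _].
  by move/negP: nuL; apply; move: pl; rewrite uniq_pairwise; apply: sub_pairwise => a b /=;
    apply: contraTneq => ->; rewrite ltxx.
(* A taint at [w] along [L] yields a chain, which [nchain] excludes, so the smaller side is
   empty. *)
have [tw|tw] := boolP (taint nb V Z (map fst L) w).
  rewrite (_ : X @^-1` _ = set0) ?pr0 ?pr_ge0//; apply/seteqP; split=> // o [[[_ r2] nc] _].
  apply: nc; apply: (taint_chain (ringlist_filter VU r2) encl).
  move: tw; rewrite taint_filter; congr taint.
  by rewrite filter_map.
rewrite !pr_piece// -!mulr_suml ler_pM2r ?exprn_gt0 ?invr_gt0//.
apply: sum_pr_count.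
- move=> c; apply: (glauber_measurable gX); apply: measurableI => //.
  exact: (measurableI _ _ (mpieces l) mnchain).
- move=> c; apply: (glauber_measurable gX); apply: measurableI => //.
  exact: (measurableI _ _ (mpieces l) mnchain).
(* Spins and clocks are now those of [o]; only the words of coins vary, and they are counted. *)
move=> o; have [pc|npc] := pselect ((pieces l `&` nchain) (X o)); last first.
  rewrite (@eq_count _ _ pred0) ?count_pred0// => c /=.
  by apply/asboolP => -[].
set vs := map fst L; set s := ini (X o).
have cE U' Z' : count (fun c => `[< (X @^-1` (pieces l `&` nchain `&` steadyE false U' Z' (size l.1) vs c)) o >])
      (bits (size vs)) =
    count (fun c => steady nb true U' w (start Z' s) (size l.1) (zip vs c)) (bits (size vs)).
  rewrite -count_steady; apply: eq_count => c; apply/asboolP/idP => [[]//|st].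
  by split.
rewrite !cE.
rewrite -[leqLHS](@eq_in_count _ (fun c => (size c == size vs) &&
    steady nb true U w (start [::] s) (size l.1) (zip vs c))); last first.
  by move=> c; rewrite mem_bits => ->.
rewrite -[leqRHS](@eq_in_count _ (fun c => (size c == size vs) &&
    steady nb true V w (start Z s) (size l.1) (zip vs c))); last first.
  by move=> c; rewrite mem_bits => ->.
apply: sub_count => c /andP[cs]; rewrite cs /=.
have zs : (size l.1 <= size (zip vs c))%N.
  by rewrite size_zip (eqP cs) minnn size_map size_cat leq_addr.
move=> /steadyP -/(_ zs) H; apply/steadyP => // i il.
have := @run_mono _ nb U V Z s (take i (zip vs c)) w VU ZV.
rewrite -[fun y => (y \in Z) || s y]/(start Z s); apply.
  apply: contra tw; rewrite map_take -/(unzip1 _) unzip1_zip ?(eqP cs)// => tw.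
  by rewrite -/vs -(cat_take_drop i vs); exact: taint_cat.
have := H i il; rewrite (_ : start [::] s = s)//.
Qed.

End held_up_comparison.

(** * Spins that stay up forever *)

Section eventual_events.
Context (G : countType) (nb : G -> seq G) (R : realType).
Local Notation D := (dspace (source G) R).
Implicit Types (x : source G -> R) (v w y z : G).

Fixpoint ball w n : seq G :=
  if n is n'.+1 then w :: flatten [seq ball u n' | u <- nb w] else [::].

Lemma walk_ball w p u n : walk nb w (rcons p u) -> (size p < n)%N -> u \in ball w n.
Proof.
elim: p w n => [|v p IH] w [|n]//=; first by rewrite andbT => /eqP -> _; rewrite mem_head.
move=> /andP[/eqP -> wp] pn; rewrite inE; apply/orP; right.
apply/flattenP; case: p wp IH pn => [|v' p] /= /andP[vw wp] IH pn.
  exists (ball u n); first exact: map_f.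
  by case: n pn => // n _; rewrite mem_head.
exists (ball v' n); first exact: map_f.
by apply: IH => //; rewrite /= eqxx.
Qed.

Lemma ball_encloses w n : encloses nb (ball w n) [::] w n.
Proof. by move=> p u wp _ pn; rewrite /taint0 (walk_ball wp pn). Qed.

(* When [sigma] is driven by [x], both events below say that [w] is up at all
   times [t >= T]; in the second one [z] is held up and only [side] is seen. *)
Definition stays_up w T x := forall m n : nat,
  ~ chain nb x (ball w n) n w (T + m%:R) ->
  held_up nb x (ball w n) [::] w T (T + m%:R).

Definition kept_up (side : pred G) z w T x := forall m : nat, exists n : nat,
  ~ chain nb x [seq v <- ball w n | side v] n w (T + m%:R) /\
  held_up nb x [seq v <- ball w n | side v] [:: z] w T (T + m%:R).

(** A local event implied by [w] being up at [T]: the finite run says so, or a long chain makes it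
    unreliable. *)
Definition maybe_up w T n x :=
  chain nb x (ball w n) n w T \/ held_up nb x (ball w n) [::] w T T.

Lemma measurable_stays_up w T : measurable ([set x | stays_up w T x] : set D).
Proof.
apply: (@mpred_forall _ D _ (fun m x => forall n, _)) => m.
apply: (@mpred_forall _ D _ (fun n x => _)) => n; apply: (@mpred_impl _ D).
  exact: (measurableC (measurable_chain nb _ _ _ _)).
exact: measurable_held_up.
Qed.

Lemma measurable_kept_up side z w T : measurable ([set x | kept_up side z w T x] : set D).
Proof.
apply: (@mpred_forall _ D _ (fun m x => exists n, _)) => m.
apply: (@mpred_exists _ D _ (fun n x => _)) => n; apply: (@mpredI _ D).
  exact: (measurableC (measurable_chain nb _ _ _ _)).
exact: measurable_held_up.
Qed.

Lemma measurable_maybe_up w T n : measurable ([set x | maybe_up w T n x] : set D).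
Proof. exact: (measurableU _ _ (measurable_chain nb _ _ _ _) (measurable_held_up nb _ _ _ _ _)). Qed.

Lemma maybe_up_depends (W : set G) w T n : W w ->
  (forall v, v \in ball w n -> W v /\ forall y, y \in nb v -> W y) ->
  depends_on [set j | W j.1] [set x : source G -> R | maybe_up w T n x].
Proof.
move=> Ww UW x x' xx' [cx|hx]; [left|right].
  by apply: (chain_depends (W := W)) cx => // v /UW[].
by apply: (held_up_depends (W := W)) hx => // v /UW[Wv Wn]; split=> // y /Wn; left.
Qed.

Section trajectories.
Variables (x : source G -> R) (sigma : R -> G -> bool) (w : G) (T : R).
Hypotheses (gx : good_clocks x) (T0 : 0 <= T).

Lemma sigma_held_up_ball n T' : T <= T' -> (forall U, trajectory nb x U sigma) ->
  (forall v, sigma 0 v = ini x v) -> ~ chain nb x (ball w n) n w T' ->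
  (forall t : R, T <= t <= T' -> sigma t w) ->
  held_up nb x (ball w n) [::] w T T'.
Proof.
move=> TT' tx s0 nc H.
by apply: (held_up_sigma gx T0 TT' (tx _) (@ball_encloses w n) nc).
Qed.

Lemma sigma_stays_up : (forall U, trajectory nb x U sigma) ->
  (forall v, sigma 0 v = ini x v) -> (forall t, T <= t -> sigma t w) -> stays_up w T x.
Proof.
move=> tx s0 H m n nc; apply: (sigma_held_up_ball (n := n)) => //.
  by rewrite lerDl.
by move=> t /andP[Tt _]; exact: H.
Qed.

Lemma maybe_up_sigma n : (forall U, trajectory nb x U sigma) ->
  (forall v, sigma 0 v = ini x v) -> ~ chain nb x (ball w n) n w T ->
  maybe_up w T n x -> sigma T w.
Proof.
move=> tx s0 nc [//|hu].
by apply: (@sigma_held_up _ nb _ x (ball w n) [::] w T T n sigma) => //;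
  [exact: ball_encloses|rewrite lexx].
Qed.

End trajectories.

Section side.
Variables (side : pred G) (z w : G).
Hypotheses (side_w : side w) (side_z : ~~ side z).
Hypothesis side_nb : forall v y, side v -> y \in nb v -> side y \/ y = z.

Lemma side_encloses n : encloses nb [seq v <- ball w n | side v] [:: z] w n.
Proof.
move=> p u wp sp pn; rewrite /taint0 mem_filter (walk_ball wp pn) andbT inE.
suff [->|->] : side u \/ u = z by rewrite ?eqxx ?andbF.
case: (lastP p) wp sp {pn} => [|q v] /=; first by rewrite andbT => /eqP -> _; left.
move=> wq sq; have sv : side v.
  by have := sq v; rewrite mem_rcons mem_head mem_filter => /(_ isT)/andP[].
apply: (side_nb sv); move: wq; case: q {sq} => [|a q] /=.
  by rewrite andbT => /andP[].
by move=> /andP[_]; rewrite rcons_path last_rcons => /andP[].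
Qed.

Lemma kept_up_depends T :
  depends_on [set j | side j.1] [set x : source G -> R | kept_up side z w T x].
Proof.
move=> x x' xx' H m; have [n [nc hu]] := H m; exists n; split.
  move=> c; apply: nc; apply: (chain_depends (W := [set v | side v])) c.
    by move=> v; rewrite mem_filter => /andP[].
  by move=> j sj; rewrite xx'.
apply: (held_up_depends (W := [set v | side v])) hu => //.
move=> v; rewrite mem_filter => /andP[sv _]; split=> // y /(side_nb sv)[|->]; first by left.
by right; rewrite mem_head.
Qed.

(** Only the spin of [z] up to time [S] is used, so that an induction in time can apply this before
    [z] is known to be up forever. *)
Lemma kept_up_sigma x (sigma : R -> G -> bool) T S t : good_clocks x -> 0 <= T ->
  (forall U, {subset U <= side} -> trajectory nb x U sigma) ->
  (forall v, side v -> sigma 0 v = ini x v) ->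
  (forall s : R, 0 <= s <= S -> sigma s z) -> kept_up side z w T x ->
  T <= t <= S -> sigma t w.
Proof.
move=> gx T0 tx s0 sz H /andP[Tt tS].
have TS : T <= S := le_trans Tt tS.
pose m := Num.bound `|S - T|.
have Sm : S <= T + m%:R.
  by rewrite -lerBlDl (le_trans (ler_norm _))// ltW// archi_boundP.
have [n [nc hu]] := H m.
have nc' : ~ chain nb x [seq v <- ball w n | side v] n w S.
  by move=> /(chain_le (fun _ => id) Sm).
apply: (@sigma_held_up _ nb _ x [seq v <- ball w n | side v] [:: z] w T S n sigma) => //.
- by apply: tx => v; rewrite mem_filter => /andP[].
- exact: side_encloses.
- by move=> v; rewrite inE => /eqP ->; rewrite mem_filter negb_and side_z.
- by move=> v; rewrite mem_filter => /andP[sv _]; exact: s0.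
- by move=> v s; rewrite inE => /eqP ->; exact: sz.
- exact: held_up_le hu.
- by rewrite Tt.
Qed.

Context (deg : nat) (deg_gt0 : (0 < deg)%N) (size_nb : forall v, size (nb v) = deg).
Context d (Omega : measurableType d) (P : probability Omega R).
Variable X : Omega -> source G -> R.
Hypothesis gX : glauber_data P X.

(** The forms of the two events fit their uses: [stays_up], universal in [n], follows from the
    behaviour of a trajectory, whereas [kept_up], existential in [n], implies it. For a bounded
    horizon they are compared by [pr_held_up_le] up to the probability of a chain, which is small
    for large [n]; continuity from above then removes the horizon. *)
Lemma pr_kept_up T : 0 <= T ->
  pr P [set o | stays_up w T (X o)] <= pr P [set o | kept_up side z w T (X o)].
Proof.
move=> T0; pose V n := [seq v <- ball w n | side v].
pose E m n : set (source G -> R) := [set x | ~ chain nb x (V n) n w (T + m%:R) /\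
  held_up nb x (V n) [:: z] w T (T + m%:R)].
have mE m n : measurable (E m n : set D).
  exact: (measurableI _ _ (measurableC (measurable_chain nb _ _ _ _)) (measurable_held_up nb _ _ _ _ _)).
pose F m := X @^-1` [set x | exists n, E m n x].
have mF m : measurable (F m).
  apply: (glauber_measurable gX); apply: (@mpred_exists _ D _ (fun n x => E m n x)) => n; exact: mE.
have mS := glauber_measurable gX (measurable_stays_up w T).
have pF m : pr P [set o | stays_up w T (X o)] <= pr P (F m).
  apply/ler_addgt0Pr => e e0.
  have [N HN] := pr_chain_small deg_gt0 size_nb gX w (T + m%:R) e0.
  pose c : set (source G -> R) := [set x | chain nb x (ball w N) N w (T + m%:R)].
  pose h : set (source G -> R) := [set x | ~ chain nb x (V N) N w (T + m%:R) /\
    held_up nb x (ball w N) [::] w T (T + m%:R)].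
  have mc : measurable (X @^-1` c) by exact: (glauber_measurable gX (measurable_chain nb _ _ _ _)).
  have mh : measurable (X @^-1` h).
    apply: (glauber_measurable gX).
    exact: (measurableI _ _ (measurableC (measurable_chain nb _ _ _ _)) (measurable_held_up nb _ _ _ _ _)).
  have VB : {subset V N <= ball w N} by move=> v; rewrite mem_filter => /andP[].
  apply: (@le_trans _ _ (pr P (X @^-1` c `|` X @^-1` h))).
    apply: pr_le => //; first exact: measurableU.
    move=> o so; have [co|nco] := pselect (c (X o)); [by left|right; split; last exact: so].
    by move=> /(chain_le VB (lexx _)).
  apply: le_trans (prU_le P mc mh) _; rewrite addrC lerD//; last exact: HN.
  apply: (@le_trans _ _ (pr P (X @^-1` (E m N)))).
    have zV v : v \in [:: z] -> v \notin V N.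
      by rewrite inE => /eqP ->; rewrite mem_filter negb_and side_z.
    exact: (pr_held_up_le gX T (T + m%:R) VB zV (@side_encloses N)).
  apply: pr_le => //; first exact: (glauber_measurable gX).
  by move=> o ?; exists N.
have -> : [set o | kept_up side z w T (X o)] = \bigcap_m F m.
  apply/seteqP; split=> o H; first by move=> m _; exact: H.
  by move=> m; exact: (H m I).
have mI : measurable (\bigcap_m F m) by exact: bigcapT_measurable.
have niF : nonincreasing_seq F.
  apply/nonincreasing_seqP => m; apply/subsetPset => o [n [nc hu]]; exists n; split.
    by move=> c; apply: nc; apply: chain_le c => //; rewrite lerD2l ler_nat.
  by apply: held_up_le hu; rewrite ?lerDl// lerD2l ler_nat.
have F0 : (P (F 0%N) < +oo)%E by rewrite ltey_eq fin_num_measure.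
have cF := nonincreasing_cvg_mu F0 mF mI niF.
rewrite -lee_fin -(fin_pr P mI).
rewrite -(cvg_lim _ cF)//; apply: lime_ge; first by apply/cvg_ex; exists (P (\bigcap_m F m)).
apply: nearW => m /=.
by rewrite -[leRHS]fineK ?fin_num_measure// lee_fin; exact: pF.
Qed.

End side.

End eventual_events.

(** * The dynamics as a function of its data *)

Section pull_back.
Context (R : realType) d (Omega : measurableType d) (P : probability Omega R).
Context (V : choiceType) (e : rel V) (init : V -> {RV P >-> bool}).
Context (tau : V -> nat -> {RV P >-> R}) (coin : V -> nat -> {RV P >-> bool}).
Context (G : countType) (phi : G -> V) (phi_inj : injective phi).

Definition sgn (b : bool) : R := if b then 1 else -1.

Definition pulled_data (o : Omega) : source G -> R := fun j =>
  match j.2 with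
  | None => sgn (init (phi j.1) o)
  | Some (true, k) => tau (phi j.1) k o
  | Some (false, k) => sgn (coin (phi j.1) k o)
  end.

Lemma sgn_gt0 b : (0 < sgn b) = b.
Proof. by case: b; rewrite /sgn ?ltr01// ltr0N1. Qed.

Lemma bernoulli_fair_sign (A : set R) :
  bernoulli_prob 2^-1 (sgn @^-1` A) = fair_sign A.
Proof.
rewrite bernoulli_probE ?invr_ge0 ?ler0n ?invf_le1 ?ler1n//.
rewrite /fair_sign !diracE /unstable.onem -!EFinM -EFinD mulrDr; congr ((_ + _)%:E).
by rewrite (_ : 1 - 2^-1 = 2^-1); last by lra.
Qed.

Hypothesis tau_law : forall x k (A : set R), measurable A ->
  distribution P (tau x k) A = exponential_prob 1 A.
Hypothesis coin_law : forall x k (A : set bool), measurable A ->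
  distribution P (coin x k) A = bernoulli_prob 2^-1 A.
Hypothesis indep : mutually_independent P (glauber_sources init tau coin).
Hypothesis iid : iid_symmetric_spins init.

Let measurable_pulled (j : source G) (A : set R) : measurable A ->
  measurable [set o | A (pulled_data o j)].
Proof.
have mb (f : {RV P >-> bool}) (B : set bool) : measurable (f @^-1` B).
  by rewrite -[X in measurable X]setTI; exact: measurable_funP.
case: j => v [[[] k]|] mA; rewrite /pulled_data /=.
- by rewrite -[X in measurable X]setTI; exact: (measurable_funP (tau _ _)).
- exact: (mb _ (sgn @^-1` A)).
- exact: (mb _ (sgn @^-1` A)).
Qed.

(** All initial spins have the same code, as the configuration is a single source in
    [glauber_sources]. *)
Let code (j : source G) : option (V * nat + V * nat) :=
  match j.2 with
  | None => None
  | Some (true, k) => Some (inl (phi j.1, k))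
  | Some (false, k) => Some (inr (phi j.1, k))
  end.

Let code_inj j j' : j.2 != None -> code j = code j' -> j = j'.
Proof.
case: j => v [[[] k]|//] _; case: j' => v' [[[] k']|] //= [] /phi_inj -> ->//.
Qed.

Let code_None j : (code j == None) = (j.2 == None).
Proof. by case: j => v [[[] k]|]. Qed.

(** Two layers of independence: the constraints on initial spins form one event of the source
    [None], independent of the clocks and coins; inside this event the i.i.d. hypothesis splits the
    spins. *)
Lemma pulled_independent : independent P pulled_data.
Proof.
move=> s A us mA.
pose B j := [set o | A j (pulled_data o j)].
pose E i : set Omega := [set o | forall j, j \in s -> code j = i -> B j o].
pose s1 := [seq j <- s | j.2 != None]; pose s0 := [seq j <- s | j.2 == None].
have E1 j : j \in s1 -> E (code j) = B j.
  rewrite mem_filter => /andP[jN js]; apply/seteqP; split=> o /= H; first exact: H.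
  by move=> j' j's /esym/(code_inj jN) <-.
have mB0 j : j \in s0 -> generated_sigma_algebra (init (phi j.1)) (B j).
  rewrite mem_filter => /andP[/eqP j0 _]; exists (sgn @^-1` (A j)) => //.
  by rewrite setTI /B /pulled_data j0.
have FE i : i \in None :: map code s1 -> glauber_sources init tau coin i (E i).
  rewrite inE => /predU1P[->|/mapP[j js1 ->]] /=.
    pose T0 := g_sigma_algebraType (\bigcup_(x in [set: V]) generated_sigma_algebra (init x)).
    have : @mpred _ T0 (fun o => forall j, j \in s0 -> B j o).
      apply: (@mpred_in _ T0 _ s0 (fun j o => B j o)) => j js0.
      by apply: sub_sigma_algebra; exists (phi j.1) => //; exact: mB0.
    suff -> : E None = [set o | forall j, j \in s0 -> B j o] by [].
    apply/seteqP; split=> o H j; rewrite ?mem_filter.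
      by move=> /andP[j0 js]; apply: H => //; apply/eqP; rewrite code_None.
    move=> js /eqP; rewrite code_None => j0; apply: H.
    by rewrite mem_filter j0.
  rewrite E1//; move: js1; rewrite mem_filter => /andP[jN js].
  rewrite /code /B /pulled_data; case: (j.2) jN => [[[] k]|] //= _.
    by exists (A j) => //; rewrite setTI.
  by exists (sgn @^-1` (A j)) => //; rewrite setTI.
have us1 : uniq (None :: map code s1).
  rewrite /= map_inj_in_uniq ?filter_uniq ?andbT//.
    apply/negP => /mapP[j]; rewrite mem_filter => /andP[jN _] /esym/eqP.
    by rewrite code_None (negbTE jN).
  by move=> j j'; rewrite mem_filter => /andP[jN _] _; exact: code_inj.
have := indep us1 FE; rewrite big_cons big_map.
have -> : \bigcap_(i in [set` None :: map code s1]) E i =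
    [set o | forall j, j \in s -> A j (pulled_data o j)].
  apply/seteqP; split=> o H.
    move=> j js; have := H (code j); rewrite /= inE; apply=> //.
    have [j0|j0] := boolP (j.2 == None); first by rewrite code_None j0.
    by apply/orP; right; apply/map_f; rewrite mem_filter j0.
  by move=> i _ j js _; exact: H.
move=> ->.
have -> : P (E None) = (\prod_(j <- s0) P (B j))%E.
  have [_ iI] := iid.
  have us0 : uniq (map (fun j : source G => phi j.1) s0).
    rewrite map_inj_in_uniq ?filter_uniq// => -[v o] [v' o'].
    by rewrite !mem_filter /= => /andP[/eqP -> _] /andP[/eqP -> _] /phi_inj ->.
  pose E0 x : set Omega := [set o | forall j, j \in s0 -> phi j.1 = x -> B j o].
  have E0B j : j \in s0 -> E0 (phi j.1) = B j.
    move=> js; apply/seteqP; split=> o H; first exact: H.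
    move=> j' js' /phi_inj vv; suff -> : j' = j by [].
    move: js js'; rewrite !mem_filter => /andP[/eqP j0 _] /andP[/eqP j'0 _].
    by rewrite [j']surjective_pairing vv j'0 -j0 -surjective_pairing.
  have F0 x : x \in map (fun j : source G => phi j.1) s0 ->
      generated_sigma_algebra (init x) (E0 x).
    by move=> /mapP[j js ->]; rewrite E0B//; exact: mB0.
  have := iI _ _ us0 F0; rewrite big_map => EP.
  rewrite -(eq_big_seq _ (fun j js => congr1 P (E0B j js))) /= -EP.
  congr (P _); apply/seteqP; split=> o H.
    move=> x /mapP[j js ->] j' js' _; apply: H; move: js'; rewrite mem_filter => /andP[j0 js']//.
    by apply/eqP; rewrite code_None.
  move=> j js /eqP; rewrite code_None => j0; apply: (H (phi j.1)) => //.
    by apply/mapP; exists j; rewrite // mem_filter j0.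
  by rewrite mem_filter j0.
rewrite (eq_big_seq _ (fun j js => congr1 P (E1 j js))).
by rewrite !big_filter [RHS](bigID (fun j : source G => j.2 == None)).
Qed.

Lemma pulled_glauber_data : glauber_data P pulled_data.
Proof.
split; last 2 first.
- exact: pulled_independent.
- move=> [v [[[] k]|]] A mA /=.
  + exact: tau_law.
  + by rewrite -bernoulli_fair_sign -(coin_law (phi v) k).
  + by rewrite -bernoulli_fair_sign -(iid.1 (phi v)).
- by move=> j _ A mA; rewrite setTI; exact: measurable_pulled.
Qed.

End pull_back.

Section pull_back_trajectory.
Context (V : choiceType) (e : rel V) (G : countType).
Context (phi : G -> V) (phi_inj : injective phi) (nb : G -> seq G).
Hypothesis nb_uniq : forall v, uniq (nb v).
Hypothesis phi_nb : forall v, neighbors e (phi v) = [set` map phi (nb v)].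

Lemma glauber_update_pull_back c (s : V -> bool) v :
  glauber_update e c s (phi v) = update nb false c (s \o phi) v.
Proof.
set p := count (s \o phi) (nb v).
have E : energy_change e s (phi v) =
    2 * (spin (s (phi v)) * (p.*2%:Z - (size (nb v))%:Z)).
  rewrite /energy_change phi_nb -fsbig_seq ?map_inj_uniq// big_map; congr (2 * _).
  rewrite -mulr_sumr; congr (_ * _); rewrite /p.
  elim: (nb v) => [|y l IH] /=; first by rewrite big_nil.
  by rewrite big_cons IH doubleD; case: (s (phi y)) => /=; lia.
rewrite /glauber_update E /update -/p /=.
have [h|h|h] := ltngtP p.*2 (size (nb v)); case: (s (phi v)) => /=;
  case: ifP => h1; try lia; (try (case: ifP => h2; try lia)); by case: c.
Qed.

Lemma trajectory_pull_back (R : realType) (x : source G -> R) (tau : V -> nat -> R)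
    (coin : V -> nat -> bool) (sigma : R -> V -> bool) U :
  (forall v k, wait x v k = tau (phi v) k) -> (forall v k, flip x v k = coin (phi v) k) ->
  glauber_trajectory e tau coin sigma ->
  trajectory nb x U (fun t v => sigma t (phi v)).
Proof.
move=> xt xc [T1 T2]; have rE v n : ring x (v, n) = ring_time tau (phi v) n.
  by apply: eq_bigr => k _; exact: xt.
split=> [v s t _ s0 st H|v n _].
  by apply: T1 => // n; rewrite -rE.
rewrite rE; have := T2 (phi v) n; apply: filterS => s.
by rewrite glauber_update_pull_back xc.
Qed.

End pull_back_trajectory.

(** * Flip times of a single spin *)

Section spin_flips.
Context (G : countType) (nb : G -> seq G) (R : realType).
Variables (x : source G -> R) (sigma : R -> G -> bool) (U : seq G) (v : G).
Hypotheses (gx : good_clocks x) (tx : trajectory nb x U sigma) (vU : v \in U).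

Definition flips := [set t : R | 0 < t /\ \forall s \near t^'-, sigma t v != sigma s v].

Lemma finite_set_bounded (A : set R) : finite_set A -> exists m : nat, forall t, A t -> t <= m%:R.
Proof.
move=> /finite_seqP[s ->].
exists (Num.bound (\sum_(t <- s) `|t|)) => t /= ts.
apply: le_trans (ler_norm t) _; apply: le_trans (ltW (archi_boundP _)); last first.
  by apply: sumr_ge0 => ? _; exact: normr_ge0.
by rewrite (big_rem t)//= lerDl; apply: sumr_ge0 => ? _; exact: normr_ge0.
Qed.

(** Induction on the number of rings before [t]. By induction the spin is constant just before the
    last ring, so a change there would be a flip time beyond the bound [m]. *)
Lemma finite_flips_const : finite_set flips ->
  exists m : nat, forall t, m%:R <= t -> sigma t v = sigma m%:R v.
Proof.
move=> /finite_set_bounded[m Hm]; exists m => t mt.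
have [T1 T2] := tx; have m0 : 0 <= m%:R :> R by exact: ler0n.
have [_ inf _] := gx; have [K tK] := inf v t.
elim: K t mt tK => [|K IH] t mt tK.
  apply: T1 => // n; apply/negP => /andP[_ rt]; have := le_lt_trans rt tK.
  by rewrite ltNge; case: n {rt} => [|n]; rewrite ?lexx// ltW// ring_lt.
have [/(IH _ mt)//|Kt] := ltP t (ring x (v, K)).
have nK n : ring x (v, n) <= t -> (n <= K)%N.
  move=> rt; rewrite leqNgt; apply/negP => Kn; have := le_lt_trans rt tK.
  rewrite ltNge; move: Kn; rewrite leq_eqVlt => /predU1P[<-|Kn]; first by rewrite lexx.
  by rewrite ltW// ring_lt.
have leK n : (n <= K)%N -> ring x (v, n) <= ring x (v, K).
  by rewrite leq_eqVlt => /predU1P[->//|nK']; rewrite ltW// ring_lt.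
have [Km|mK] := leP (ring x (v, K)) m%:R.
  apply: T1 => // n; apply/negP => /andP[mn /nK/leK nk].
  by have := lt_le_trans mn (le_trans nk Km); rewrite ltxx.
have -> : sigma t v = sigma (ring x (v, K)) v.
  apply: T1 => //; first exact: ltW (ring_gt0 _ gx).
  move=> n; apply/negP => /andP[Kn /nK/leK nk].
  by have := lt_le_trans Kn nk; rewrite ltxx.
have near_s : \forall s \near (ring x (v, K))^'-, sigma s v = sigma m%:R v.
  near=> s; apply: IH; last by near: s; exact: nbhs_left_lt.
  by near: s; exact: nbhs_left_ge.
have [//|ne] := eqVneq (sigma (ring x (v, K)) v) (sigma m%:R v).
have /Hm : flips (ring x (v, K)).
  split; first exact: ring_gt0.
  by apply: filterS near_s => s ->.
by rewrite leNgt mK.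
Unshelve. all: end_near. Qed.

Lemma tie_infinite_flips (T : R) : (forall K, exists2 k, (K <= k)%N & flip x v k) ->
  (forall s, T <= s -> (count (sigma s) (nb v)).*2 = size (nb v)) ->
  infinite_set flips.
Proof.
move=> heads tie /finite_set_bounded[m Hm]; have [_ inf _] := gx.
have [K HK] := inf v (Num.max m%:R T); have [k Kk hk] := heads K.
have rk : Num.max m%:R T < ring x (v, k).
  apply: lt_le_trans HK _; move: Kk; rewrite leq_eqVlt => /predU1P[->//|Kk].
  by rewrite ltW// ring_lt.
move: rk; rewrite gt_max => /andP[mr Tr].
have : flips (ring x (v, k)).
  split; first exact: ring_gt0.
  near=> s; have -> : sigma (ring x (v, k)) v = update nb false (flip x v k) (sigma s) v.
    by near: s; exact: tx.2.
  have Ts : T <= s by near: s; exact: nbhs_left_ge.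
  by rewrite /update tie// !ltnn hk /=; case: (sigma s v).
by move=> /Hm; rewrite leNgt mr.
Unshelve. all: end_near. Qed.

End spin_flips.

(** * Regular trees *)

Section regular_tree.
Variable b : nat.

(* The [b.+1]-regular tree seen from an edge: [(true, [::])] and
   [(false, [::])] are its end points, and [(r, i :: s)] is the [i]-th child of
   [(r, s)]. *)
Definition tree := (bool * seq 'I_b)%type.

Definition parent (v : tree) : tree := if v.2 is _ :: s then (v.1, s) else (~~ v.1, [::]).

Definition child (v : tree) i : tree := (v.1, i :: v.2).

Definition tree_nb (v : tree) : seq tree := parent v :: [seq child v i | i <- enum 'I_b].

Lemma size_tree_nb v : size (tree_nb v) = b.+1.
Proof. by rewrite /= size_map size_enum_ord. Qed.

Lemma uniq_tree_nb v : uniq (tree_nb v).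
Proof.
rewrite /= map_inj_uniq ?enum_uniq ?andbT; last by move=> i j [].
apply/mapP => -[i _] /(congr1 (fun u : tree => size u.2)).
by case: v => r [|j s] //= E; lia.
Qed.

Lemma tree_nbP v y : reflect (y = parent v \/ exists i, y = child v i) (y \in tree_nb v).
Proof.
rewrite inE; apply: (iffP predU1P) => -[->|]; try by left.
  by move=> /mapP[i _ ->]; right; exists i.
by move=> [i ->]; right; apply: map_f; rewrite mem_enum.
Qed.

Lemma tree_nb_sym v y : y \in tree_nb v -> v \in tree_nb y.
Proof.
move=> /tree_nbP[->|[i ->]]; apply/tree_nbP; last by left; case: v.
by case: v => r [|i s]; [left; rewrite /parent /= negbK|right; exists i].
Qed.

Let adj (v y : tree) := y \in tree_nb v.

Lemma tree_connected u v : exists2 p, path adj u p & last u p = v.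
Proof.
suff H r s : exists2 p, path adj (true, [::]) p & last (true, [::]) p = (r, s).
  case: u => r s; case: v => r' s'; have [p pp lp] := H r s; have [q qp lq] := H r' s'.
  have lr (y : tree) l : last (last y l) (rev (belast y l)) = y.
    by case: l => //= a l; rewrite rev_cons last_rcons.
  exists (rev (belast (true, [::]) p) ++ q); last by rewrite last_cat -lp lr.
  rewrite cat_path -lp lr qp andbT rev_path.
  by apply: sub_path pp => x y; exact: tree_nb_sym.
elim: s => [|i s [p pp lp]].
  case: r; first by exists [::].
  by exists [:: (false, [::])] => //=; rewrite andbT; apply/tree_nbP; left.
exists (rcons p (r, i :: s)); last by rewrite last_rcons.
by rewrite rcons_path pp lp; apply/tree_nbP; right; exists i.
Qed.

End regular_tree.

Section tree_embedding.
Context (V : choiceType) (e : rel V) (b : nat).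
Hypotheses (htree : is_tree e) (hreg : is_regular e b.+1).

Fixpoint nobacktrack (x : V) (p : seq V) :=
  if p is y :: p' then (if p' is z :: _ then x != z else true) && nobacktrack y p' else true.

(** If [x] recurs, the stretch before its return is a simple cycle. Such a cycle has at most two
    vertices, and a return after two steps is a backtrack. *)
Lemma nobacktrack_uniq x p : path e x p -> nobacktrack x p -> uniq (x :: p).
Proof.
have [_ [_ irr] _ acyc] := htree.
elim: p x => // y p IH x /= /andP[xy yp] /andP[xz np].
rewrite -[_ && _]/(uniq (x :: y :: p)) cons_uniq IH// andbT inE negb_or; apply/andP; split.
  by apply: contraTneq xy => ->; rewrite irr.
apply/negP => xp; move: (IH _ yp np); case/splitPr: xp yp xz {np} => p1 p2 yp xz uyp.
have := acyc (x :: y :: p1); rewrite /ucycle /= xy /=.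
move: yp; rewrite cat_path /= => /and3P[yp1 lx _].
move: uyp; rewrite -[y :: p1 ++ x :: p2]/((y :: p1) ++ x :: p2) cat_uniq => /and3P[u1 /hasPn H _].
have xn : x \notin y :: p1 := H x (mem_head _ _).
move: u1 => /= u1; rewrite rcons_path yp1 lx xn u1 => /(_ isT).
by case: p1 {yp1 lx u1 xn H} xz => [|? ?] //=; rewrite eqxx.
Qed.

(** The model tree is mapped as a covering, bijectively from neighbours to neighbours. A path
    without repetition then has a non-backtracking image, whose end points differ by
    [nobacktrack_uniq]. *)
Lemma tree_embedding : exists phi : tree b -> V, injective phi /\
  forall v, neighbors e (phi v) = [set` map phi (tree_nb v)].
Proof.
have [[x0 _] [esym irr] _ _] := htree.
pose nbV x : seq V := finmap.enum_fset (fset_set (neighbors e x)).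
have finN x : finite_set (neighbors e x) by apply/finite_setP; exists b.+1; exact: hreg.
have nbVE x y : (y \in nbV x) = e x y.
  have E : [set` nbV x] = neighbors e x := fset_setK (finN x).
  by move/seteqP: E => [H1 H2]; apply/idP/idP; [exact: H1|exact: H2].
have szV x : size (nbV x) = b.+1 by apply: card_fset_set; exact: hreg.
have unV x : uniq (nbV x) by exact: finmap.fset_uniq.
pose w := nth x0 (nbV x0) 0.
have ew : e x0 w by rewrite -nbVE mem_nth// szV.
(* The pair consists of the image of a vertex and that of its parent; the [i]-th child goes to the
   [i]-th neighbour once the parent is removed. *)
pose psi (r : bool) := fix psi (s : seq 'I_b) : V * V :=
  if s is i :: s' then let p := psi s' in (nth x0 (rem p.2 (nbV p.1)) i, p.1)
  else if r then (w, x0) else (x0, w).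
have szr r s : (psi r s).2 \in nbV (psi r s).1 ->
    size (rem (psi r s).2 (nbV (psi r s).1)) = b.
  by move=> H; rewrite size_rem// szV.
have inv r s : (psi r s).2 \in nbV (psi r s).1.
  elim: s => [|i s IH]; first by case: r; rewrite nbVE// esym.
  rewrite /= nbVE esym -nbVE; apply: (@mem_rem _ (psi r s).2).
  by rewrite mem_nth// szr.
pose phi (v : tree b) := (psi v.1 v.2).1.
have par v : (psi v.1 v.2).2 = phi (parent v).
  by case: v => r [|i s] //; case: r.
have nbE v : map phi (tree_nb v) = phi (parent v) :: rem (phi (parent v)) (nbV (phi v)).
  rewrite /= -map_comp; congr cons; rewrite -par.
  rewrite -[RHS](mkseq_nth x0) /mkseq szr// -val_enum_ord -map_comp.
  by apply: eq_map => i.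
have nbP v : perm_eq (map phi (tree_nb v)) (nbV (phi v)).
  by rewrite nbE perm_sym; apply: perm_to_rem; rewrite -par; exact: inv.
exists phi; split; last first.
  move=> v; apply/seteqP; split=> y /=; by rewrite (perm_mem (nbP v)) nbVE.
have edge v y : y \in tree_nb v -> e (phi v) (phi y).
  by move=> vy; rewrite -nbVE -(perm_mem (nbP v)) map_f.
have locinj v y z : y \in tree_nb v -> z \in tree_nb v -> phi y = phi z -> y = z.
  move=> yv zv E; have u : uniq (map phi (tree_nb v)) by rewrite (perm_uniq (nbP v)).
  have [i il iE] := nthP v yv; have [j jl jE] := nthP v zv.
  rewrite -iE -jE; congr nth; apply/eqP.
  rewrite -(nth_uniq (phi v) _ _ u) ?size_map// !(nth_map v)//.
  by rewrite iE jE E.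
move=> u v uv; apply/eqP; apply: contraT => neq.
have [p pp lp] := tree_connected u v; move: lp.
case/shortenP: pp => q pq uq _ lq.
have pe : path e (phi u) (map phi q).
  by rewrite path_map; apply: sub_path pq => x y; exact: edge.
have nq : nobacktrack (phi u) (map phi q).
  elim: q (u) pq uq {lq pe} => // y q IH x /andP[xy yq] uq.
  rewrite /= IH//; last by move: uq; rewrite cons_uniq => /andP[].
  case: q yq uq {IH} => // z q /andP[yz _]; rewrite /= andbT !inE !negb_or => /and3P[/and3P[_ xz _] _ _].
  by apply: contraNneq xz => E; apply/eqP; apply: (@locinj y) => //; exact: tree_nb_sym.
have := nobacktrack_uniq pe nq; rewrite cons_uniq => /andP[/negP + _]; case.
case: q lq {pq uq pe nq} => [/= E|y q lq]; first by rewrite E eqxx in neq.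
by rewrite uv -lq; apply: (@map_f _ _ phi (y :: q)); exact: (mem_last y q).
Qed.

End tree_embedding.

(** * Freezing *)

Section independent_trials.
Context (J : choiceType) (R : realType) d (Omega : measurableType d)
  (P : probability Omega R).

Lemma expr_small (r e : R) : 0 <= r < 1 -> 0 < e -> exists n : nat, r ^+ n < e.
Proof.
move=> /andP[r0 r1] e0; have cr : (GRing.exp r : nat -> R) @ \oo --> (0 : R).
  by apply: cvg_expr; rewrite ger0_norm.
have [n _ /(_ n (leqnn _))] := cvgr_lt _ cr _ e0.
by exists n.
Qed.

Variable X : Omega -> J -> R.
Hypotheses (mX : measurable_data X) (iX : independent P X).

Lemma pr_all_le (I : eqType) (s : seq I) (S : I -> set J) (E : I -> set (J -> R)) r :
  uniq s -> (forall i k, i \in s -> k \in s -> i != k -> S i `&` S k = set0) ->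
  (forall i, i \in s -> measurable (E i : set (dspace J R))) ->
  (forall i, i \in s -> depends_on (S i) (E i)) ->
  (forall i, i \in s -> pr P (X @^-1` (E i)) <= r) ->
  pr P [set w | forall i, i \in s -> E i (X w)] <= r ^+ size s.
Proof.
move=> us dS mE dE Er; rewrite (independent_depends_seq mX iX us dS mE dE).
rewrite (_ : r ^+ size s = \prod_(i <- s) r); last by rewrite big_const_seq count_predT -Monoid.iteropE.
by rewrite big_seq [leRHS]big_seq; apply: ler_prod => i si; rewrite pr_ge0 Er.
Qed.

Lemma pr_all_ge (I : eqType) (s : seq I) (S : I -> set J) (E : I -> set (J -> R)) r :
  uniq s -> (forall i k, i \in s -> k \in s -> i != k -> S i `&` S k = set0) ->
  (forall i, i \in s -> measurable (E i : set (dspace J R))) ->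
  (forall i, i \in s -> depends_on (S i) (E i)) ->
  0 <= r -> (forall i, i \in s -> r <= pr P (X @^-1` (E i))) ->
  r ^+ size s <= pr P [set w | forall i, i \in s -> E i (X w)].
Proof.
move=> us dS mE dE r0 Er; rewrite (independent_depends_seq mX iX us dS mE dE).
rewrite (_ : r ^+ size s = \prod_(i <- s) r); last by rewrite big_const_seq count_predT -Monoid.iteropE.
by rewrite big_seq [leRHS]big_seq; apply: ler_prod => i si; rewrite r0 Er.
Qed.

Lemma negligible_none (S : nat -> set J) (E : nat -> set (J -> R)) (q : R) :
  (forall i k, i != k -> S i `&` S k = set0) ->
  (forall i, measurable (E i : set (dspace J R))) ->
  (forall i, depends_on (S i) (E i)) -> 0 < q ->
  (forall i, q <= pr P (X @^-1` (E i))) ->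
  P.-negligible [set w | forall i, ~ E i (X w)].
Proof.
move=> dS mE dE q0 Eq; apply: pr_negligible_small => e e0.
have mEX i : measurable (X @^-1` (E i)) by exact: measurable_preimage.
have q1 : q <= 1 := le_trans (Eq 0%N) (pr_le1 P (mEX 0%N)).
have [|n Hn] := @expr_small (1 - q) e _ e0; first by rewrite subr_ge0 q1 ltrBlDr ltrDl.
exists [set w | forall i, i \in iota 0 n -> (~` E i) (X w)]; split.
- by apply: (@mpred_in _ _ _ _ (fun i w => ~ E i (X w))) => i _; apply: mpredN; exact: mEX.
- by move=> w H i _; exact: H.
apply: le_lt_trans Hn; rewrite -{2}(size_iota 0 n).
apply: (pr_all_le (S := S) (E := fun i => ~` E i)) => //.
- exact: iota_uniq.
- by move=> i k _ _; exact: dS.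
- by move=> i _; exact: measurableC.
- move=> i _ x y xy nx Ey; apply: nx; apply: (dE i y x) => // j /xy ->//.
- by move=> i _; rewrite -preimage_setC prC// lerD2l lerN2.
Qed.

End independent_trials.

Section dynamics.
Context (G : countType) (nb : G -> seq G) (R : realType).
Implicit Types (x : source G -> R) (sigma : R -> G -> bool).

(** An initial coordinate 0 would be read as a spin -1 before and after negation, which would break
    the spin symmetry. *)
Definition good x := [/\ good_clocks x, forall v, x (v, None) != 0 &
  forall v K, exists2 k, (K <= k)%N & flip x v k].

Definition dynamics x sigma :=
  (forall U, trajectory nb x U sigma) /\ forall v, sigma 0 v = ini x v.

(** Quantifying over trajectories makes this a property of the data alone, though possibly not a
    measurable one. *)
Definition freezing x :=
  exists sigma, dynamics x sigma /\ forall v, finite_set (flips sigma v).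

Lemma freezing_settles x sigma v : good_clocks x -> dynamics x sigma ->
  finite_set (flips sigma v) ->
  exists (b : bool) (m : nat), forall t, m%:R <= t -> sigma t v = b.
Proof.
move=> gx [tx _] /(finite_flips_const gx (tx [:: v]) (mem_head _ _))[m Hm].
by exists (sigma m%:R v), m.
Qed.

Lemma update_neg c s v : update nb false c (fun y => ~~ s y) v = ~~ update nb false c s v.
Proof.
rewrite /update; have E := count_predC s (nb v).
have -> : count (fun y => ~~ s y) (nb v) = (size (nb v) - count s (nb v))%N.
  by rewrite -E addKn; exact: eq_count.
set p := count s (nb v) in E *; set n := size (nb v) in E *.
have pn : (p <= n)%N by rewrite -E leq_addr.
by have [h|h|h] := ltngtP p.*2 n; case: ltngtP => h'; try lia; case: c (s v) => -[].
Qed.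

Lemma dynamics_reflect b x sigma : good x -> dynamics x sigma ->
  dynamics (reflect_spins b x) (fun t v => b (+) sigma t v).
Proof.
move=> [_ x0 _] [tx ix]; case: b; last first.
  suff -> : reflect_spins false x = x by split.
  by apply/funext => j.
split=> [U|v]; last first.
  rewrite /= ix /ini /reflect_spins /= oppr_gt0.
  by have := x0 v; case: ltgtP.
have [T1 T2] := tx U; split=> [v s t vU s0 st H|v n vU].
  by congr (~~ _); apply: T1 => // n; have := H n.
by apply: filterS (T2 v n vU) => s /=; rewrite -[ring _ _]/(ring x (v, n)) => ->; rewrite update_neg.
Qed.

Lemma good_reindex (k : G -> G) x : injective k -> good x -> good (reindex k x).
Proof.
move=> kI [[pos inf inj] x0 heads]; split; last 2 first.
- by move=> v; exact: x0.
- by move=> v K; have [i] := heads (k v) K; exists i.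
split; [by move=> v i; exact: pos|by move=> v t; exact: (inf (k v) t)|].
move=> [v i] [v' i'] E; have := inj (k v, i) (k v', i').
by move=> /(_ E) [/kI -> ->].
Qed.

Lemma good_reflect b x : good x -> good (reflect_spins b x).
Proof.
move=> [gx x0 heads]; have E f : reflect_spins b x (f.1, Some f.2) = x (f.1, Some f.2).
  by rewrite /reflect_spins andbF.
have rE a : ring (reflect_spins b x) a = ring x a by apply: ring_ext => k; exact: (E (_, _)).
have [pos inf inj] := gx; split; first split.
- by move=> v k; rewrite /wait (E (_, _)); exact: pos.
- by move=> v t; have [k] := inf v t; exists k; rewrite rE.
- by move=> a a'; rewrite !rE; exact: inj.
- by move=> v; rewrite /reflect_spins; case: ifP; rewrite ?oppr_eq0.
- by move=> v K; have [k Kk] := heads v K; exists k; rewrite // /flip (E (_, _)).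
Qed.

Context d (Omega : measurableType d) (P : probability Omega R).
Variable X : Omega -> source G -> R.
Hypothesis gX : glauber_data P X.

Lemma good_ae : {ae P, forall w, good (X w)}.
Proof.
have n0 : P.-negligible [set w | exists v, X w (v, None) = 0].
  apply: negligible_exists => v; have mX : measurable [set w | [set 0 : R] (X w (v, None))].
    by apply: mpred_fun (measurable_set1 _); case: gX.
  apply: pr0_negligible mX _; rewrite (pr_coord gX)//= /fair_sign.
  by rewrite !memNset ?addr0 ?mulr0//= => /eqP; rewrite ?oppr_eq0 oner_eq0.
have nf : P.-negligible [set w | exists v K, forall i, ~ flip (X w) v (K + i)%N].
  apply: negligible_exists => v; apply: negligible_exists => K.
  have [mX iX _] := gX.
  apply: (negligible_none mX iX (S := fun i => [set (v, Some (false, (K + i)%N))])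
    (E := fun i => [set x | flip x v (K + i)%N]) (q := 2^-1)).
  - move=> i k ik; rewrite -subset0 => j [/= ->] [] /addnI ik'.
    by rewrite ik' eqxx in ik.
  - by move=> i; exact: mpred_flip.
  - by move=> i x y xy; rewrite /flip /= xy.
  - by rewrite invr_gt0.
  - by move=> i; rewrite -(pr_flip gX v (K + i)%N true).
apply: negligibleS (negligibleU (good_clocks_ae gX) (negligibleU n0 nf)) => w nw.
apply: contrapT => H; apply: nw => /=; split.
- by apply: contrapT => ng; apply: H; left.
- by move=> v; apply/eqP => v0; apply: H; right; left; exists v.
- move=> v K; apply: contrapT => nh; apply: H; right; right; exists v, K => i fi.
  by apply: nh; exists (K + i)%N; rewrite ?leq_addr.
Qed.

End dynamics.

(** * Preservation of a configuration in time *)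

Section invariant_spins.
Context (G : countType) (nb : G -> seq G) (R : realType).
Implicit Types (x : source G -> R) (sigma : R -> G -> bool).

Lemma last_ring x U sigma v t : good_clocks x -> trajectory nb x U sigma ->
  v \in U -> 0 <= t -> sigma t v = sigma 0 v \/
  exists2 k, ring x (v, k) <= t & sigma t v = sigma (ring x (v, k)) v.
Proof.
move=> gx [T1 _] vU t0; have [_ inf _] := gx; have H := inf v t.
case: (ex_minnP H) => -[|k] tk mk.
  left; apply: T1 => // n; apply/negP => /andP[_ nt].
  have := le_lt_trans nt tk; rewrite ltNge.
  by case: n {nt} => [|n]; rewrite ?lexx// ltW// ring_lt.
have kt : ring x (v, k) <= t.
  by rewrite leNgt; apply/negP => /mk; rewrite ltnn.
right; exists k => //; apply: T1 => //; first exact: ltW (ring_gt0 _ gx).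
move=> n; apply/negP => /andP[kn nt].
have [nk|kn'] := leqP n k.
  move: nk kn; rewrite leq_eqVlt => /predU1P[->|/(ring_lt v gx) nk]; first by rewrite ltxx.
  by move=> /(lt_trans nk); rewrite ltxx.
have := le_lt_trans nt tk; rewrite ltNge; move: kn'; rewrite leq_eqVlt => /predU1P[->|kn'].
  by rewrite lexx.
by rewrite ltW// ring_lt.
Qed.

(** Induction in time, carried out on the number of rings in [U]: strictly before a ring there are
    strictly fewer of them. *)
Lemma trajectory_invariant x U sigma (a : G -> bool) : good_clocks x ->
  trajectory nb x U sigma -> (forall v, v \in U -> sigma 0 v = a v) ->
  (forall v k, v \in U ->
    (forall s, 0 <= s < ring x (v, k) -> forall y, y \in U -> sigma s y = a y) ->
    sigma (ring x (v, k)) v = a v) ->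
  forall t, 0 <= t -> forall v, v \in U -> sigma t v = a v.
Proof.
move=> gx tx s0 H.
suff K n t l : ringlist x U t l -> (size l <= n)%N -> 0 <= t ->
    forall v, v \in U -> sigma t v = a v.
  move=> t t0; have [l1 [l2 [rl _]]] := ringlist_exists U gx (lexx t).
  exact: K rl (leqnn _) t0.
elim: n t l => [|n IH] t l rl ln t0 v vU;
  have [->|[k kt ->]] := last_ring gx tx vU t0; try exact: s0.
  by case: l rl ln => // -[_ /(_ (v, k))]; rewrite vU kt.
apply: H => // s /andP[s_ge0 sk].
have [l1 [l2 [r1 r2]]] := ringlist_exists U gx (le_trans (ltW sk) kt).
rewrite (ringlist_uniq rl r2) size_cat in ln.
apply: (IH s l1) => //.
suff : (0 < size l2)%N by lia.
have : (v, k) \in l1 ++ l2 by case: r2 => _ ->; rewrite vU kt.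
rewrite mem_cat; case: r1 => _ ->; rewrite leNgt sk andbF /=.
by case: l2 {r2 ln}.
Qed.

Lemma update_majority c s v (b : bool) :
  (size (nb v) < (count (fun y => s y == b) (nb v)).*2)%N ->
  update nb false c s v = b.
Proof.
rewrite /update; have E := count_predC s (nb v); case: b => H.
  have e : count (fun y => s y == true) (nb v) = count s (nb v).
    by apply: eq_count => y; rewrite eqb_id.
  by rewrite e in H; case: ltngtP H.
have e : count (fun y => s y == false) (nb v) = count (predC s) (nb v).
  by apply: eq_count => y; rewrite eqbF_neg.
by rewrite e in H; case: ifP => // h; lia.
Qed.

Lemma count_but_one (p : pred G) v z : uniq (nb v) ->
  (forall y, y \in nb v -> y != z -> p y) -> (size (nb v) <= (count p (nb v)).+1)%N.
Proof.
move=> un H; rewrite -(count_predC p) -addn1 leq_add2l.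
apply: leq_trans (_ : count_mem z (nb v) <= 1)%N; last by rewrite count_uniq_mem// leq_b1.
rewrite -!size_filter; apply: uniq_leq_size; first exact: filter_uniq.
move=> y; rewrite !mem_filter /= => /andP[py yn]; rewrite yn andbT.
by apply: contraNT py; exact: H.
Qed.

End invariant_spins.

Lemma update_map (G H : countType) (nb : G -> seq G) (nb' : H -> seq H) (f : G -> H) m c s v :
  map f (nb v) = nb' (f v) -> update nb m c (s \o f) v = update nb' m c s (f v).
Proof. by rewrite /update => <-; rewrite count_map size_map. Qed.

Section eventually_up_negligible.
Context (G : countType) (nb : G -> seq G) (R : realType).
Context d (Omega : measurableType d) (P : probability Omega R).
Variable X : Omega -> source G -> R.
Hypothesis gX : glauber_data P X.

Lemma dynamics_stays_up (x : source G -> R) sigma w (b : bool) (m : nat) : good x ->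
  dynamics nb x sigma -> (forall t, m%:R <= t -> sigma t w = b) ->
  stays_up nb w m%:R (reflect_spins (~~ b) x).
Proof.
move=> gx dx H; have [tx ix] := dynamics_reflect (~~ b) gx dx.
have [gc _ _] := good_reflect (~~ b) gx.
apply: (sigma_stays_up gc (ler0n _ _) tx ix) => t mt /=.
by rewrite H//; case: (b).
Qed.

(** A spin that settles at -1 settles at +1 after reflection, so countably many events of
    probability 0 cover freezing. Times have the form [T.+1] because the opposite case needs a
    positive time. *)
Lemma freezing_negligible_stays_up w :
  (forall T : nat, pr P [set o | stays_up nb w T.+1%:R (X o)] = 0) ->
  P.-negligible [set o | freezing nb (X o)].
Proof.
move=> H; pose F (a : bool * nat) := [set o | stays_up nb w a.2.+1%:R (reflect_spins a.1 (X o))].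
have nF : P.-negligible [set o | exists a, F a o].
  apply: negligible_exists => -[b m]; have gR := glauber_data_reflect b gX.
  have mS := measurable_stays_up nb w (m.+1%:R : R).
  apply: pr0_negligible; first exact: (glauber_measurable gR mS).
  by rewrite -(H m); exact: (glauber_data_law gR gX mS).
apply: negligibleS (negligibleU (good_ae gX) nF) => o [sigma [dx fx]].
have [gx|] := pselect (good (X o)); [right|by left].
have [gc _ _] := gx; have [b [m Hm]] := freezing_settles gc dx (fx w).
exists (~~ b, m); apply: dynamics_stays_up gx dx _ => t mt; apply: Hm.
by apply: le_trans mt; rewrite ler_nat.
Qed.

End eventually_up_negligible.

Lemma measurable_relabel (G H : countType) (R : realType) (k : H -> G) c
    (E : set (source H -> R)) : measurable (E : set (dspace (source H) R)) ->
  measurable ([set x | E (reflect_spins c (reindex k x))] : set (dspace (source G) R)).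
Proof.
apply: (measurable_preimage (Omega := dspace (source G) R)
  (X := fun x => reflect_spins c (reindex k x))) => j.
have mj : measurable_fun setT (fun x : dspace (source G) R => x (k j.1, j.2)).
  exact: measurable_coord.
by rewrite /reflect_spins; case: (_ && _) => //; exact: measurableT_comp.
Qed.

(** * Branches of the tree *)

Section branches.
Context (b : nat) (R : realType).
Local Notation D := (dspace (source (tree b)) R).
Implicit Types (x : source (tree b) -> R) (u : seq 'I_b) (c : bool).

(** Identifies the half tree of [(true, [::])] with the descendants of [(true, u)]. The other half
    is fixed, which keeps the map injective, as reindexing the data requires. *)
Definition branch u (v : tree b) : tree b := if v.1 then (true, v.2 ++ u) else v.

Lemma branch_inj u : injective (branch u).
Proof.
move=> [[] s] [[] s'] //= [] // /(congr1 rev); rewrite !rev_cat => /eqP.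
by rewrite eqseq_cat// => /andP[_ /eqP/(can_inj revK) ->].
Qed.

Definition branch_data u c x := reflect_spins c (reindex (branch u) x).

(** After the reflection by [c], being up means having spin [~~ c]: the root of the branch agrees
    with a parent held at [~~ c] from time [T] on. *)
Definition kept u c (T : R) x :=
  kept_up (@tree_nb b) (fun v : tree b => v.1) (false, [::]) (true, [::]) T (branch_data u c x).

Lemma side_tree_nb (v y : tree b) : v.1 -> y \in tree_nb v -> y.1 \/ y = (false, [::]).
Proof.
move=> v1 /tree_nbP[->|[i ->]]; last by left.
by case: v v1 => [[] [|i s]] //= _; [right|left].
Qed.

Lemma measurable_kept u c T : measurable ([set x | kept u c T x] : set D).
Proof. exact: measurable_relabel (measurable_kept_up _ _ _ _ _). Qed.

Lemma kept_depends u c T :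
  depends_on [set j | exists s, j.1 = (true, s ++ u)] [set x | kept u c T x].
Proof.
move=> x x' xx'; apply: kept_up_depends; [by []|exact: side_tree_nb|].
move=> [[[] s] o] //= _; rewrite /branch_data /reflect_spins /reindex /=.
by rewrite -(xx' (true, s ++ u, o))//; exists s.
Qed.

Lemma kept_sigma u c (T S t : R) x sigma : good x -> dynamics (@tree_nb b) x sigma -> 0 <= T ->
  (forall s, 0 <= s <= S -> sigma s (parent (true, u)) = ~~ c) -> kept u c T x ->
  T <= t <= S -> sigma t (true, u) = ~~ c.
Proof.
move=> gx dx T0 sp ku tS.
have gx' : good (branch_data u c x).
  by apply/good_reflect/good_reindex => //; exact: branch_inj.
have gr : good_clocks (branch_data u c x) by case: gx'.
have [tx ix] := dynamics_reflect c gx dx.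
(* Unlike [branch], this sends the whole other half to the parent of [(true, u)], so that the spin
   seen at [(false, [::])] is that of the parent. *)
pose kap (v : tree b) := if v.1 then (true, v.2 ++ u) else parent (true, u).
have kapE (v : tree b) : v.1 -> [seq kap y | y <- tree_nb v] = tree_nb (kap v).
  case: v => -[] // s _; rewrite /= -map_comp; congr cons.
  by case: s.
have := @kept_up_sigma _ (@tree_nb b) _ (fun v => v.1) (false, [::]) (true, [::]) isT isT
  side_tree_nb _ (fun t v => c (+) sigma t (kap v)) T S t gr T0.
rewrite /= /kap /= => H; apply/(can_inj (addbK c)); rewrite ![_ (+) c]addbC.
have -> : c (+) ~~ c = true by case: (c).
apply: H => //.
- move=> U Us; split=> [[r s] p q vU p0 pq Hq|[r s] n vU].
    have r1 : r := Us _ vU; rewrite r1 in Hq *.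
    by have [T1 _] := tx [:: (true, s ++ u)]; apply: T1; rewrite ?mem_head.
  have r1 : r := Us _ vU; rewrite r1.
  have [_ T2] := tx [:: (true, s ++ u)].
  have := T2 (true, s ++ u) n (mem_head _ _).
  apply: filterS => p ->; rewrite -(update_map _ _ _ (kapE (true, s) isT)).
  by [].
- by move=> [[] s] // _; exact: ix.
- by move=> s s0S /=; rewrite sp//; case: (c).
Qed.

End branches.

Lemma count_ltn_iota m n : count (fun j => (j < m)%N) (iota 0 (m + n)) = m.
Proof.
rewrite iotaD count_cat.
have : all (fun j => (j < m)%N) (iota 0 m) by apply/allP => j; rewrite mem_iota.
rewrite all_count => /eqP ->; rewrite size_iota -[RHS]addn0; congr (_ + _)%N; apply/eqP; rewrite -leqn0 leqNgt -has_count.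
by apply/hasPn => j; rewrite mem_iota => /andP[mj _]; rewrite -leqNgt.
Qed.

(** * Degree at least four *)

Section tied_vertex.
Variable h : nat.
Hypothesis h_gt0 : (0 < h)%N.
Local Notation b := h.*2.+1.
Implicit Types (w u : seq 'I_b) (i j : 'I_b).

(* Words relative to the root of a block: [[:: ord0; ord0]] is the vertex to be
   tied, the others are the frozen vertices around it. *)
Definition in_core w :=
  match w with
  | [::] => true
  | [:: i] => i == ord0
  | [:: i; j] => (i == ord0) && (j == ord0)
  | [:: _; i; j] => (i == ord0) && (j == ord0)
  | _ => false
  end.

(** The words of [in_core] except the tied vertex. The root [[::]] is frozen too because
    [[:: ord0]], which already has the tied vertex as an unreliable neighbour, cannot afford a
    second one. *)
Definition core : seq (seq 'I_b) :=
  [:: [::]; [:: ord0]] ++ [seq [:: j; ord0; ord0] | j <- enum 'I_b].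

Definition leaves : seq (seq 'I_b) :=
  [seq v <- [seq i :: w | w <- core, i <- enum 'I_b] | ~~ in_core v].

(* The tied vertex needs [h.+1] neighbours of each spin. *)
Definition target w := if w is [:: j; _; _] then (j < h)%N else true.

Lemma in_core_behead i w : in_core (i :: w) -> in_core w.
Proof. by case: w => [|j [|k [|l w]]] //= /andP[]. Qed.

Lemma core_in_core w : w \in core -> in_core w.
Proof.
by rewrite !inE => /orP[/eqP ->//|/orP[/eqP ->|/mapP[j _ ->]]] /=; rewrite ?eqxx.
Qed.

Lemma core_first : [:: ord0] \in core. Proof. by []. Qed.

Lemma core_child j : [:: j; ord0; ord0] \in core.
Proof. by rewrite mem_cat; apply/orP; right; apply/mapP; exists j; rewrite // mem_enum. Qed.

Lemma leavesP w : reflect (exists i w', [/\ w = i :: w', w' \in core & ~~ in_core w])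
  (w \in leaves).
Proof.
rewrite mem_filter; apply: (iffP andP) => [[nw /allpairsP[[w' i] /= [cw _ E]]]|[i [w' [E cw nw]]]].
  by exists i, w'; split=> //; rewrite -E.
by split=> //; rewrite E; apply: allpairs_f; rewrite ?mem_enum.
Qed.

Lemma in_core_suffix s w : in_core (s ++ w) -> in_core w.
Proof. by elim: s => //= i s IH /in_core_behead/IH. Qed.

(** Otherwise one leaf would be a proper suffix of another one, hence a suffix of a core word; but
    [in_core] is closed under suffixes and leaves violate it. *)
Lemma leaves_disjoint s s' w w' : w \in leaves -> w' \in leaves ->
  s ++ w = s' ++ w' -> w = w'.
Proof.
wlog le : s s' w w' / (size w <= size w')%N => [H wl wl' E|].
  have [le|/ltnW le] := leqP (size w) (size w'); first exact: H le wl wl' E.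
  by apply/esym; exact: H le wl' wl (esym E).
move=> /leavesP[_ [_ [_ _ nw]]] /leavesP[i [v [w'E cv _]]] E.
rewrite w'E in le E *.
have [t tE] : exists t, i :: v = t ++ w.
  exists (drop (size s') s); have := congr1 (drop (size s')) E.
  rewrite (@drop_size_cat _ (size s') s' (i :: v) erefl) => <-; rewrite drop_cat.
  have Es := congr1 size E; rewrite !size_cat in Es.
  case: ltnP => // ss; have -> : (size s' - size s = 0)%N by lia.
  by rewrite drop0 drop_oversize.
case: t tE => [//|k t [_ tE]].
by move: (core_in_core cv); rewrite tE => /in_core_suffix; rewrite (negbTE nw).
Qed.

Lemma core_leaves_disjoint s w w' : w \in core -> w' \in leaves -> w <> s ++ w'.
Proof.
move=> /core_in_core cw /leavesP[_ [_ [_ _ nw]]] E; rewrite E in cw.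
by move: nw; rewrite (in_core_suffix cw).
Qed.

Context (R : realType).
Local Notation D := (dspace (source (tree b)) R).
Implicit Types (x : source (tree b) -> R).

Definition site_event T u w x := if w \in core
  then (ini x (true, w ++ u) = target w) /\ T < wait x (true, w ++ u) 0
  else kept (w ++ u) (~~ target (behead w)) T x.

Definition sites := undup (core ++ leaves).

Definition block_event T u x := forall w, w \in sites -> site_event T u w x.

Lemma mpred_ini_eq v (c : bool) : mpred (fun x : D => ini x v = c).
Proof.
case: c; first exact: mpred_ini.
apply: (@mpred_eq _ D (fun x => ~ ini x v)); last by apply: mpredN; exact: mpred_ini.
by move=> x; split=> [/negP/negbTE|->].
Qed.

Lemma cat_same (s s' t : seq 'I_b) : s ++ t = s' ++ t -> s = s'.
Proof.
by move=> /(congr1 rev); rewrite !rev_cat => /eqP; rewrite eqseq_cat// eqxx => /eqP/(can_inj revK).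
Qed.

Lemma measurable_site_event T u w : measurable ([set x | site_event T u w x] : set D).
Proof.
rewrite /site_event; case: (w \in core); last exact: measurable_kept.
apply: (@mpredI _ D (fun x => ini x _ = _) (fun x => T < _)).
  exact: mpred_ini_eq.
by apply: mpred_lt => //; exact: measurable_wait_coord.
Qed.

Lemma site_event_depends T u w :
  depends_on [set j | if w \in core then j.1 = (true, w ++ u)
    else exists s, j.1 = (true, s ++ (w ++ u))] [set x | site_event T u w x].
Proof.
rewrite /site_event; case: (w \in core); last exact: kept_depends.
by move=> x y xy [xi xw]; rewrite /= /ini /wait -!xy.
Qed.

Lemma measurable_block_event T u : measurable ([set x | block_event T u x] : set D).
Proof. by apply: (@mpred_in _ D) => w _; exact: measurable_site_event. Qed.

Lemma block_event_depends T u :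
  depends_on [set j | exists s, j.1 = (true, s ++ u)] [set x | block_event T u x].
Proof.
move=> x y xy H w ws; apply: site_event_depends (H w ws) => -[v o] /= E; apply: xy => /=.
move: E; case: ifP => _; first by exists w.
by move=> [s ->]; exists (s ++ w); rewrite catA.
Qed.

Section block_probability.
Context d (Omega : measurableType d) (P : probability Omega R).
Variable X : Omega -> source (tree b) -> R.
Hypothesis gX : glauber_data P X.

Lemma pr_core_site (T : R) w v : 0 < T ->
  2^-1 * expR (- T) <= pr P [set o | (ini (X o) v = target w) /\ T < wait (X o) v 0].
Proof.
move=> T0; have [mX iX _] := gX.
pose E1 : set (source (tree b) -> R) := [set x | ini x v = target w].
pose E2 : set (source (tree b) -> R) := [set x | T < wait x v 0].
have := @independent_depends _ _ _ _ P X [set (v, None)] [set (v, Some (true, 0%N))] E1 E2 mX iX.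
move=> ->.
- rewrite [pr P (X @^-1` E1)](pr_ini gX) ler_pM2l ?invr_gt0//; exact: (pr_wait_gt gX).
- by rewrite -subset0 => j [/= ->].
- exact: mpred_ini_eq.
- have : mpred (fun x : D => T < wait x v 0); last by [].
  by apply: mpred_lt => //; exact: measurable_wait_coord.
- by move=> x y xy; rewrite /E1 /= /ini xy.
- by move=> x y xy; rewrite /E2 /= /wait xy.
Qed.

Lemma pr_block_event (T : R) : 0 < T ->
  0 < pr P [set o | stays_up (@tree_nb b) (true, [::]) T (X o)] ->
  exists2 q, 0 < q & forall u, q <= pr P [set o | block_event T u (X o)].
Proof.
move=> T0 c0; set c := pr _ _ in c0; have [mX iX _] := gX.
(* The first bound is for a core site, the second for a branch. Neither depends on [u]. *)
pose r := Num.min (2^-1 * expR (- T)) c.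
have r0 : 0 < r by rewrite lt_min c0 mulr_gt0 ?invr_gt0 ?expR_gt0.
exists (r ^+ size sites) => [|u]; first exact: exprn_gt0.
apply: (@pr_all_ge _ _ _ _ P X mX iX _ sites (fun w => [set j | if w \in core then j.1 = (true, w ++ u)
    else exists s, j.1 = (true, s ++ (w ++ u))]) (fun w => [set x | site_event T u w x])).
- exact: undup_uniq.
- have mem_leaves w : w \in sites -> w \in core = false -> w \in leaves.
    by rewrite mem_undup mem_cat => /orP[->|].
  move=> w w' ws ws' ww'; rewrite -subset0 => -[v o] /= []; case: ifP => cw; case: ifP => cw'.
  + by move=> -> [] /cat_same/eqP; rewrite (negbTE ww').
  + move=> -> [s []]; rewrite catA => /cat_same/(core_leaves_disjoint cw).
    by apply; exact: mem_leaves.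
  + move=> [s ->] []; rewrite catA => /cat_same/esym/(core_leaves_disjoint cw').
    by apply; exact: mem_leaves.
  + move=> [s ->] [s' []] ; rewrite !catA => /cat_same/leaves_disjoint.
    by move=> /(_ (mem_leaves _ ws cw) (mem_leaves _ ws' cw'))/eqP; rewrite (negbTE ww').
- by move=> w _; exact: measurable_site_event.
- by move=> w _; exact: site_event_depends.
- exact: ltW.
move=> w _; rewrite /r ge_min; case: (boolP (w \in core)) => cw.
  apply/orP; left; rewrite (_ : X @^-1` _ = [set o | (ini (X o) (true, w ++ u) = target w) /\
    T < wait (X o) (true, w ++ u) 0]); first exact: pr_core_site.
  by rewrite /site_event cw.
apply/orP; right; rewrite (_ : X @^-1` _ = [set o | kept (w ++ u) (~~ target (behead w)) T (X o)]);
  last by rewrite /site_event (negbTE cw).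
 pose sd (v : tree b) := v.1.
have gB : glauber_data P (fun o => branch_data (w ++ u) (~~ target (behead w)) (X o)).
  by apply/glauber_data_reflect/glauber_data_reindex => //; exact: branch_inj.
have deg_gt0 : (0 < b.+1)%N by [].
have := pr_kept_up (side := sd) (z := (false, [::])) (w := (true, [::])) isT isT
  (@side_tree_nb b) deg_gt0 (@size_tree_nb b) gX (ltW T0).
move=> /le_trans; apply.
by rewrite (glauber_data_law gX gB (measurable_kept_up _ _ _ _ _)).
Qed.

End block_probability.

Section block_dynamics.
Variables (x : source (tree b) -> R) (sigma : R -> tree b -> bool) (T : R) (u : seq 'I_b).
Hypotheses (gx : good x) (dx : dynamics (@tree_nb b) x sigma) (T0 : 0 <= T).
Hypothesis bx : block_event T u x.

(** Core and branches support each other, and induction in time breaks the circle: until the ring at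
    hand the core has its prescribed spins, hence the branch roots agree with it from [T] on, hence
    at most one neighbour of the ringing vertex disagrees. Before [T] core vertices do not ring. *)
Lemma core_constant t w : 0 <= t -> w \in core -> sigma t (true, w ++ u) = target w.
Proof.
have [gc _ _] := gx; have [tx ix] := dx.
have cev v : v \in core -> (ini x (true, v ++ u) = target v) /\ T < wait x (true, v ++ u) 0.
  move=> cv; have := bx; move=> /(_ v); rewrite /site_event cv; apply.
  by rewrite mem_undup mem_cat cv.
pose U : seq (tree b) := [seq (true, v ++ u) | v <- core].
(* Cutting off the suffix [u] recovers the word relative to the block. *)
pose a (v : tree b) := target (take (size v.2 - size u) v.2).
have aE v : a (true, v ++ u) = target v by rewrite /a /= size_cat addnK take_size_cat.
suff H : forall t, 0 <= t -> forall v, v \in U -> sigma t v = a v.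
  by move=> t0 cw; rewrite H ?aE//; apply/mapP; exists w.
apply: (trajectory_invariant gc (tx U)).
  by move=> _ /mapP[v cv ->]; rewrite ix aE; case: (cev v cv).
move=> _ k /mapP[v cv ->] cst; rewrite aE.
have rT : T < ring x (true, v ++ u, k).
  have [_ Tw] := cev v cv; apply: lt_le_trans Tw _.
  have -> : wait x (true, v ++ u) 0 = ring x (true, v ++ u, 0%N).
    by rewrite /ring /ring_time big_ord1.
  by case: k {cst} => // k; rewrite ltW// ring_lt.
have [_ T2] := tx U; have vU : (true, v ++ u) \in U by apply/mapP; exists v.
have nT : \forall s \near (ring x (true, v ++ u, k))^'-, T < s < ring x (true, v ++ u, k).
  near=> s; apply/andP; split; near: s; first exact: nbhs_left_gt.
  exact: nbhs_left_lt.
have [s [E /andP[Ts sr]]] := @filter_ex _ _ (at_left_proper_filter _) _ (filterI (T2 _ k vU) nT).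
rewrite E {E}.
have s0 : 0 <= s by rewrite ltW// (le_lt_trans T0).
have core_s r w' : 0 <= r <= s -> w' \in core -> sigma r (true, w' ++ u) = target w'.
  move=> /andP[r0 rs] cw'; rewrite cst ?aE//; last by apply/mapP; exists w'.
  by rewrite r0 (le_lt_trans rs).
have leaf_s i w' : w' \in core -> ~~ in_core (i :: w') -> sigma s (true, i :: w' ++ u) = target w'.
  move=> cw' nw'; have lw' : i :: w' \in leaves by apply/leavesP; exists i, w'.
  have := bx; move=> /(_ (i :: w')); rewrite mem_undup mem_cat lw' orbT => /(_ isT).
  rewrite /site_event ifF; last by apply: contraNF nw' => /core_in_core.
  move=> ku; rewrite -[target w']negbK.
  apply: (kept_sigma gx dx T0 (S := s)) ku _; last by rewrite ltW/=.
  by move=> r r0s; rewrite negbK; exact: core_s.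
have nb1 : size (tree_nb ((true, v ++ u) : tree b)) = h.*2.+2 by rewrite size_tree_nb.
(* The only unreliable neighbour: the tied vertex, or the vertex below the block when [v] is its
   root. *)
pose z : tree b := if v is [:: _] then (true, ord0 :: ord0 :: u) else parent (true, v ++ u).
apply: update_majority.
(* All neighbours but one are a strict majority because [h] is positive, that is, the degree is at
   least 4. *)
have cnt n : (h.*2.+2 <= n.+1)%N -> (h.*2.+2 < n.*2)%N by lia.
rewrite nb1; apply: cnt; rewrite -nb1; apply: (count_but_one (z := z) (uniq_tree_nb _)) => y /tree_nbP[->|[i ->]].
  move: cv; rewrite /z !inE => /orP[/eqP ->|/orP[/eqP ->|/mapP[j _ ->]]]; rewrite ?eqxx//= => _.
  by rewrite (core_s s [::]) ?s0 ?lexx.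
have [ni _|ci] := boolP (~~ in_core (i :: v)); first by rewrite [X in sigma s X]/= leaf_s.
move: cv ci; rewrite /z !inE negbK => /orP[/eqP ->|/orP[/eqP ->|/mapP[j _ ->]]] //=.
  by move=> /eqP -> _; rewrite (core_s s [:: ord0]) ?s0 ?lexx.
by rewrite eqxx andbT => /eqP -> /eqP[].
Unshelve. all: end_near. Qed.

Lemma block_tie s : 0 <= s ->
  (count (sigma s) (tree_nb ((true, ord0 :: ord0 :: u) : tree b))).*2 =
  size (tree_nb ((true, ord0 :: ord0 :: u) : tree b)).
Proof.
move=> s0; rewrite size_tree_nb /= (core_constant s0 core_first).
rewrite count_map (eq_count (a2 := fun j : 'I_b => (j < h)%N)); last first.
  by move=> j /=; rewrite (core_constant s0 (core_child j)).
rewrite (_ : count _ _ = count (fun j : nat => (j < h)%N) (map val (enum 'I_b))); last first.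
  by rewrite count_map; exact: eq_count.
rewrite val_enum_ord.
suff -> : count (fun j : nat => (j < h)%N) (iota 0 b) = h by rewrite /=; lia.
by rewrite (_ : h.*2.+1 = h + h.+1)%N ?count_ltn_iota//; lia.
Qed.

End block_dynamics.

Lemma freezing_negligible_tree d (Omega : measurableType d) (P : probability Omega R)
    (X : Omega -> source (tree b) -> R) : glauber_data P X ->
  P.-negligible [set o | freezing (@tree_nb b) (X o)].
Proof.
move=> gX; have [[T pT]|nT] := pselect (exists T : nat,
    0 < pr P [set o | stays_up (@tree_nb b) (true, [::]) T.+1%:R (X o)]); last first.
  apply: (freezing_negligible_stays_up gX (w := (true, [::]))) => T.
  apply/eqP; rewrite eq_le pr_ge0 andbT leNgt; apply/negP => pT.
  by apply: nT; exists T.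
have [mX iX _] := gX; have T0 : 0 < T.+1%:R :> R by [].
have [q q0 Hq] := pr_block_event gX T0 pT.
(* Blocks hang off the ray of children [ord0] at different heights. The first letter other than
   [ord0], counted from the root, recovers [i] from any descendant, so the blocks use disjoint
   data. *)
pose u (i : nat) : seq 'I_b := ord_max :: nseq i ord0.
have um : ord_max != ord0 :> 'I_b by apply/eqP => /(congr1 val) /=; lia.
have uE s (i : nat) : find (predC1 ord0) (rev (s ++ u i)) = i.
  rewrite rev_cat /u rev_cons -cats1 -catA !find_cat.
  by rewrite rev_nseq has_nseq size_nseq /= ?eqxx andbF um addn0.
have n0 : P.-negligible [set o | forall n, ~ block_event T.+1%:R (u n) (X o)].
  apply: (negligible_none mX iX (S := fun n => [set j | exists s, j.1 = (true, s ++ u n)])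
    (E := fun n => [set x | block_event T.+1%:R (u n) x]) (q := q)) => //.
  - move=> n k nk; rewrite -subset0 => -[v o] /= [[s ->] [s' [E]]].
    by have := uE s n; rewrite E uE => kn; rewrite kn eqxx in nk.
  - by move=> n; exact: measurable_block_event.
  - by move=> n; exact: block_event_depends.
  - by move=> n; exact: Hq.
apply: negligibleS (negligibleU (good_ae gX) n0) => o [sigma [dx fx]].
have [gx|] := pselect (good (X o)); [right|by left].
move=> n bx; have [tx _] := dx; have [gc _ heads] := gx.
pose v : tree b := (true, ord0 :: ord0 :: u n).
apply: (tie_infinite_flips gc (tx [:: v]) (mem_head _ _) (heads v) (T := 0)) (fx v).
by move=> s; exact: (block_tie gx dx (ltW T0) bx).
Qed.

End tied_vertex.

(** * Degree two *)

Section line.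
Context (R : realType).
Local Notation D := (dspace (source int) R).
Implicit Types (x : source int -> R) (sigma : R -> int -> bool) (i v w : int) (T : nat).

Definition line_nb i : seq int := [:: i - 1; i + 1].

Lemma ball_line w n v : v \in ball line_nb w n -> `|v - w| + 1 <= n%:Z.
Proof.
elim: n w v => // n IH w v; rewrite inE => /predU1P[->|]; first by lia.
by rewrite /= cats0 mem_cat => /orP[] /IH; lia.
Qed.

Let shift (m v : int) : int := v + m.

Let shift_inj m : injective (shift m). Proof. by move=> u v /addIr. Qed.

Let site_near (n i j : nat) v :
  `|v - (i * n.*2.+1)%N%:Z| <= n%:Z -> `|v - (j * n.*2.+1)%N%:Z| <= n%:Z -> i = j.
Proof.
wlog ij : i j / (i < j)%N => [H|].
  by have [/H|/H + vi vj|//] := ltngtP i j; [exact|move/(_ vj vi)].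
have : (i.+1 * n.*2.+1 <= j * n.*2.+1)%N by rewrite leq_mul2r ij orbT.
by rewrite mulSn; lia.
Qed.

Lemma dynamics_shift m x sigma : dynamics line_nb x sigma ->
  dynamics line_nb (reindex (shift m) x) (fun t v => sigma t (v + m)).
Proof.
move=> [tx ix]; split=> [U|v]; last exact: ix.
have nbE v : map (shift m) (line_nb v) = line_nb (v + m).
  by rewrite /line_nb /shift /= addrAC [v + 1 + m]addrAC.
split=> [v s t _ s0 st H|v n _].
  by have [T1 _] := tx [:: v + m]; apply: T1; rewrite ?mem_head.
have [_ T2] := tx [:: v + m]; apply: filterS (T2 (v + m) n (mem_head _ _)) => p E.
by rewrite [LHS]E -(update_map _ _ _ (nbE v)).
Qed.

Lemma line_consensus x sigma : good x -> dynamics line_nb x sigma ->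
  (forall v, finite_set (flips sigma v)) ->
  exists b : bool, forall v, exists m : nat, forall t, m%:R <= t -> sigma t v = b.
Proof.
move=> gx dx fx; have [gc _ heads] := gx; have [tx _] := dx.
have [c Hc] := choice (fun v => freezing_settles gc dx (fx v)).
have [m Hm] := choice Hc.
have c2 i : c (i - 1) = c (i + 1).
  apply/eqP; apply: contraT => ne; pose T := maxn (m (i - 1)) (m (i + 1)).
  case: (tie_infinite_flips gc (tx [:: i]) (mem_head _ _) (heads i) (T := T%:R) _ (fx i)) => s Ts.
  rewrite /= !Hm; first by case: (c _) (c _) ne => -[].
    by apply: le_trans Ts; rewrite ler_nat leq_maxr.
  by apply: le_trans Ts; rewrite ler_nat leq_maxl.
have c1 i : c i = c (i + 1).
  pose T := maxn (m i) (maxn (m (i - 1)) (m (i + 1))).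
  have [_ inf _] := gc; have [k Tk] := inf i T%:R.
  have [_ T2] := tx [:: i].
  have nT : \forall s \near (ring x (i, k))^'-, T%:R < s by exact: nbhs_left_gt.
  have [s [E Ts]] := @filter_ex _ _ (at_left_proper_filter _) _ (filterI (T2 i k (mem_head _ _)) nT).
  rewrite -(Hm i (ring x (i, k))); last by apply: le_trans (ltW Tk); rewrite ler_nat leq_maxl.
  rewrite E; apply: update_majority; rewrite /= !Hm ?c2 ?eqxx//.
    by apply: le_trans (ltW Ts); rewrite ler_nat; lia.
  by apply: le_trans (ltW Ts); rewrite ler_nat; lia.
have c0 (n : nat) i : c (i + n%:Z) = c i.
  elim: n => [|n IH]; first by rewrite addr0.
  by rewrite -IH [RHS]c1; congr c; lia.
exists (c 0) => v; exists (m v) => t mt; rewrite Hm//.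
case: v {mt} => n; first by rewrite -[Posz n]add0r c0.
by rewrite -(c0 n.+1 (Negz n)); congr c; rewrite NegzE; lia.
Qed.

Lemma held_up_later U Z w (S T T' : R) x : T <= S -> S <= T' ->
  held_up line_nb x U Z w T T' -> held_up line_nb x U Z w S T'.
Proof.
move=> TS ST' [l1 [l2 [r1 r2 st]]].
have [i il ri] := ringlist_prefix TS ST' r1 r2.
exists (l1 ++ take i l2), (drop i l2).
have E : (l1 ++ take i l2) ++ drop i l2 = l1 ++ l2 by rewrite -catA cat_take_drop.
rewrite E; split=> //; have := st => /steadyP; rewrite size_map size_cat leq_addr => /(_ isT) H.
apply/steadyP; first by rewrite size_map !size_cat leq_add2l size_takel.
move=> j; rewrite size_map !size_cat => /andP[j1 j2]; apply: H.
by rewrite j2 andbT (leq_trans _ j1) ?leq_addr.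
Qed.

Lemma stays_maybe_up x w (T0 T n : nat) : (T0 <= T)%N -> stays_up line_nb w T0%:R x ->
  maybe_up line_nb w T%:R n x.
Proof.
move=> TT H; have [|nc] := pselect (chain line_nb x (ball line_nb w n) n w T%:R); [by left|right].
have := H (T - T0)%N n; rewrite natrB// addrC subrK => /(_ nc).
by apply: held_up_later => //; rewrite ler_nat.
Qed.

Context d (Omega : measurableType d) (P : probability Omega R).
Variable X : Omega -> source int -> R.
Hypothesis gX : glauber_data P X.
Hypothesis dX : {ae P, forall o, exists sigma, dynamics line_nb (X o) sigma}.

Lemma pr_chain_line w (t e : R) : 0 < e -> exists n,
  pr P [set o | chain line_nb (X o) (ball line_nb w n) n w t] <= e.
Proof.
move=> e0; have [N HN] := @pr_chain_small _ line_nb 2 isT (fun=> erefl) _ _ _ P X gX w t e e0.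
by exists N; exact: HN.
Qed.

(** The event and its reflection are equally likely. When there is no chain they exclude each other,
    as a trajectory has one spin at time [T], and a chain has probability at most 1 / 2. Hence twice
    the probability is at most 1 + 1 / 2. *)
Lemma pr_maybe_up (T : nat) : exists n,
  pr P [set o | maybe_up line_nb 0 T%:R n (X o)] <= 3 / 4.
Proof.
have [|n Hn] := @pr_chain_line 0 T%:R 2^-1; first by rewrite invr_gt0.
exists n; set M := [set o | maybe_up _ _ _ _ _].
pose M' := [set o | maybe_up line_nb 0 T%:R n (reflect_spins true (X o))].
set C := [set o | chain _ _ _ _ _ _] in Hn.
have gR := glauber_data_reflect true gX.
have mS := measurable_maybe_up line_nb 0 (T%:R : R) n.
have mM : measurable M by exact: (glauber_measurable gX mS).
have mM' : measurable M' by exact: (glauber_measurable gR mS).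
have mC : measurable C by exact: (glauber_measurable gX (measurable_chain line_nb _ _ _ _)).
have MM' : pr P M = pr P M' by exact: (glauber_data_law gX gR mS).
have MC : pr P (M `&` M') <= 2^-1.
  apply: le_trans Hn; rewrite (prID P (measurableI _ _ mM mM') mC) -[leRHS]addr0.
  apply: lerD; first by apply: pr_le; [by do ?apply: measurableI|by []|by move=> o []].
  suff /negligibleP : P.-negligible ((M `&` M') `\` C).
    by move=> /(_ (measurableD (measurableI _ _ mM mM') mC)); rewrite /pr => ->.
  apply: negligibleS (negligibleU (good_ae gX) dX) => o [[Mo M'o] nCo].
  apply: contrapT => /not_orP[/contrapT gx /contrapT [sigma dx]].
  have [gc _ _] := gx; have [tx ix] := dx.
  have [gc' _ _] := good_reflect true gx; have [tx' ix'] := dynamics_reflect true gx dx.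
  have := maybe_up_sigma gc' (ler0n _ _) tx' ix' nCo M'o.
  by rewrite (maybe_up_sigma gc (ler0n _ _) tx ix nCo Mo).
have := pr_le1 P (measurableU _ _ mM (measurableD mM' mM)).
rewrite prU//; [|exact: measurableD|by rewrite setDE setICA setICr setI0].
have := prID P mM' mM; rewrite setIC -MM'; lra.
Qed.

(** These events decrease to the empty set as [T] grows, so late settling is unlikely for large
    [T]. *)
Let up_late (T : nat) := [set x : source int -> R | (exists T0 : nat, stays_up line_nb 0 T0%:R x) /\
  ~ exists2 T0 : nat, (T0 <= T)%N & stays_up line_nb 0 T0%:R x].

Let measurable_up_late T : measurable (up_late T : set D).
Proof.
have mS (T0 : nat) : mpred (fun x : D => stays_up line_nb 0 T0%:R x).
  exact: measurable_stays_up.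
apply: (@mpredI _ D (fun x => exists T0 : nat, stays_up line_nb 0 T0%:R x)
  (fun x => ~ exists2 T0 : nat, (T0 <= T)%N & stays_up line_nb 0 T0%:R x)).
  exact: mpred_exists.
apply: mpredN; apply: (@mpred_eq _ D (fun x => exists T0 : nat,
    (T0 <= T)%N /\ stays_up line_nb 0 T0%:R x)).
  by move=> x; split=> [[T0 [? ?]]|[T0 ? ?]]; exists T0.
by apply: mpred_exists => T0; apply: (@mpredI _ D (fun=> (T0 <= T)%N : Prop)) => //; exact: mpred_cst.
Qed.

Lemma pr_up_late (e : R) : 0 < e -> exists T : nat, pr P (X @^-1` up_late T) < e.
Proof.
move=> e0; pose F T := X @^-1` up_late T.
have mF T : measurable (F T) by exact: (glauber_measurable gX).
have niF : nonincreasing_seq F.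
  apply/nonincreasing_seqP => T; apply/subsetPset => o [ex nle]; split=> //.
  by move=> [T0 T0T sT0]; apply: nle; exists T0 => //; exact: leqW.
have F0 : \bigcap_T F T = set0.
  rewrite -subset0 => o H; have [[T0 sT0] _] := H 0%N I.
  by have [_] := H T0 I; apply; exists T0.
have fF : (P (F 0%N) < +oo)%E by rewrite ltey_eq fin_num_measure.
have := nonincreasing_cvg_mu fF mF (bigcapT_measurable mF) niF.
rewrite F0 measure0 => /fine_cvgP[_ /(@cvgr_lt _ _ _ _ _ _) H].
have [n _ /(_ n (leqnn _))] := H _ e0; by exists n.
Qed.

Lemma freezing_negligible_line : P.-negligible [set o | freezing line_nb (X o)].
Proof.
suff : P.-negligible [set o | good (X o) /\ freezing line_nb (X o)].
  move=> n; apply: negligibleS (negligibleU (good_ae gX) n) => o fo.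
  by have [?|] := pselect (good (X o)); [right|left].
have [mX iX _] := gX.
apply: pr_negligible_small => e e0.
(* For each of the two limits, e / 4 is allotted to agreement at all [k] sites and e / 4 to late
   settling at one of them. The order of choices matters: [T] depends on [k], and the radius [n]
   depends on [T]. *)
have [k Hk] : exists k : nat, (3 / 4) ^+ k < e / 4.
  by apply: expr_small; [lra|rewrite divr_gt0].
have [T HT] : exists T : nat, pr P (X @^-1` up_late T) < e / (4 * k.+1%:R).
  by apply: pr_up_late; rewrite divr_gt0 ?mulr_gt0.
have [n Hn] := pr_maybe_up T.
(* At this spacing the intervals of radius [n] around the sites are disjoint, so the local events
   are independent. *)
pose site (i : nat) : int := (i * n.*2.+1)%:Z.
pose Y (b : bool) (i : nat) x : source int -> R := reflect_spins b (reindex (shift (site i)) x).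
have gY b (i : nat) : glauber_data P (fun o => Y b i (X o)).
  by apply/glauber_data_reflect/glauber_data_reindex.
pose B b := [set o | exists2 i : nat, i \in iota 0 k & up_late T (Y b i (X o))].
pose F b := [set o | forall i : nat, i \in iota 0 k -> maybe_up line_nb 0 T%:R n (Y b i (X o))].
have mYl b (i : nat) : measurable [set o | up_late T (Y b i (X o))].
  exact: (glauber_measurable (gY b i)).
have mB b : measurable (B b) by apply: (measurable_exists_in (F := fun i : nat => [set o | up_late T (Y b i (X o))])) => i _; exact: mYl.
have mM := measurable_maybe_up line_nb 0 (T%:R : R) n.
have mF b : measurable (F b).
  by apply: mpred_in => i _; exact: (glauber_measurable (gY b i) mM).
have prB b : pr P (B b) <= k%:R * (e / (4 * k.+1%:R)).
  apply: le_trans (pr_exists_le P _) _; first by move=> i _; exact: mYl.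
  rewrite (eq_bigr (fun=> pr P (X @^-1` up_late T))); last first.
    by move=> i _; apply: (glauber_data_law (gY b i) gX).
  rewrite big_const_seq count_predT size_iota iter_addr_0 -[leLHS]mulr_natl.
  by rewrite ler_wpM2l// ltW.
have prF b : pr P (F b) <= (3 / 4) ^+ k.
  rewrite -(size_iota 0 k).
  apply: (pr_all_le mX iX (S := fun i : nat => [set j | `|j.1 - site i| <= n%:Z])
    (E := fun i : nat => [set x | maybe_up line_nb 0 T%:R n (Y b i x)])).
  - exact: iota_uniq.
  - move=> i j _ _ ij; rewrite -subset0 => -[v o] /= [vi vj].
    by move: ij; rewrite (site_near vi vj) eqxx.
  - by move=> i _; exact: measurable_relabel.
  - have dep : depends_on [set j | `|j.1| <= n%:Z] [set x : source int -> R | maybe_up line_nb 0 T%:R n x].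
      apply: (@maybe_up_depends int line_nb R [set v : int | `|v| <= n%:Z]); first by rewrite /= normr0.
      move=> v /ball_line; rewrite subr0 => vn; split=> /= [|y]; first by lia.
      by rewrite !inE => /orP[] /eqP ->; lia.
    move=> i _ x y xy; apply: dep => -[v o] /= vn.
    by rewrite /Y /reflect_spins /reindex /= xy//= /shift addrK.
  - move=> i _; apply: le_trans Hn; rewrite le_eqVlt; apply/orP; left; apply/eqP.
    exact: (glauber_data_law (gY b i) gX).
exists ((B true `|` F true) `|` (B false `|` F false)); split.
- by apply: measurableU; exact: measurableU.
- move=> o [gx [sigma [dx fx]]]; have [b Hb] := line_consensus gx dx fx.
  suff : (B (~~ b) `|` F (~~ b)) o by case: (b); [right|left].
  have up (i : nat) : exists m : nat, stays_up line_nb 0 m%:R (Y (~~ b) i (X o)).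
    have [m Hm] := Hb (site i); exists m; apply: dynamics_stays_up (dynamics_shift (site i) dx) _.
      by exact: good_reindex gx.
    by move=> t mt; rewrite add0r Hm.
  have [|nB] := pselect (B (~~ b) o); [by left|right].
  move=> i ik; have [T0 T0T sT0] : exists2 T0 : nat, (T0 <= T)%N & stays_up line_nb 0 T0%:R (Y (~~ b) i (X o)).
    by apply: contrapT => ne; apply: nB; exists i.
  exact: stays_maybe_up sT0.
have kk : k%:R * (e / (4 * k.+1%:R)) <= e / 4.
  have E (y : R) : y != 0 -> e / 4 = y * (e / (4 * y)) by move=> y0; field.
  rewrite [leRHS](E k.+1%:R) ?pnatr_eq0//.
  by rewrite ler_wpM2r ?ler_nat// divr_ge0 ?mulr_ge0// ltW.
have prBF b : pr P (B b `|` F b) < e / 2.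
  apply: le_lt_trans (prU_le P (mB b) (mF b)) _.
  by have := le_trans (prB b) kk; have := le_lt_trans (prF b) Hk; lra.
apply: le_lt_trans (prU_le P (measurableU _ _ (mB _) (mF _)) (measurableU _ _ (mB _) (mF _))) _.
by have := prBF true; have := prBF false; lra.
Qed.

End line.

Section line_in_tree.

(** Degree two is treated on the integers for the sake of translations; 0 and -1 are the two ends of
    the distinguished edge. *)
Definition line_to_tree (i : int) : tree 1 :=
  match i with Posz n => (true, nseq n ord0) | Negz n => (false, nseq n ord0) end.

Lemma line_to_tree_inj : injective line_to_tree.
Proof.
by move=> [m|m] [n|n] //= [] /(congr1 size); rewrite !size_nseq => ->.
Qed.

Lemma tree_nb_line i : tree_nb (line_to_tree i) =i map line_to_tree (line_nb i).
Proof.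
have E v : tree_nb (v : tree 1) =i [:: parent v; child v ord0].
  move=> y; apply/tree_nbP/idP => [[->|[j ->]]|]; rewrite ?ord1 !inE ?eqxx ?orbT//.
  by move=> /orP[/eqP ->|/eqP ->]; [left|right; exists ord0].
move=> y; rewrite E /line_nb !map_cons; case: i => [[|n]|n].
- by [].
- rewrite (_ : n.+1%:Z - 1 = n%:Z)//; last by lia.
  by rewrite (_ : n.+1%:Z + 1 = n.+2%:Z)//; lia.
- rewrite (_ : Negz n - 1 = Negz n.+1)//; last by rewrite !NegzE; lia.
  rewrite !inE orbC; congr (_ || _); case: n => [|n] //.
  by rewrite (_ : Negz n.+1 + 1 = Negz n)// !NegzE; lia.
Qed.

End line_in_tree.

(** * Transfer to the given graph and dynamics *)

Section conclusion.
Context (R : realType) (disp : measure_display) (Omega : measurableType disp).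
Context (P : probability Omega R) (V : choiceType) (e : rel V).
Variables (tau : V -> nat -> {RV P >-> R}) (coin : V -> nat -> {RV P >-> bool}).
Variable sigma : R -> V -> {RV P >-> bool}.
Hypothesis hdyn : glauber_dynamics e tau coin sigma.
Hypothesis hinit : iid_symmetric_spins (sigma 0).
Variables (G : countType) (nb : G -> seq G) (phi : G -> V).
Hypotheses (phi_inj : injective phi) (nb_uniq : forall v, uniq (nb v)).
Hypothesis phi_nb : forall v, neighbors e (phi v) = [set` map phi (nb v)].

Let X := pulled_data (sigma 0) tau coin phi.

Lemma pulled_data_glauber : glauber_data P X.
Proof. by have [h1 h2 h3 _] := hdyn; exact: pulled_glauber_data. Qed.

Lemma pulled_data_dynamics :
  {ae P, forall o, dynamics nb (X o) (fun t v => sigma t (phi v) o)}.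
Proof.
have [_ _ _ tr] := hdyn; apply: filterS tr => o tr; split; last first.
  by move=> v; rewrite /ini /X /pulled_data /= sgn_gt0.
move=> U; apply: (trajectory_pull_back phi_inj nb_uniq phi_nb _ _ _ tr) => // v k.
by rewrite /flip /X /pulled_data /= sgn_gt0.
Qed.

Lemma infinite_flips_ae : P.-negligible [set o | freezing nb (X o)] ->
  {ae P, forall w, ~ freezes (fun t x => sigma t x w) /\
     exists x : V, infinite_set (flip_times (fun t y => sigma t y w) x)}.
Proof.
move=> nf; apply: negligibleS (negligibleU nf pulled_data_dynamics) => o H.
apply: contrapT => /not_orP[nfo /contrapT dx]; apply: H.
have [v Hv] : exists v, infinite_set (flips (fun t v => sigma t (phi v) o) v).
  apply: contrapT => nv; apply: nfo; exists (fun t v => sigma t (phi v) o); split=> // v.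
  by apply: contrapT => nfv; apply: nv; exists v.
by split=> [/(_ (phi v))//|]; exists (phi v).
Qed.

End conclusion.

Theorem theorem39 (R : realType) (disp : measure_display)
    (Omega : measurableType disp) (P : probability Omega R)
    (V : choiceType) (e : rel V) (d : nat)
    (tau : V -> nat -> {RV P >-> R}) (coin : V -> nat -> {RV P >-> bool})
    (sigma : R -> V -> {RV P >-> bool})
    (hd2 : (2 <= d)%N) (hd : ~~ odd d)
    (htree : is_tree e) (hreg : is_regular e d)
    (hdyn : glauber_dynamics e tau coin sigma)
    (hinit : iid_symmetric_spins (sigma 0)) :
  {ae P, forall w, ~ freezes (fun t x => sigma t x w) /\
     exists x : V, infinite_set (flip_times (fun t y => sigma t y w) x)}.
Proof.
have [h dE] : exists h, d = h.*2.+2.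
  exists d./2.-1; have := odd_double_half d; rewrite (negbTE hd); lia.
rewrite dE in hreg; have [phi [phi_inj phi_nb]] := tree_embedding htree hreg.
(* The model tree has branching [h.*2.+1], so [h = 0] is exactly degree two. *)
have [h0|h_gt0] := posnP h; last first.
  apply: (infinite_flips_ae hdyn phi_inj (@uniq_tree_nb _) phi_nb).
  exact: (freezing_negligible_tree h_gt0 (pulled_data_glauber hdyn hinit phi_inj)).
rewrite h0 in phi phi_inj phi_nb.
pose psi i := phi (line_to_tree i).
have psi_inj : injective psi by move=> i j /phi_inj/line_to_tree_inj.
have line_uniq i : uniq (line_nb i) by rewrite /= inE andbT; lia.
have psi_nb i : neighbors e (psi i) = [set` map psi (line_nb i)].
  rewrite phi_nb (map_comp phi line_to_tree).
  by apply/funext => y; apply/propext; rewrite /mkset (eq_mem_map phi (tree_nb_line i)).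
apply: (infinite_flips_ae hdyn psi_inj line_uniq psi_nb).
apply: (freezing_negligible_line (pulled_data_glauber hdyn hinit psi_inj)).
apply: filterS (pulled_data_dynamics hdyn psi_inj line_uniq psi_nb) => o dx.
by eexists; exact: dx.
Qed.
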